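(* Consider the model $y_i(t_{i,j})=x_i^{\top}\beta(t_{i,j})+\xi_i(t_{i,j})+\epsilon_i(t_{i,j})$, $i=1,\dots,n$, $j=1,\dots,m_i$, with $s_\beta=p<n$. Let $M=\operatorname{diag}(m_1,\dots,m_n)$. Assume: (i) $t_{i,j}$ are i.i.d. uniform on $(0,1)$ and independent of the errors $\epsilon_i(t_{i,j})$; the errors are i.i.d. with mean zero and variance $\sigma_\epsilon^2$; (ii) each coordinate of $\beta(\cdot)$ satisfies $\beta_k(\cdot)\in W^{\mathrm{per}}(\alpha,R)$ for some constants $\alpha\ge2$, $R>0$, with $s_\beta$ coordinates nonzero; moreover $x_i^{\top}\beta(\cdot)\in W^{\mathrm{per}}(\alpha,O(g(n)))$ uniformly in $i$ and $\sup_{i=1,\dots,n}\int_0^1(x_i^{\top}\beta(t))^2dt=O(g(n))$ for some function $g(n)$; (iii) $(\xi_i(\cdot))_{i=1}^n\subseteq W^{\mathrm{per}}(\alpha,R)$ almost surely and are i.i.d., with $\mathbb{E}\xi_i(t)=0$ for all $t\in(0,1)$ and $\mathbb{E}\int_0^1\xi_i^2(t)dt<\infty$. Then the least squares projection estimator $\hat\beta^{LD}$ with truncation level $K_\beta$ (defined in the context) satisfies $$\mathrm{MISE}(\hat\beta^{LD})=\operatorname{tr}\Big((X^{\top}X)^{-1}X^{\top}\big(O(1)I_n+O(g(n)K_\beta)M^{-1}\big)X(X^{\top}X)^{-1}\Big)+O(s_\beta K_\beta^{-2\alpha}).$$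
   Context: All quantities may depend on $n$ (triangular array); $O$ refers to $n\to\infty$. Here $x_i\in\mathbb{R}^p$ are time invariant covariates (with distribution not depending on time), $X\in\mathbb{R}^{n\times p}$ has rows $x_i^{\top}$, $\beta:(0,1)\to\mathbb{R}^p$ is the coefficient function, $\xi_i:(0,1)\to\mathbb{R}$ are individual functional random effects, $\epsilon_i(t_{i,j})$ are independent errors and $t_{i,j}\in(0,1)$ are sampling times. $\mathbb{E}$ is expectation over $(\xi_i)$ and $(\epsilon_i)$; $\mathbb{T}$ is expectation over the sampling times. Trigonometric basis: $\phi_1(t)=1$, $\phi_k(t)=\sqrt2\cos(\pi kt)$ for even $k$, $\phi_k(t)=\sqrt2\sin(\pi(k-1)t)$ for odd $k\ge3$. $W^{\mathrm{per}}(\alpha,R)$ is the periodic Sobolev class: functions $f$ on $[0,1]$ with $f^{(\alpha-1)}$ absolutely continuous, $\int_0^1(f^{(\alpha)})^2\le R^2$ and $f^{(j)}(0)=f^{(j)}(1)$ for $j=0,\dots,\alpha-1$; equivalently, the Fourier coefficients $\theta_k$ of $f$ in the basis $(\phi_k)$ satisfy $\sum_k a_k^2\theta_k^2\le R^2/\pi^{2\alpha}$ with $a_k=k^\alpha$ ($k$ even), $a_k=(k-1)^\alpha$ ($k$ odd). Estimator: the projected observations are $\omega_{i,k}=m_i^{-1}\sum_{j=1}^{m_i}y_i(t_{i,j})\phi_k(t_{i,j})$ and $\Omega_k=(\omega_{1,k},\dots,\omega_{n,k})^{\top}$. Set $\hat\beth_k^{LD}=(X^{\top}X)^{-1}X^{\top}\Omega_k$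 for $k=1,\dots,K_\beta$ and $\hat\beth_k^{LD}=0$ for $k>K_\beta$, and $\hat\beta^{LD}(\cdot)=\sum_{k\ge1}\hat\beth_k^{LD}\phi_k(\cdot)$. The mean integrated squared error is $\mathrm{MISE}(\hat\beta)=\mathbb{T}\,\mathbb{E}\int_0^1\|\hat\beta(t)-\beta(t)\|_2^2dt$.
   Formalization: The formal theorem additionally assumes that g(n) is bounded away from zero for large n (1 = O(g(n))), that σ_ε² = O(1), and that E∫ξ_i² is bounded uniformly in n; with g(n)→0 and unit noise variance the claim as stated is false. *)

(* Defs.v *)
From HB Require Import structures.
From mathcomp Require Import all_boot all_order all_algebra.
From mathcomp Require Import all_classical all_reals all_analysis.

Set Implicit Arguments.
Unset Strict Implicit.
Unset Printing Implicit Defensive.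

Import Order.TTheory GRing.Theory Num.Theory.
Import numFieldNormedType.Exports.

Local Open Scope classical_set_scope.
Local Open Scope ring_scope.

(** The value of [phi 0] is junk: the basis is indexed from 1. *)
Definition phi {R : realType} (k : nat) (t : R) : R :=
  if k == 1%N then 1
  else if odd k then Num.sqrt 2 * sin (pi * k.-1%:R * t)
  else Num.sqrt 2 * cos (pi * k%:R * t).

(** [g] is the derivative of [f] on [0, 1], one-sided at the endpoints. *)
Definition derivative01 {R : realType} (f g : R -> R) : Prop :=
  forall x : R, x \in `[0, 1] ->
    (y - x)^-1 * (f y - f x) @[y --> within `[0, 1] x^'] --> g x.

Definition abs_continuous01 {R : realType} (f : R -> R) : Prop :=
  forall e : R, 0 < e -> exists2 d : R, 0 < d &
    forall (k : nat) (a b : 'I_k -> R),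
      (forall i, 0 <= a i /\ a i <= b i /\ b i <= 1) ->
      trivIset setT (fun i => `]a i, b i[%classic) ->
      \sum_(i < k) (b i - a i) < d ->
      \sum_(i < k) `|f (b i) - f (a i)| < e.

(** [Wper alpha L f] : the restriction of [f] to (0, 1) is (the restriction of)
    a member of W^per(alpha, L).  [D j] is the j-th derivative on [0, 1];
    [D 0] may differ from [f] at the endpoints, where [f] carries no
    information.  [D alpha] is a Borel version of the derivative of the
    absolutely continuous [D alpha.-1], which exists only almost everywhere.
    Meant for [alpha] positive. *)
Definition Wper {R : realType} (alpha : nat) (L : R) (f : R -> R) : Prop :=
  exists D : nat -> R -> R,
    [/\ forall x : R, x \in `]0, 1[ -> D 0%N x = f x,
        forall j, (j.+1 < alpha)%N -> derivative01 (D j) (D j.+1),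
        abs_continuous01 (D alpha.-1),
        [/\ measurable_fun `[0 : R, 1] (D alpha),
            \forall x \ae (@lebesgue_measure R),
              x \in `]0 : R, 1[ -> is_derive x 1 (D alpha.-1) (D alpha x)
          & (\int[lebesgue_measure]_(x in `[0%R : R, 1%R]) ((D alpha x) ^+ 2)%:E
               <= (L ^+ 2)%:E)%E]
      & forall j, (j < alpha)%N -> D j 0 = D j 1].

Section Independence.
Context {d : measure_display} {T : measurableType d} {R : realType}.
Variable P : probability T R.

Definition mutually_independent (I : finType) (G : I -> set_system T) : Prop :=
  forall (J : {set I}) (A : I -> set T),
    (forall i, i \in J -> G i (A i)) ->
    P (\bigcap_(i in [set` J]) A i) = (\prod_(i in J) P (A i))%E.

Definition sigma_of_rv (X : T -> R) : set_system T :=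
  preimage_set_system setT X measurable.

Definition sigma_of_process (X : T -> R -> R) : set_system T :=
  <<s \bigcup_(t in `]0, 1[%classic) sigma_of_rv (X ^~ t) >>.

(** Equality in law as random functions on (0, 1): the finite-dimensional
    distributions determine the law on the cylinder sigma-algebra. *)
Definition process_eqd (X Y : T -> R -> R) : Prop :=
  forall (k : nat) (s : 'I_k -> R) (B : 'I_k -> set R),
    (forall l, s l \in `]0, 1[) -> (forall l, measurable (B l)) ->
    P [set w | forall l, B l (X w (s l))] =
    P [set w | forall l, B l (Y w (s l))].

End Independence.

(** The [n]-th row of the triangular array.  The sampling times live on their
    own probability space: they are thereby independent of the random effects
    and of the errors, and averaging over times and over noise are separate
    integrals.  Nothing is assumed on the joint law of [xi] and [eps].
    [eps i j] is the error at the j-th sampling time of individual i, and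
    [trunc] is the truncation level of the estimator.  Only the values of
    [beta] and of the paths of [xi] on (0, 1) are meaningful. *)
Record sample (R : realType) (n : nat) := Sample {
  ncov : nat;
  nobs : 'I_n -> nat;
  trunc : nat;
  design : 'M[R]_(n, ncov);
  beta : R -> 'cV[R]_ncov;
  times_disp : measure_display;
  times_space : measurableType times_disp;
  times_prob : probability times_space R;
  time : forall i : 'I_n, 'I_(nobs i) -> {RV times_prob >-> R};
  noise_disp : measure_display;
  noise_space : measurableType noise_disp;
  noise_prob : probability noise_space R;
  xi : 'I_n -> noise_space -> R -> R;
  eps : forall i : 'I_n, 'I_(nobs i) -> {RV noise_prob >-> R};
  sigma2 : R
}.

Arguments nobs {R n} s i.
Arguments design {R n} s.
Arguments beta {R n} s t.
Arguments times_prob {R n} s.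
Arguments time {R n} s i j.
Arguments noise_prob {R n} s.
Arguments xi {R n} s i w t.
Arguments eps {R n} s i j.

Section Model.
Context {R : realType} {n : nat}.
Variable S : sample R n.

Definition xbeta (i : 'I_n) (t : R) : R := (design S *m beta S t) i ord0.

Definition betac (l : 'I_(ncov S)) (t : R) : R := beta S t l ord0.

(** Number of coordinates of [beta] that are not identically zero. *)
Definition sbeta : nat :=
  #|[set l : 'I_(ncov S) |
     `[< exists2 t : R, t \in `]0, 1[ & betac l t != 0 >]]|.

Definition Mdiag : 'M[R]_n := diag_mx (\row_i (nobs S i)%:R).

Definition gram_inv : 'M[R]_(ncov S) := invmx ((design S)^T *m design S).

Section Estimator.
Variables (u : times_space S) (w : noise_space S).

Definition obs (i : 'I_n) (j : 'I_(nobs S i)) : R :=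
  xbeta i (time S i j u) + xi S i w (time S i j u) + eps S i j w.

Definition Omegak (k : nat) : 'cV[R]_n :=
  \col_i ((nobs S i)%:R^-1 *
          \sum_(j < nobs S i) obs j * phi k (time S i j u)).

Definition hat_beth (k : nat) : 'cV[R]_(ncov S) :=
  if (1 <= k <= trunc S)%N then gram_inv *m (design S)^T *m Omegak k else 0.

(** The coefficients beyond [trunc S] vanish, so the series is a finite sum. *)
Definition hat_beta (t : R) : 'cV[R]_(ncov S) :=
  \sum_(1 <= k < (trunc S).+1) phi k t *: hat_beth k.

Definition ISE : \bar R :=
  (\int[lebesgue_measure]_(t in `]0%R, 1%R[)
     (\sum_(l < ncov S) (hat_beta t l ord0 - betac l t) ^+ 2)%:E)%E.

End Estimator.

Definition MISE : \bar R :=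
  (\int[times_prob S]_u \int[noise_prob S]_w ISE u w)%E.

Definition well_posed : Prop :=
  [/\ (ncov S < n)%N, (design S)^T *m design S \in unitmx,
      forall i, (0 < nobs S i)%N & (0 < trunc S)%N].

Definition times_iid_uniform : Prop :=
  [/\ forall i j u, time S i j u \in `]0, 1[,
      forall i j (B : set R), measurable B ->
        distribution (times_prob S) (time S i j) B = uniform_prob (@ltr01 R) B
    & mutually_independent (times_prob S)
        (fun ij : {i : 'I_n & 'I_(nobs S i)} =>
           sigma_of_rv (time S (tag ij) (tagged ij)))].

Definition errors_iid : Prop :=
  [/\ forall i j i' j' (B : set R), measurable B ->
        distribution (noise_prob S) (eps S i j) B =
        distribution (noise_prob S) (eps S i' j') B,
      mutually_independent (noise_prob S)
        (fun ij : {i : 'I_n & 'I_(nobs S i)} =>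
           sigma_of_rv (eps S (tag ij) (tagged ij))),
      forall i j, ('E_(noise_prob S)[eps S i j] = 0)%E
    & forall i j, 'V_(noise_prob S)[eps S i j] = (sigma2 S)%:E].

(** The random effects are measurable processes, so that [obs] is a random
    variable. *)
Definition effects_iid_centered : Prop :=
  [/\ forall i, measurable_fun
        (setT `*` `]0, 1[ : set (noise_space S * measurableTypeR R))
        (fun wt => xi S i wt.1 wt.2),
      mutually_independent (noise_prob S)
        (fun i : 'I_n => sigma_of_process (xi S i)),
      forall i i', process_eqd (noise_prob S) (xi S i) (xi S i')
    & forall i (t : R), t \in `]0, 1[ ->
        ('E_(noise_prob S)[xi S i ^~ t] = 0)%E].

End Model.

Arguments xbeta {R n} S i t.
Arguments betac {R n} S l t.

(* Main.v *)
Require Import Defs.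
From HB Require Import structures.
From mathcomp Require Import all_boot all_order all_algebra.
From mathcomp Require Import all_classical all_reals all_analysis.
From mathcomp Require Import measurable_realfun lebesgue_integral_differentiation.
From mathcomp Require Import zify ring lra.

Import Order.TTheory GRing.Theory Num.Theory.
Import numFieldNormedType.Exports.

Set Implicit Arguments.
Unset Strict Implicit.
Unset Printing Implicit Defensive.

Local Open Scope classical_set_scope.
Local Open Scope ring_scope.

(** Let H = (X^T X)^-1 X^T, so that H X = 1.  The error of the k-th estimated
    coefficient of the l-th coordinate is the sum over i of H_li times the
    sampling error of the signal x_i^T beta + xi_i, plus the k-th coefficient of
    xi_i, plus an average of errors.  The first and the last of these have mean
    squares O(g / m_i) and O(1 / m_i) for each of the K frequencies, because
    distinct observations are uncorrelated.  The coefficients of the xi_i are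
    uncorrelated between individuals, and the sum over k of their mean squares
    is at most the mean energy of xi_i by Bessel's inequality, whence no factor
    K there.

    For the truncation error, integration by parts turns the coefficients of f
    into those of its alpha-th derivative divided by the alpha-th power of the
    frequency, and Bessel's inequality bounds the tail.  The Fourier series of f
    converges to f pointwise (Dirichlet kernel and Riemann-Lebesgue), so Fatou's
    lemma transfers this bound to the remainder.

    This yields an upper bound of the asserted shape.  As the MISE lies between
    0 and this bound, multiplying the three constants by their ratio gives the
    equality. *)

(** * Square integrable functions *)

(** Random effects and errors may be dependent, so the three parts of a coefficient error cannot be
    treated as orthogonal; they are separated by [(x + y + z)^2 <= 3 (x^2 + y^2 + z^2)]. With the 2
    that splits off the truncation error this gives the factor 6 common to all constants. In
    [12 = 6 * 2] and [24 = 6 * 4] one factor 2 comes from [phi_k^2 <= 2], and the second one in 24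
    from separating [x_i^T beta] and [xi_i]. The last derivative of a Sobolev function exists only
    almost everywhere, so integrating by parts requires the fundamental theorem of calculus for
    absolutely continuous functions. Pointwise convergence and Fatou's lemma stand in for the
    completeness of the trigonometric system: only an upper bound on the remainder is wanted, and
    [alpha >= 2] makes the functions differentiable at every interior point. Measurability of the
    integrated squared error in the times and in the noise is avoided: the integral, a supremum over
    simple functions, is monotone for arbitrary nonnegative functions. *)

Section SquareIntegrable.
Context {d : measure_display} {T : measurableType d} {R : realType}.
Variable mu : {measure set T -> \bar R}.
Variable D : set T.
Hypothesis mD : measurable D.

Definition sqint (f : T -> R) : Prop :=
  measurable_fun D f /\ mu.-integrable D (fun x => (f x ^+ 2)%:E).

(** Real-valued: a non-finite integral would be read as 0, hence the square integrability asked for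
    by the linear rules below. *)
Definition ip (f g : T -> R) : R := \int[mu]_(x in D) (f x * g x).

Lemma le_integrable_EFin (f g : T -> R) : measurable_fun D f ->
  (forall x, D x -> `|f x| <= g x) -> mu.-integrable D (EFin \o g) ->
  mu.-integrable D (EFin \o f).
Proof.
move=> mf fg; apply: le_integrable => //; first exact/measurable_EFinP.
move=> x Dx; rewrite /= lee_fin (le_trans (fg x Dx))//.
exact: ler_norm.
Qed.

Lemma integrable_mul_bounded (f g : T -> R) (B : R) :
  mu.-integrable D (EFin \o f) -> measurable_fun D g ->
  (forall x, D x -> `|g x| <= B) ->
  mu.-integrable D (EFin \o (fun x => f x * g x)).
Proof.
move=> fi mg gB; have mf : measurable_fun D f.
  by apply/measurable_EFinP; exact: measurable_int fi.
apply: (@le_integrable_EFin _ (fun x => B * `|f x|)).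
- exact: measurable_funM.
- by move=> x Dx; rewrite normrM mulrC ler_wpM2r// gB.
- have := integrableZl mD B (integrable_norm fi).
  by apply: eq_integrable => // x _; rewrite /= EFinM.
Qed.

Lemma integrable_add_EFin (f g : T -> R) :
  mu.-integrable D (EFin \o f) -> mu.-integrable D (EFin \o g) ->
  mu.-integrable D (EFin \o (fun x => f x + g x)).
Proof.
move=> fi gi; have := integrableD mD fi gi.
by apply: eq_integrable => // x _; rewrite /= EFinD.
Qed.

Lemma integrable_sum_EFin (I : Type) (s : seq I) (P : pred I)
    (h : I -> T -> R) :
  (forall i, P i -> mu.-integrable D (EFin \o h i)) ->
  mu.-integrable D (EFin \o (fun x => \sum_(i <- s | P i) h i x)).
Proof.
move=> ih; have := @integrable_sum _ _ _ mu _ mD I s P (fun i => EFin \o h i) ih.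
by apply: eq_integrable => // x _; rewrite /= sumEFin.
Qed.

Lemma Rintegral_sum (I : Type) (s : seq I) (P : pred I) (h : I -> T -> R) :
  (forall i, P i -> mu.-integrable D (EFin \o h i)) ->
  \int[mu]_(x in D) (\sum_(i <- s | P i) h i x) =
  \sum_(i <- s | P i) \int[mu]_(x in D) h i x.
Proof.
move=> ih; elim: s => [|i s IHs].
  rewrite big_nil; under eq_Rintegral do rewrite big_nil.
  by rewrite Rintegral_cst// mul0r.
rewrite big_cons; under eq_Rintegral do rewrite big_cons.
have [Pi|//] := boolP (P i).
by rewrite RintegralD ?IHs//; [exact: ih|exact: integrable_sum_EFin].
Qed.

Lemma sqint_mul (f g : T -> R) : sqint f -> sqint g ->
  mu.-integrable D (EFin \o (fun x => f x * g x)).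
Proof.
move=> [mf f2] [mg g2].
apply: (@le_integrable_EFin _ (fun x => f x ^+ 2 + g x ^+ 2)).
- exact: measurable_funM.
- move=> x _; have h1 := sqr_ge0 (f x - g x); have h2 := sqr_ge0 (f x + g x).
  rewrite ler_norml; apply/andP; split; nra.
- have := integrableD mD f2 g2.
  by apply: eq_integrable => // x _; rewrite /= EFinD.
Qed.

Lemma sqintD (f g : T -> R) : sqint f -> sqint g ->
  sqint (fun x => f x + g x).
Proof.
move=> sf sg; have [mf f2] := sf; have [mg g2] := sg; split.
  exact: measurable_funD.
have fg := integrableZl mD 2 (sqint_mul sf sg).
have := integrableD mD (integrableD mD f2 g2) fg.
by apply: eq_integrable => // x _; rewrite /= -!EFinM -!EFinD; congr EFin; ring.
Qed.

Lemma sqintZ (k : R) (f : T -> R) : sqint f -> sqint (fun x => k * f x).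
Proof.
move=> [mf f2]; split; first exact: measurable_funM.
have := integrableZl mD (k ^+ 2) f2.
by apply: eq_integrable => // x _; rewrite /= -EFinM exprMn.
Qed.

Lemma sqintB (f g : T -> R) : sqint f -> sqint g ->
  sqint (fun x => f x - g x).
Proof.
move=> sf sg; have := sqintD sf (sqintZ (-1) sg).
by congr sqint; apply/funext => x; rewrite mulN1r.
Qed.

Lemma sqint_sum (I : Type) (s : seq I) (P : pred I) (h : I -> T -> R) :
  (forall i, P i -> sqint (h i)) ->
  sqint (fun x => \sum_(i <- s | P i) h i x).
Proof.
move=> sh; elim: s => [|i s IHs].
  under eq_fun do rewrite big_nil.
  split=> //; under eq_fun do rewrite expr0n.
  exact: integrable0.
under eq_fun do rewrite big_cons.
by have [Pi|_] := boolP (P i); [exact: sqintD (sh _ Pi) IHs|exact: IHs].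
Qed.

Lemma eq_sqint (f g : T -> R) : {in D, f =1 g} -> sqint f -> sqint g.
Proof.
move=> fg [mf f2]; split; first by apply: eq_measurable_fun mf.
by apply: eq_integrable f2 => // x Dx /=; rewrite fg.
Qed.

Lemma sqint_le (f g : T -> R) : measurable_fun D f ->
  (forall x, D x -> `|f x| <= `|g x|) -> sqint g -> sqint f.
Proof.
move=> mf fg [mg g2]; split=> //.
apply: (@le_integrable_EFin _ (fun x => g x ^+ 2)) => //.
  exact: measurable_funX.
by move=> x Dx; rewrite normrX -(real_normK (num_real (g x))) lerXn2r ?fg// nnegrE.
Qed.

Lemma sqintP (f : T -> R) : sqint f <->
  measurable_fun D f /\ (\int[mu]_(x in D) (f x ^+ 2)%:E < +oo)%E.
Proof.
split=> -[mf f2]; split=> //.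
  move/integrableP : f2 => [_]; congr (_ < _)%E; apply: eq_integral => x _.
  by rewrite gee0_abs// lee_fin sqr_ge0.
apply/integrableP; split.
  by apply/measurable_EFinP; exact: measurable_funX.
move: f2; congr (_ < _)%E; apply: eq_integral => x _.
by rewrite gee0_abs// lee_fin sqr_ge0.
Qed.

Lemma ipC (f g : T -> R) : ip f g = ip g f.
Proof. by apply: eq_Rintegral => x _; rewrite mulrC. Qed.

Lemma eq_ip (f f' g g' : T -> R) : {in D, f =1 f'} -> {in D, g =1 g'} ->
  ip f g = ip f' g'.
Proof. by move=> ff gg; apply: eq_Rintegral => x Dx; rewrite ff ?gg. Qed.

Lemma ip_ge0 (f : T -> R) : 0 <= ip f f.
Proof. by apply: Rintegral_ge0 => x _; rewrite -expr2 sqr_ge0. Qed.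

Lemma ipE (f : T -> R) : ip f f = \int[mu]_(x in D) f x ^+ 2.
Proof. by apply: eq_Rintegral => x _; rewrite expr2. Qed.

Lemma EFin_ip (f : T -> R) : sqint f ->
  (ip f f)%:E = (\int[mu]_(x in D) (f x ^+ 2)%:E)%E.
Proof.
move=> [_ f2]; rewrite ipE fineK//.
exact: integrable_fin_num.
Qed.

Lemma ipDl (f g h : T -> R) : sqint f -> sqint g -> sqint h ->
  ip (fun x => f x + g x) h = ip f h + ip g h.
Proof.
move=> sf sg sh; rewrite /ip -RintegralD//; try exact: sqint_mul.
by apply: eq_Rintegral => x _; rewrite mulrDl.
Qed.

Lemma ipZl (k : R) (f h : T -> R) : sqint f -> sqint h ->
  ip (fun x => k * f x) h = k * ip f h.
Proof.
move=> sf sh; rewrite /ip -RintegralZl//; last exact: sqint_mul.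
by apply: eq_Rintegral => x _; rewrite mulrA.
Qed.

Lemma ipBl (f g h : T -> R) : sqint f -> sqint g -> sqint h ->
  ip (fun x => f x - g x) h = ip f h - ip g h.
Proof.
move=> sf sg sh; rewrite /ip -RintegralB//; try exact: sqint_mul.
by apply: eq_Rintegral => x _; rewrite mulrBl.
Qed.

Lemma ip_suml (I : Type) (s : seq I) (P : pred I) (h : I -> T -> R)
    (f : T -> R) :
  (forall i, P i -> sqint (h i)) -> sqint f ->
  ip (fun x => \sum_(i <- s | P i) h i x) f = \sum_(i <- s | P i) ip (h i) f.
Proof.
move=> sh sf; rewrite /ip -Rintegral_sum; last first.
  by move=> i Pi; exact: sqint_mul (sh i Pi) sf.
by apply: eq_Rintegral => x _; rewrite mulr_suml.
Qed.

Lemma ip_sum_orthogonal (I : finType) (h : I -> T -> R) :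
  (forall i, sqint (h i)) -> (forall i j, i != j -> ip (h i) (h j) = 0) ->
  ip (fun x => \sum_i h i x) (fun x => \sum_i h i x) = \sum_i ip (h i) (h i).
Proof.
move=> sh oh; rewrite ip_suml//; last exact: sqint_sum.
apply: eq_bigr => i _; rewrite ipC ip_suml// (bigD1 i)//= big1 ?addr0//.
by move=> j ji; exact: oh.
Qed.

Lemma ip_subD (f g : T -> R) : sqint f -> sqint g ->
  ip (fun x => f x - g x) (fun x => f x - g x) = ip f f - 2 * ip f g + ip g g.
Proof.
move=> sf sg; have sfg := sqintB sf sg.
rewrite ipBl// (ipC f (fun x => f x - g x)) (ipC g (fun x => f x - g x)).
rewrite !ipBl// (ipC g f); ring.
Qed.

(** By the parallelogram law the gap is the squared norm of [f - g]. *)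
Lemma ip_add_le (f g : T -> R) : sqint f -> sqint g ->
  ip (fun x => f x + g x) (fun x => f x + g x) <= 2 * ip f f + 2 * ip g g.
Proof.
move=> sf sg; have := ip_ge0 (fun x => f x - g x).
have sfg := sqintD sf sg.
rewrite ip_subD// ipDl// (ipC f (fun x => f x + g x)).
rewrite (ipC g (fun x => f x + g x)) !ipDl// (ipC g f); lra.
Qed.

Lemma ip_sum_orthonormal (I : finType) (e : I -> T -> R) (c : I -> R) :
  (forall i, sqint (e i)) -> (forall i j, ip (e i) (e j) = (i == j)%:R) ->
  ip (fun x => \sum_i c i * e i x) (fun x => \sum_i c i * e i x) =
  \sum_i c i ^+ 2.
Proof.
move=> se oe; have sc i : sqint (fun x => c i * e i x) by exact: sqintZ.
rewrite ip_sum_orthogonal//; last first.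
  move=> i j ij /=; rewrite ipZl// (ipC (e i)) ipZl//.
  by rewrite oe eq_sym (negbTE ij) !mulr0.
apply: eq_bigr => i _; rewrite ipZl// (ipC (e i)) ipZl// oe eqxx mulr1.
by rewrite expr2.
Qed.

(** Pythagoras; nonnegativity of the left-hand side is Bessel's inequality. *)
Lemma ip_sub_proj (I : finType) (e : I -> T -> R) (f : T -> R) :
  (forall i, sqint (e i)) -> (forall i j, ip (e i) (e j) = (i == j)%:R) ->
  sqint f ->
  ip (fun x => f x - \sum_i ip f (e i) * e i x)
     (fun x => f x - \sum_i ip f (e i) * e i x) =
  ip f f - \sum_i ip f (e i) ^+ 2.
Proof.
move=> se oe sf.
have sS i : sqint (fun x => ip f (e i) * e i x) by exact: sqintZ.
rewrite ip_subD//; last exact: sqint_sum.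
rewrite ip_sum_orthonormal//.
have -> : ip f (fun x => \sum_i ip f (e i) * e i x) = \sum_i ip f (e i) ^+ 2.
  rewrite ipC ip_suml//; apply: eq_bigr => i _.
  by rewrite ipZl// (ipC (e i)) expr2.
ring.
Qed.

Lemma bessel (I : finType) (e : I -> T -> R) (f : T -> R) :
  (forall i, sqint (e i)) -> (forall i j, ip (e i) (e j) = (i == j)%:R) ->
  sqint f -> \sum_i ip f (e i) ^+ 2 <= ip f f.
Proof. by move=> se oe sf; rewrite -subr_ge0 -ip_sub_proj// ip_ge0. Qed.

Lemma sqint_bounded (f : T -> R) (M : R) : (mu D < +oo)%E ->
  measurable_fun D f -> (forall x, D x -> `|f x| <= M) -> sqint f.
Proof.
move=> muD mf fM; split=> //.
apply: (@measurable_bounded_integrable _ _ _ _ (fun x => f x ^+ 2)) => //.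
  exact: measurable_funX.
exists (M ^+ 2); split; first exact: num_real.
move=> y My x Dx /=; rewrite (le_trans _ (ltW My))// normrX.
by rewrite lerXn2r ?nnegrE ?fM//; exact: le_trans (fM x Dx).
Qed.

Lemma sqint_integrable (f : T -> R) : (mu D < +oo)%E -> sqint f ->
  mu.-integrable D (EFin \o f).
Proof.
move=> muD sf; have s1 : sqint (cst 1).
  by apply: (@sqint_bounded _ 1) => // x _; rewrite normr1.
by have := sqint_mul sf s1; apply: eq_integrable => // x _ /=; rewrite mulr1.
Qed.

End SquareIntegrable.

(** * Absolutely continuous functions *)

Section AbsoluteContinuity.
Context {R : realType}.
Implicit Types (F G : R -> R) (U : set R).
Local Notation mu := (@lebesgue_measure R).

(** A substitute for compactness of [[a, b]]. The step hypothesis crosses [s] from a nearby point on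
    its left to one on its right, both possibly equal to [s], which merges the limit step and the
    successor step. A point of the set close to its supremum can cross it, which is absurd unless
    the supremum is [b]. *)
Lemma real_induction (a b : R) (A : R -> Prop) : a <= b -> A a ->
  (forall s, a <= s <= b -> exists2 r, 0 < r &
     forall x y, a <= x -> x <= s -> s <= y -> y <= b ->
       s - r < x -> y < s + r -> A x -> A y) ->
  A b.
Proof.
move=> ab Aa step; pose E := [set x : R | a <= x <= b /\ A x].
have Ea : E a by split=> //; rewrite lexx.
have supE : has_sup E by split; [exists a|exists b => x [/andP[]]].
have [h1 h2] : a <= sup E /\ sup E <= b.
  split; first by rewrite ub_le_sup//; case: supE.
  by rewrite ge_sup//; [exists a|move=> x [/andP[]]].
have [r r0 stepr] : exists2 r, 0 < r &
     forall x y, a <= x -> x <= sup E -> sup E <= y -> y <= b ->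
       sup E - r < x -> y < sup E + r -> A x -> A y by apply: step; rewrite h1.
have [x Ex xr] := sup_adherent r0 supE.
have [/andP[x0 x1] Ax] := Ex.
have xs : x <= sup E by rewrite ub_le_sup//; case: supE.
have {}step y : sup E <= y -> y <= b -> y < sup E + r -> A y.
  by move=> sy y1 yr; exact: stepr x0 xs sy y1 xr yr Ax.
have [s1|s1] := leP b (sup E); first by apply: step => //; lra.
pose y := Num.min b (sup E + r / 2).
have ys : sup E < y by rewrite lt_min s1 /=; lra.
have Ey : E y.
  split; first by rewrite (le_trans h1 (ltW ys)) ge_min lexx.
  apply: step; rewrite ?(ltW ys) ?ge_min ?lexx// /y.
  by rewrite gt_min; apply/orP; right; lra.
have : y <= sup E by rewrite ub_le_sup//; case: supE.
by rewrite leNgt ys.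
Qed.

(** Non-overlapping intervals inside [U], listed from right to left, because real induction extends
    the family at its right end. The base case keeps all of them at or above 0. *)
Fixpoint descending_intervals U (x : R) (s : seq (R * R)) : Prop :=
  if s is p :: s' then
    [/\ p.1 <= p.2 <= x, `]p.1, p.2[ `<=` U & descending_intervals U p.1 s']
  else 0 <= x.

Lemma descending_intervals_ge0 U x s : descending_intervals U x s -> 0 <= x.
Proof.
elim: s x => [//|p s IH] x /= [/andP[h1 h2] _ /IH h3].
exact: le_trans h3 (le_trans h1 h2).
Qed.

Lemma descending_intervals_nth U x s i : descending_intervals U x s ->
  (i < size s)%N ->
  [/\ 0 <= (nth (0, 0) s i).1, (nth (0, 0) s i).1 <= (nth (0, 0) s i).2 &
      (nth (0, 0) s i).2 <= x].
Proof.
elim: s x i => [//|p s IH] x [|i] /= [/andP[h1 h2] _ h3] si.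
  by split=> //; exact: descending_intervals_ge0 h3.
have [k1 k2 k3] := IH _ _ h3 si; split=> //.
exact: le_trans k3 (le_trans h1 h2).
Qed.

Lemma descending_intervals_lt U x s i j : descending_intervals U x s ->
  (i < j)%N -> (j < size s)%N -> (nth (0, 0) s j).2 <= (nth (0, 0) s i).1.
Proof.
elim: s x i j => [//|p s IH] x [|i] [|j] //= [_ _ h3] ij sj.
  by case: (descending_intervals_nth h3 sj).
exact: (IH _ _ _ h3).
Qed.

(** The open head interval is disjoint from [[0, p.1]], which contains the others, so the measures
    add up. *)
Lemma descending_intervals_length U x s : measurable U ->
  descending_intervals U x s ->
  ((\sum_(p <- s) (p.2 - p.1))%:E <= mu (U `&` `[0%R, x]))%E.
Proof.
move=> mU; elim: s x => [|p s IH] x /=; first by rewrite big_nil.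
move=> [/andP[h1 h2] sU h3]; rewrite big_cons addrC EFinD.
have := IH _ h3; have p10 := descending_intervals_ge0 h3.
have mI : mu `]p.1, p.2[ = (p.2 - p.1)%:E.
  rewrite lebesgue_measure_itv /= lte_fin; case: ltP => // h.
  by have -> : p.2 = p.1; [lra|rewrite subrr].
rewrite -mI => IHs.
rewrite (le_trans (leeD2r _ IHs))// -measureU//; last 2 first.
- exact: measurableI.
- apply/disjoints_subset => y [_ /=]; rewrite !in_itv/=.
  by move=> /andP[_ yp] /andP[]; rewrite ltNge yp.
apply: le_measure; rewrite ?inE//.
- by apply: measurableU => //; exact: measurableI.
- exact: measurableI.
move=> y /= [[Uy]|]; rewrite !in_itv/= => /andP[y1 y2].
  by split=> //; rewrite y1 (le_trans y2)// (le_trans h1).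
split; first by apply: sU; rewrite /= in_itv/= y1.
by rewrite (le_trans p10 (ltW y1)) (le_trans (ltW y2)).
Qed.

Lemma abs_continuous_descending F : abs_continuous01 F ->
  forall e, 0 < e -> exists2 d, 0 < d & forall U s, measurable U ->
    (mu U < d%:E)%E -> descending_intervals U 1 s ->
    \sum_(p <- s) `|F p.2 - F p.1| < e.
Proof.
move=> acF e e0; have [d d0 acd] := acF e e0.
exists d => // U s mU Ud Us.
rewrite (big_nth (0, 0)) big_mkord.
apply: acd => [i||].
- by have [-> -> ->] := descending_intervals_nth Us (ltn_ord i).
- apply/trivIsetP => i j _ _ ij.
  wlog lij : i j ij / (i < j)%N.
    move=> W; have [/W|ji|/val_inj ijE] := ltngtP i j; first exact.
    - by rewrite setIC; apply: W => //; rewrite eq_sym.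
    - by rewrite ijE eqxx in ij.
  apply/disjoints_subset => y; rewrite /= !in_itv/= => /andP[yi _] /andP[_].
  rewrite ltNge (le_trans _ (ltW yi))//.
  exact: descending_intervals_lt Us lij (ltn_ord j).
- rewrite -(big_mkord xpredT (fun i => (nth (0, 0) s i).2 - (nth (0, 0) s i).1)).
  rewrite -(big_nth (0, 0) xpredT (fun p => p.2 - p.1)) -lte_fin.
  apply: le_lt_trans Ud; apply: le_trans (descending_intervals_length mU Us) _.
  by apply: le_measure; rewrite ?inE//; exact: measurableI.
Qed.

Lemma is_derive0_near (H : R -> R) (s : R) : is_derive s 1 H 0 ->
  forall e, 0 < e -> exists2 r, 0 < r &
    forall y, `|y - s| < r -> `|H y - H s| <= e * `|y - s|.
Proof.
move=> /is_derive1_caratheodory[k [Hk kc ks]] e e0.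
have : k y @[y --> s] --> (0 : R) by rewrite -ks.
move=> /cvgr0Pnorm_le /(_ _ e0) /nbhs_ballP[r /= r0 kr].
exists r => // y yr; rewrite Hk normrM ler_wpM2r//.
by apply: kr; rewrite /ball/= distrC.
Qed.

Lemma descending_intervals_le U x y s : x <= y -> descending_intervals U x s ->
  descending_intervals U y s.
Proof.
case: s => [|p s] xy /= => [x0|[/andP[h1 h2] h3 h4]]; first exact: le_trans xy.
by split=> //; rewrite h1 (le_trans h2).
Qed.

Let prim (G : R -> R) (x : R) := \int[mu]_(t in `[0, x]) G t.

Let primB (G : R -> R) (x y : R) : mu.-integrable setT (EFin \o G) ->
  0 <= x -> x <= y -> prim G y - prim G x = \int[mu]_(t in `]x, y]) G t.
Proof.
move=> iG x0 xy; rewrite /prim Rintegral_itvB ?bnd_simp//.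
exact: integrableS iG.
Qed.

Let prim_le (G : R -> R) (x y : R) : mu.-integrable setT (EFin \o G) ->
  (forall t, 0 <= G t) -> 0 <= x -> x <= y -> prim G x <= prim G y.
Proof.
by move=> iG G0 x0 xy; rewrite -subr_ge0 primB// Rintegral_ge0.
Qed.

Let prim_norm (G : R -> R) (x y : R) : mu.-integrable setT (EFin \o G) ->
  0 <= x -> x <= y -> `|prim G y - prim G x| <= \int[mu]_(t in `]x, y]) `|G t|.
Proof.
move=> iG x0 xy; rewrite primB//; apply: le_normr_Rintegral => //.
exact: integrableS iG.
Qed.

(** By Lebesgue differentiation [prim G0] has derivative [G0] almost everywhere, so [H] has
    derivative 0 almost everywhere and must be shown not to move between 0 and 1. Real induction
    takes the place of a Vitali covering. *)
Theorem ac_ftc F G : abs_continuous01 F ->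
  mu.-integrable `[0, 1] (EFin \o G) ->
  (\forall x \ae mu, x \in `]0 : R, 1[ -> is_derive x 1 F (G x)) ->
  \int[mu]_(x in `[0, 1]) G x = F 1 - F 0.
Proof.
move=> acF iG dF; pose G0 := G \_ `[0, 1].
have iG0 : mu.-integrable setT (EFin \o G0).
  by move/integrable_mkcond : iG; rewrite restrict_EFin; exact.
pose H x := F x - prim G0 x.
have dP : \forall x \ae mu, (0 : R) < x ->
    derivable (prim G0) x 1 /\ (prim G0)^`()%classic x = G0 x.
  have iy (y : R) : mu.-integrable `[0, y] (EFin \o G0) by exact: integrableS iG0.
  exact: FTC1 iy (integrable_locally_restrict (measurable_itv _) iG).
(* The endpoints belong to [N], since the derivative of [F] is known only in the interior; thus they
   are covered by [U] as well. *)
pose N := [set x : R | 0 <= x <= 1 /\ ~ ((x \in `]0, 1[) /\ is_derive x 1 H 0)].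
have negN : mu.-negligible N.
  have : \forall x \ae mu, x \in `]0 : R, 1[ -> is_derive x 1 H 0.
    move: dF dP; apply: filterS2.
      exact: (ae_filter_ringOfSetsType mu).
    move=> x dFx dPx x01.
    have [x0 x1] : 0 < x /\ x < 1 by move: x01; rewrite in_itv => /andP.
    have := is_deriveB (dFx x01) (DeriveDef (dPx x0).1 erefl).
    rewrite -derive1E (dPx x0).2 /G0 patchE mem_set ?subrr//=.
    by rewrite in_itv/= !ltW.
  move=> negZ.
  have neg1 (x : R) : mu.-negligible [set x].
    by exists [set x]; split=> //; exact: lebesgue_measure_set1.
  have := negligibleU (negligibleU negZ (neg1 0)) (neg1 1).
  apply: negligibleS => x [x01 Nx]; have [->|x0] := eqVneq x 0; first by left; right.
  have [->|x1] := eqVneq x 1; first by right.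
  left; left => /= dH; apply: Nx.
  have x01' : x \in `]0, 1[.
    by rewrite in_itv/= !lt_neqAle eq_sym x0 x1; case/andP: x01 => -> ->.
  by split=> //; exact: dH.
(* Let [U] be a small open set containing the points where [H] does not have
   derivative 0.  Going from 0 to 1 by real induction, [H] moves by at most
   [e * x] outside of [U]; inside of [U] the increments of [F] and of the
   integral of [G] are small by absolute continuity. *)
suff He e : 0 < e -> `|H 1 - H 0| <= e * 3.
  have H10 : H 1 = H 0.
    apply/eqP; rewrite -subr_eq0 -normr_eq0; apply/negPn/negP => n0.
    have n1 : 0 < `|H 1 - H 0| by rewrite lt_def n0 /=.
    have := He (`|H 1 - H 0| / 4); lra.
  have P0 : prim G0 0 = 0 by rewrite /prim set_itv1 Rintegral_set1.
  have -> : \int[mu]_(x in `[0, 1]) G x = prim G0 1.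
    by apply: eq_Rintegral => x x01; rewrite /G0 patchE x01.
  by move: H10; rewrite /H P0; lra.
move=> e0.
have [d1 d10 acd] := abs_continuous_descending acF e0.
have [d2 [d20 icd]] := integral_normr_continuous iG0 e0.
pose d := Num.min d1 d2 / 2.
have d0 : 0 < d by rewrite divr_gt0// lt_min d10.
have [U [oU NU muU]] := outer_measure_open_le N d0.
have {}muU : (mu U < (Num.min d1 d2)%:E)%E.
  apply: (le_lt_trans muU).
  move/negligible_outer_measure : negN => ->; rewrite add0e lte_fin /d.
  rewrite ltr_pdivrMr// ltr_pMr ?ltr1n// lt_min d10; exact: d20.
have mU : measurable U by exact: open_measurable.
pose g := (fun t => `|G0 t|) \_ U.
have g0 t : 0 <= g t by rewrite /g patchE; case: ifP.
have ig : mu.-integrable setT (EFin \o g).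
  have iU : mu.-integrable U (EFin \o (fun t => `|G0 t|)).
    by apply: (@integrableS _ _ _ _ setT) => //; exact: integrable_norm.
  by move/integrable_mkcond : iU; rewrite restrict_EFin; exact.
have int_g : prim g 1 <= e.
  rewrite /prim /g -Rintegral_mkcondr ltW// icd//; first exact: measurableI.
  apply: le_lt_trans (lt_le_trans muU _); last by rewrite lee_fin ge_min lexx orbT.
  by apply: le_measure; rewrite ?inE//; exact: measurableI.
(* Each of the three terms is at most [e] at [x = 1]: the slope off [U], the increments of [F] over
   the intervals collected inside [U], and the integral of [|G0|] over [U]. *)
pose A x := exists s, descending_intervals U x s /\
  `|H x - H 0| <= e * x + \sum_(p <- s) `|F p.2 - F p.1| + prim g x.
suff [s [Us]] : A 1.
  move=> /le_trans; apply; rewrite mulr1.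
  have : \sum_(p <- s) `|F p.2 - F p.1| < e.
    by apply: (acd U) => //; apply: lt_le_trans muU _; rewrite lee_fin ge_min lexx.
  by lra.
apply: (real_induction ler01) => [|s s01].
  exists [::]; split=> //=; rewrite subrr normr0 mulr0 big_nil !add0r.
  exact: Rintegral_ge0.
have [Us|nUs] := pselect (U s).
  have /nbhs_ballP[r /= r0 rU] := open_nbhs_nbhs (conj oU Us).
  exists r => // x y x0 xs sy y1 xr yr [l [Ul Hl]].
  exists ((x, y) :: l); split.
    split=> //=; first by rewrite lexx andbT (le_trans xs).
    move=> t /=; rewrite in_itv/= => /andP[xt ty]; apply: rU.
    by rewrite /ball/= ltr_norml; lra.
  rewrite big_cons /=.
  have xy : x <= y by exact: le_trans xs sy.
  have h1 : `|prim G0 y - prim G0 x| <= prim g y - prim g x.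
    rewrite (le_trans (prim_norm _ _ _))// primB// le_eqVlt; apply/orP; left.
    apply/eqP/eq_Rintegral => t; rewrite inE /= in_itv/= => /andP[xt ty].
    rewrite /g patchE mem_set//; apply: rU.
    by rewrite /ball/= ltr_norml; lra.
  have h2 : `|H y - H 0| <= `|F y - F x| + `|prim G0 y - prim G0 x| + `|H x - H 0|.
    have -> : H y - H 0 = F y - F x - (prim G0 y - prim G0 x) + (H x - H 0).
      by rewrite /H; ring.
    by rewrite (le_trans (ler_normD _ _))// lerD2r ler_normB.
  have : e * x <= e * y by rewrite ler_wpM2l// ltW.
  lra.
have [s1 dH] : (s \in `]0, 1[) /\ is_derive s 1 H 0.
  by apply: contrapT => nH; apply/nUs/NU.
have [r r0 Hr] := is_derive0_near dH e0.
exists r => // x y x0 xs sy y1 xr yr [l [Ul Hl]].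
have xy : x <= y by exact: le_trans xs sy.
exists l; split; first exact: descending_intervals_le Ul.
have := prim_le ig g0 x0 xy.
have := Hr x; rewrite ler0_norm ?subr_le0//.
have := Hr y; rewrite ger0_norm ?subr_ge0//.
have : `|H y - H 0| <= `|H y - H s| + `|H x - H s| + `|H x - H 0|.
  have -> : H y - H 0 = H y - H s - (H x - H s) + (H x - H 0) by ring.
  by rewrite (le_trans (ler_normD _ _))// lerD2r ler_normB.
have [k1 k2] : y - s < r /\ - (x - s) < r by lra.
move=> + /(_ k1) + /(_ k2); lra.
Qed.
End AbsoluteContinuity.

(** * Absolute continuity of products and primitives, and integration by parts *)

Section AbsoluteContinuityAlgebra.
Context {R : realType}.
Implicit Types (F G : R -> R).
Local Notation mu := (@lebesgue_measure R).

Lemma abs_continuous_unif F : abs_continuous01 F -> forall e, 0 < e ->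
  exists2 d, 0 < d & forall x y, 0 <= x -> x <= y -> y <= 1 -> y - x < d ->
    `|F y - F x| < e.
Proof.
move=> acF e e0; have [d d0 acd] := acF e e0.
exists d => // x y x0 xy y1 yx.
have := acd 1%N (fun=> x) (fun=> y); rewrite !big_ord1; apply=> //.
by apply/trivIsetP => i j _ _; rewrite !ord1 eqxx.
Qed.

(** Real induction on boundedness over [[0, x]]: crossing a gap shorter than [d] raises the bound by
    at most 1. *)
Lemma abs_continuous_bounded F : abs_continuous01 F ->
  exists M, forall x, 0 <= x <= 1 -> `|F x| <= M.
Proof.
move=> acF; have [d d0 dF] := abs_continuous_unif acF ltr01.
apply: (@real_induction _ 0 1
    (fun x => exists M, forall y, 0 <= y <= x -> `|F y| <= M)) => //.
  by exists `|F 0| => y; rewrite -eq_le => /eqP <-.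
move=> s /andP[s0 s1]; exists (d / 2); first by rewrite divr_gt0.
move=> x y x0 xs sy y1 xd yd [M FM]; exists (M + 1) => z /andP[z0 zy].
have [zx|xz] := leP z x.
  by apply: (le_trans (FM z _)); rewrite ?z0// lerDl.
have -> : F z = (F z - F x) + F x by rewrite subrK.
rewrite (le_trans (ler_normD _ _))// addrC lerD ?FM ?x0 ?lexx//.
by apply/ltW/dF => //; lra.
Qed.

Lemma abs_continuous_measurable F : abs_continuous01 F ->
  measurable_fun `]0 : R, 1[ F.
Proof.
move=> acF; apply: open_continuous_measurable_fun; first exact: interval_open.
move=> x; rewrite inE /= in_itv/= => /andP[x0 x1].
apply/cvgrPdist_lt => e e0; have [d d0 dF] := abs_continuous_unif acF e0.
near=> y.
have [y0 y1] : 0 < y /\ y < 1.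
  by split; near: y; [exact: lt_nbhsr|exact: lt_nbhsl].
have : `|x - y| < d by near: y; apply/nbhs_ballP; exists d.
rewrite ltr_norml => /andP[xy1 xy2].
have [xy|yx] := leP x y; last by apply: dF => //; [exact: ltW|exact: ltW|exact: ltW].
by rewrite distrC; apply: dF => //; [exact: ltW|exact: ltW|lra].
Unshelve. all: by end_near. Qed.

Lemma lipschitz_abs_continuous F (M : R) :
  (forall x y, 0 <= x -> x <= y -> y <= 1 -> `|F y - F x| <= M * (y - x)) ->
  abs_continuous01 F.
Proof.
move=> FM e e0; have [M0|M0] := ltP 0 M; last first.
  exists 1 => // k a b ab _ _; rewrite big1 ?e0// => i _.
  have [a0 [abi b1]] := ab i; apply/eqP; rewrite normr_eq0 -normr_le0.
  by rewrite (le_trans (FM _ _ a0 abi b1))// mulr_le0_ge0// subr_ge0.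
exists (e / M); first by rewrite divr_gt0.
move=> k a b ab _; rewrite ltr_pdivlMr// mulrC => h.
apply: le_lt_trans h; rewrite mulr_sumr; apply: ler_sum => i _.
by have [a0 [abi b1]] := ab i; exact: FM.
Qed.

Lemma abs_continuousM F (psi : R -> R) (B M : R) : abs_continuous01 F ->
  (forall x, `|psi x| <= B) ->
  (forall x y, x <= y -> `|psi y - psi x| <= M * (y - x)) ->
  abs_continuous01 (fun x => F x * psi x).
Proof.
move=> acF psiB psiM e e0.
have [C FC] := abs_continuous_bounded acF.
have C0 : 0 <= C by rewrite (le_trans _ (FC 0 _))// lexx ler01.
have B0 : 0 <= B by rewrite (le_trans _ (psiB 0)).
have M0 : 0 <= M.
  by have := psiM 0 1 ler01; rewrite subr0 mulr1; exact: le_trans.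
(* One half of [e] pays for the increments of [F], the other for those of [psi]; the [+ 1] keeps the
   denominators positive when [B] or [C * M] is 0. *)
pose e1 := e / (2 * (B + 1)); pose d2 := e / (2 * (C * M + 1)).
have CM0 : 0 <= C * M by rewrite mulr_ge0.
have e10 : 0 < e1 by rewrite divr_gt0// mulr_gt0//; lra.
have d20 : 0 < d2 by rewrite divr_gt0// mulr_gt0//; lra.
have [d d0 acd] := acF _ e10.
exists (Num.min d d2); first by rewrite lt_min d0.
move=> k a b ab tI; rewrite lt_min => /andP[h1 h2].
have := acd k a b ab tI h1; set S := \sum_(i < k) _ => S1.
set L := \sum_(i < k) (b i - a i) in h2.
apply: (@le_lt_trans _ _ (S * B + C * M * L)).
  rewrite /S /L mulr_suml mulr_sumr -big_split/=; apply: ler_sum => i _.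
  have [a0 [abi b1]] := ab i.
  have -> : F (b i) * psi (b i) - F (a i) * psi (a i) =
      (F (b i) - F (a i)) * psi (b i) + F (a i) * (psi (b i) - psi (a i)) by ring.
  rewrite (le_trans (ler_normD _ _))// !normrM lerD//.
    by rewrite ler_wpM2l.
  by rewrite -mulrA ler_pM// ?psiM// FC// a0 (le_trans abi b1).
have S2 : S * (2 * (B + 1)) < e by rewrite -ltr_pdivlMr// mulr_gt0//; lra.
have L2 : L * (2 * (C * M + 1)) < e by rewrite -ltr_pdivlMr// mulr_gt0//; lra.
have S0 : 0 <= S by apply: sumr_ge0.
have L0 : 0 <= L by apply: sumr_ge0 => i _; rewrite subr_ge0; have [_ []] := ab i.
lra.
Qed.

(** The difference quotient multiplied out, so that it also makes sense at [y = x] and, one-sidedly,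
    at the endpoints. *)
Lemma derivative01_near F G (x : R) e : derivative01 F G -> x \in `[0, 1] ->
  0 < e -> exists2 r, 0 < r & forall y, 0 <= y <= 1 -> `|y - x| < r ->
  `|F y - F x - G x * (y - x)| <= e * `|y - x|.
Proof.
move=> dF x01 e0; have /cvgrPdist_le/(_ e e0) := dF x x01.
rewrite near_withinE /= => -[r /= r0 xr]; exists r => // y y01 yr.
have [->|yx] := eqVneq y x; first by rewrite !subrr mulr0 subrr normr0 mulr0.
have := xr y _ yx; rewrite /= distrC in_itv/= => /(_ yr y01).
have yx0 : y - x != 0 by rewrite subr_eq0.
have -> : F y - F x - G x * (y - x) =
    - ((G x - (y - x)^-1 * (F y - F x)) * (y - x)) by field.
by move=> h; rewrite normrN normrM ler_wpM2r.
Qed.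

Lemma derivative01_is_derive F G (x : R) : derivative01 F G -> x \in `]0, 1[ ->
  is_derive x 1 F (G x).
Proof.
move=> dF x01; have [x0 x1] : 0 < x /\ x < 1 by move: x01; rewrite in_itv => /andP.
apply/is_derive1_caratheodory.
exists (fun y => if y == x then G x else (F y - F x) / (y - x)); split.
- move=> y; have [->|yx] := eqVneq y x; first by rewrite !subrr mulr0.
  by rewrite divfK// subr_eq0.
- apply/cvgrPdist_le => e e0; rewrite eqxx.
  have [|r r0 xr] := @derivative01_near _ _ x _ dF _ e0.
    by rewrite in_itv/= !ltW.
  near=> y; have [_|yx] := eqVneq y x; first by rewrite subrr normr0 ltW.
  have yx0 : y - x != 0 by rewrite subr_eq0.
  rewrite -(ler_pM2r (_ : 0 < `|y - x|)) ?normr_gt0// -normrM -normrN.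
  have -> : - ((G x - (F y - F x) / (y - x)) * (y - x)) =
    F y - F x - G x * (y - x) by field.
  apply: xr.
    by apply/andP; split; apply: ltW; near: y; [exact: lt_nbhsr|exact: lt_nbhsl].
  by rewrite distrC; near: y; apply/nbhs_ballP; exists r.
- by rewrite eqxx.
Unshelve. all: by end_near. Qed.

(** A mean value inequality by real induction: [F] is Lipschitz with constant [M + 1], where [M]
    bounds [G] and the 1 absorbs the error of the first order expansion. *)
Lemma derivative01_abs_continuous F G : derivative01 F G ->
  abs_continuous01 G -> abs_continuous01 F.
Proof.
move=> dF acG; have [M GM] := abs_continuous_bounded acG.
have M0 : 0 <= M by rewrite (le_trans _ (GM 0 _))// lexx ler01.
apply: (@lipschitz_abs_continuous _ (M + 1)) => a b a0 ab b1.
apply: (@real_induction _ a b (fun x => `|F x - F a| <= (M + 1) * (x - a))) => //.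
  by rewrite !subrr normr0 mulr0.
move=> s /andP[as_ sb].
have s01 : 0 <= s <= 1 by rewrite (le_trans a0)// (le_trans sb).
have [r r0 Fr] := derivative01_near dF s01 ltr01.
have Fs y : 0 <= y <= 1 -> `|y - s| < r -> `|F y - F s| <= (M + 1) * `|y - s|.
  move=> y01 yr; have -> : F y - F s = F y - F s - G s * (y - s) + G s * (y - s).
    by rewrite subrK.
  rewrite (le_trans (ler_normD _ _))// mulrDl addrC lerD// ?Fr// normrM.
  by rewrite ler_wpM2r// GM.
exists r => // x y ax xs sy yb xr yr Ax.
have s1 : s <= 1 by case/andP: s01.
have h1 : `|F y - F s| <= (M + 1) * (y - s).
  have ys : `|y - s| = y - s by rewrite ger0_norm ?subr_ge0.
  by rewrite -ys; apply: Fs; [apply/andP; split; lra|rewrite ys; lra].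
have h2 : `|F x - F s| <= (M + 1) * (s - x).
  have sx : `|x - s| = s - x by rewrite ler0_norm ?subr_le0// opprB.
  by rewrite -sx; apply: Fs; [apply/andP; split; lra|rewrite sx; lra].
have : `|F y - F a| <= `|F y - F s| + `|F x - F s| + `|F x - F a|.
  have -> : F y - F a = F y - F s - (F x - F s) + (F x - F a) by ring.
  by rewrite (le_trans (ler_normD _ _))// lerD2r ler_normB.
lra.
Qed.

Lemma ac_ftc_oo F G : abs_continuous01 F ->
  mu.-integrable `]0, 1[ (EFin \o G) ->
  (\forall x \ae mu, x \in `]0 : R, 1[ -> is_derive x 1 F (G x)) ->
  \int[mu]_(x in `]0, 1[) G x = F 1 - F 0.
Proof.
move=> acF iG dF; have sub01 : `]0 : R, 1[ `<=` `[0, 1].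
  by move=> x /=; rewrite !in_itv/= => /andP[/ltW-> /ltW->].
rewrite -(@ac_ftc _ F (G \_ `]0, 1[))//.
- by rewrite -Rintegral_mkcondr setIidr.
- apply: (@integrableS _ _ _ _ setT) => //.
  by move/integrable_mkcond : iG; rewrite restrict_EFin; exact.
- move: dF; apply: filterS; first exact: (ae_filter_ringOfSetsType mu).
  by move=> x dFx x01; rewrite patchE mem_set//; exact: dFx.
Qed.

(** The fundamental theorem applied to [F * psi], which is absolutely continuous because [psi] is
    Lipschitz by the mean value theorem. *)
Lemma ac_ibp F G (psi dpsi : R -> R) (B M : R) : abs_continuous01 F ->
  mu.-integrable `]0, 1[ (EFin \o G) ->
  (\forall x \ae mu, x \in `]0 : R, 1[ -> is_derive x 1 F (G x)) ->
  (forall x : R, is_derive x 1 psi (dpsi x)) ->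
  (forall x, `|psi x| <= B) -> (forall x, `|dpsi x| <= M) ->
  measurable_fun setT dpsi ->
  \int[mu]_(x in `]0, 1[) (G x * psi x) + \int[mu]_(x in `]0, 1[) (F x * dpsi x)
   = F 1 * psi 1 - F 0 * psi 0.
Proof.
move=> acF iG dF dpsiE psiB dpsiM mdpsi.
have cpsi : continuous psi.
  move=> z; exact/differentiable_continuous/derivable1_diffP/(@ex_derive _ _ _ _ _ _ _ (dpsiE z)).
have lip x y : x <= y -> `|psi y - psi x| <= M * (y - x).
  move=> xy; have [|c _ ->] := @MVT_segment _ psi dpsi _ _ xy (fun x _ => dpsiE x).
    exact: continuous_subspaceT.
  by rewrite normrM (ger0_norm (_ : 0 <= y - x)) ?subr_ge0// ler_wpM2r ?subr_ge0.
have mpsi : measurable_fun setT psi by exact: continuous_measurable_fun.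
have [C FC] := abs_continuous_bounded acF.
have C0 : 0 <= C by rewrite (le_trans _ (FC 0 _))// lexx ler01.
have iGp : mu.-integrable `]0, 1[ (EFin \o (fun x => G x * psi x)).
  by apply: (@integrable_mul_bounded _ _ _ _ _ _ _ _ B) => //; exact: measurable_funTS.
have iFp : mu.-integrable `]0, 1[ (EFin \o (fun x => F x * dpsi x)).
  apply: (@integrable_mul_bounded _ _ _ _ _ _ _ _ M) => //; last exact: measurable_funTS.
  apply: sqint_integrable => //.
    by rewrite /= lebesgue_measure_itv/= lte01 ltry.
  apply: (@sqint_bounded _ _ _ _ _ _ _ C) => //.
  - by rewrite /= lebesgue_measure_itv/= lte01 ltry.
  - exact: abs_continuous_measurable.
  - by move=> x /=; rewrite in_itv/= => /andP[x0 x1]; rewrite FC// !ltW.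
rewrite -RintegralD//; apply: (ac_ftc_oo (abs_continuousM acF psiB lip)).
  exact: integrable_add_EFin.
move: dF; apply: filterS; first exact: (ae_filter_ringOfSetsType mu).
move=> x dFx /dFx {}dFx; rewrite addrC (mulrC (G x)).
exact: (is_deriveM dFx (dpsiE x)).
Qed.

End AbsoluteContinuityAlgebra.

(** * The trigonometric basis *)

Section TrigonometricBasis.
Context {R : realType}.
Local Notation mu := (@lebesgue_measure R).
Local Notation I01 := (`]0 : R, 1[%classic : set R).

Lemma is_derive_sin_scaled (c t : R) :
  is_derive t 1 (fun t => sin (c * t)) (c * cos (c * t)).
Proof.
have h : is_derive t 1 (fun t : R => c * t) (c * 1).
  exact: (@is_deriveZ _ _ _ id c t 1 1).
by have := is_derive1_comp (is_derive_sin (c * t)) h; rewrite mulr1 mulrC.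
Qed.

Lemma is_derive_cos_scaled (c t : R) :
  is_derive t 1 (fun t => cos (c * t)) (- c * sin (c * t)).
Proof.
have h : is_derive t 1 (fun t : R => c * t) (c * 1).
  exact: (@is_deriveZ _ _ _ id c t 1 1).
have := is_derive1_comp (is_derive_cos (c * t)) h; rewrite mulr1 mulrC.
by rewrite mulrN mulNr.
Qed.

Lemma norm_sin_le1 (t : R) : `|sin t| <= 1.
Proof. by rewrite ler_norml sin_geN1 sin_le1. Qed.

Lemma norm_cos_le1 (t : R) : `|cos t| <= 1.
Proof. by rewrite ler_norml cos_geN1 cos_le1. Qed.

Lemma continuous_sin_scaled (c : R) : continuous (fun t : R => sin (c * t)).
Proof.
move=> z; apply/differentiable_continuous/derivable1_diffP.
exact: (@ex_derive _ _ _ _ _ _ _ (is_derive_sin_scaled c z)).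
Qed.

Lemma continuous_cos_scaled (c : R) : continuous (fun t : R => cos (c * t)).
Proof.
move=> z; apply/differentiable_continuous/derivable1_diffP.
exact: (@ex_derive _ _ _ _ _ _ _ (is_derive_cos_scaled c z)).
Qed.

Lemma measurable_sin_scaled (c : R) :
  measurable_fun [set: R] (fun t : R => sin (c * t)).
Proof. by apply: continuous_measurable_fun; exact: continuous_sin_scaled. Qed.

Lemma measurable_cos_scaled (c : R) :
  measurable_fun [set: R] (fun t : R => cos (c * t)).
Proof. by apply: continuous_measurable_fun; exact: continuous_cos_scaled. Qed.

(** Integration by parts against the constant function 1 plays the role of the fundamental theorem
    for the primitive [sin (c t) / c]. *)
Lemma Rintegral_cos_scaled (c : R) : c != 0 ->
  \int[mu]_(t in `]0, 1[) cos (c * t) = sin c / c.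
Proof.
move=> c0.
have ac1 : abs_continuous01 (cst (1 : R)).
  by apply: (@lipschitz_abs_continuous _ _ 0) => x y *; rewrite subrr normr0 mul0r.
have d1 : \forall x \ae mu, x \in `]0 : R, 1[ -> is_derive x 1 (cst (1 : R)) 0.
  by apply: aeW => x _; exact: is_derive_cst.
have dpsi (t : R) : is_derive t 1 (fun t => c^-1 * sin (c * t)) (cos (c * t)).
  have := @is_deriveZ _ _ _ _ c^-1 _ _ _ (is_derive_sin_scaled c t).
  by rewrite -[_ *: (_ * _)]/(_ * _) mulKf.
have i0 : mu.-integrable I01 (EFin \o cst 0) by exact: integrable0.
have := @ac_ibp _ _ _ _ _ `|c^-1| 1 ac1 i0 d1 dpsi _ (fun t => norm_cos_le1 _) _.
rewrite /= mulr1 mulr0 sin0 !mulr0 subr0 mul1r (mulrC c^-1).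
under eq_Rintegral do rewrite mul0r.
under [X in _ + X]eq_Rintegral do rewrite mul1r.
rewrite Rintegral_cst// mul0r add0r; apply.
  by move=> x; rewrite normrM ler_piMr// norm_sin_le1.
exact: measurable_cos_scaled.
Qed.

Lemma Rintegral_sin_scaled (c : R) : c != 0 ->
  \int[mu]_(t in `]0, 1[) sin (c * t) = (1 - cos c) / c.
Proof.
move=> c0.
have ac1 : abs_continuous01 (cst (1 : R)).
  by apply: (@lipschitz_abs_continuous _ _ 0) => x y *; rewrite subrr normr0 mul0r.
have d1 : \forall x \ae mu, x \in `]0 : R, 1[ -> is_derive x 1 (cst (1 : R)) 0.
  by apply: aeW => x _; exact: is_derive_cst.
have dpsi (t : R) : is_derive t 1 (fun t => - c^-1 * cos (c * t)) (sin (c * t)).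
  have := @is_deriveZ _ _ _ _ (- c^-1) _ _ _ (is_derive_cos_scaled c t).
  by rewrite -[_ *: (_ * _)]/(_ * _) mulrA mulrNN mulVf// mul1r.
have i0 : mu.-integrable I01 (EFin \o cst 0) by exact: integrable0.
have := @ac_ibp _ _ _ _ _ `|c^-1| 1 ac1 i0 d1 dpsi _ (fun t => norm_sin_le1 _) _.
rewrite /= mulr1 mulr0 cos0.
under eq_Rintegral do rewrite mul0r.
under [X in _ + X]eq_Rintegral do rewrite mul1r.
rewrite Rintegral_cst// mul0r add0r => ->; first by field.
  by move=> x; rewrite normrM normrN ler_piMr// norm_cos_le1.
exact: measurable_sin_scaled.
Qed.

Let w (p : nat) : R := pi * p.*2%:R.

Lemma sin_period_nat (p : nat) : sin (w p) = 0.
Proof.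
rewrite /w; elim: p => [|p IH]; first by rewrite mulr0 sin0.
rewrite doubleS -addn2 natrD mulrDr [pi * 2%:R]mulr_natr.
by rewrite sinD2pi.
Qed.

Lemma cos_period_nat (p : nat) : cos (w p) = 1.
Proof.
rewrite /w; elim: p => [|p IH]; first by rewrite mulr0 cos0.
rewrite doubleS -addn2 natrD mulrDr [pi * 2%:R]mulr_natr.
by rewrite cosD2pi.
Qed.

Let w_inj (p q : nat) : (w p - w q == 0) = (p == q).
Proof.
have pi0 : pi != 0 :> R by rewrite gt_eqF ?pi_gt0.
rewrite subr_eq0 /w (inj_eq (mulfI pi0)) eqr_nat.
by rewrite (inj_eq double_inj).
Qed.

Let int_cosB p q : \int[mu]_(t in `]0, 1[) cos ((w p - w q) * t) = (p == q)%:R.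
Proof.
case: (eqVneq p q) => [->|pq].
  under eq_Rintegral do rewrite subrr mul0r cos0.
  by rewrite Rintegral_cst//= lebesgue_measure_itv/= lte01 mul1r/= subr0.
rewrite Rintegral_cos_scaled ?w_inj// sinB !sin_period_nat.
by rewrite mul0r mulr0 subrr mul0r.
Qed.

Let int_sinB p q : \int[mu]_(t in `]0, 1[) sin ((w p - w q) * t) = 0.
Proof.
case: (eqVneq p q) => [->|pq].
  under eq_Rintegral do rewrite subrr mul0r sin0.
  by rewrite Rintegral_cst// mul0r.
rewrite Rintegral_sin_scaled ?w_inj// cosB !sin_period_nat !cos_period_nat.
by rewrite mul0r addr0 mulr1 subrr mul0r.
Qed.

Let wD p q : w p + w q = w (p + q) - w 0.
Proof. by rewrite /w doubleD natrD double0 mulr0 subr0 mulrDr. Qed.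

Definition trig (b : bool) (p : nat) (t : R) : R :=
  if b then sin (w p * t) else cos (w p * t).

Let icos (c : R) : mu.-integrable I01 (EFin \o (fun t => cos (c * t))).
Proof.
apply: measurable_bounded_integrable => //.
- by rewrite /= lebesgue_measure_itv/= lte01 ltry.
- by apply: measurable_funTS; exact: measurable_cos_scaled.
- by exists 1; split=> // y y1 t _ /=; rewrite (le_trans (norm_cos_le1 _))// ltW.
Qed.

Let isin (c : R) : mu.-integrable I01 (EFin \o (fun t => sin (c * t))).
Proof.
apply: measurable_bounded_integrable => //.
- by rewrite /= lebesgue_measure_itv/= lte01 ltry.
- by apply: measurable_funTS; exact: measurable_sin_scaled.
- by exists 1; split=> // y y1 t _ /=; rewrite (le_trans (norm_sin_le1 _))// ltW.
Qed.

Lemma norm_trig_le1 b p t : `|trig b p t| <= 1.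
Proof. by rewrite /trig; case: b; rewrite ?norm_sin_le1 ?norm_cos_le1. Qed.

Lemma measurable_trig b p : measurable_fun setT (trig b p).
Proof.
by rewrite /trig; case: b; [exact: measurable_sin_scaled|exact: measurable_cos_scaled].
Qed.

Lemma sqint_trig b p : sqint mu I01 (trig b p).
Proof.
apply: (@sqint_bounded _ _ _ _ _ _ _ 1) => //.
- by rewrite /= lebesgue_measure_itv/= lte01 ltry.
- by apply: measurable_funTS; exact: measurable_trig.
- by move=> x _; exact: norm_trig_le1.
Qed.

(** Product-to-sum formulas; sums and differences of frequencies are again whole numbers of periods,
    so each term integrates to 0 or 1. The term in [p + q = 0] accounts for frequency zero, where
    the cosine is the constant 1 and the sine vanishes. *)
Lemma ip_trig (b b' : bool) (p q : nat) :
  2 * ip mu I01 (trig b p) (trig b' q) =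
  (b == b')%:R * ((p == q)%:R + (-1) ^+ b * (p + q == 0)%N%:R).
Proof.
have H (f g h : R -> R) :
    mu.-integrable I01 (EFin \o g) -> mu.-integrable I01 (EFin \o h) ->
    (forall t, 2 * f t = g t + h t) ->
    mu.-integrable I01 (EFin \o f) ->
    2 * \int[mu]_(t in `]0, 1[) f t =
    \int[mu]_(t in `]0, 1[) g t + \int[mu]_(t in `]0, 1[) h t.
  move=> ig ih fgh fi; rewrite -RintegralZl// -RintegralD//.
  by apply: eq_Rintegral => t _.
have iN (f : R -> R) : mu.-integrable I01 (EFin \o f) ->
    mu.-integrable I01 (EFin \o (fun t => - f t)).
  by move=> /integrableN.
have RN (f : R -> R) : mu.-integrable I01 (EFin \o f) ->
    \int[mu]_(t in `]0, 1[) (- f t) = - \int[mu]_(t in `]0, 1[) f t.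
  move=> fi; under eq_Rintegral do rewrite -mulN1r.
  by rewrite RintegralZl// mulN1r.
have : mu.-integrable I01 (EFin \o (fun t => trig b p t * trig b' q t)).
  by apply: sqint_mul => //; exact: sqint_trig.
rewrite /ip /trig; case: b; case: b' => /= sm.
- rewrite (H _ _ _ (icos (w p - w q)) (iN _ (icos (w p + w q))) _ sm).
    by rewrite RN// wD !int_cosB; ring.
  by move=> t; rewrite !mulrDl mulNr cosB cosD; ring.
- rewrite (H _ _ _ (isin (w p - w q)) (isin (w p + w q)) _ sm).
    by rewrite wD !int_sinB; ring.
  by move=> t; rewrite !mulrDl mulNr sinB sinD; ring.
- rewrite (H _ _ _ (isin (w p + w q)) (iN _ (isin (w p - w q))) _ sm).
    by rewrite RN// wD !int_sinB; ring.
  by move=> t; rewrite !mulrDl mulNr sinB sinD; ring.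
- rewrite (H _ _ _ (icos (w p - w q)) (icos (w p + w q)) _ sm).
    by rewrite wD !int_cosB; ring.
  by move=> t; rewrite !mulrDl mulNr cosB cosD; ring.
Qed.

Lemma phiE k : (0 < k)%N ->
  phi k = fun t : R => (if k == 1%N then 1 else Num.sqrt 2) *
                    trig (odd k && (k != 1%N)) k./2 t.
Proof.
move=> k0; apply/funext => t; rewrite /phi /trig /w.
case: eqP => [->/=|k1]; first by rewrite double0 mulr0 mul0r cos0 mulr1.
by have := odd_double_half k; case: (odd k) => /= kE; rewrite -{1}kE.
Qed.

Lemma measurable_phi k : (0 < k)%N -> measurable_fun setT (phi k : R -> R).
Proof. by move=> /phiE ->; apply: measurable_funM => //; exact: measurable_trig. Qed.

Lemma sqint_phi k : (0 < k)%N -> sqint mu I01 (phi k).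
Proof. by move=> /phiE ->; apply: sqintZ => //; exact: sqint_trig. Qed.

Lemma phi_sqr_le k (t : R) : (0 < k)%N -> phi k t ^+ 2 <= 2.
Proof.
move=> /phiE ->; rewrite exprMn -[leRHS]mulr1 ler_pM ?sqr_ge0//.
  by case: ifP => _; [rewrite expr1n ler1n|rewrite sqr_sqrtr].
by rewrite -(real_normK (num_real _)) expr_le1// norm_trig_le1.
Qed.

Lemma phi_orthonormal j k : (0 < j)%N -> (0 < k)%N ->
  ip mu I01 (phi j) (phi k) = (j == k)%:R.
Proof.
move=> j0 k0; rewrite (phiE j0) (phiE k0) ipZl//; [|exact: sqint_trig|]; last first.
  by apply: sqintZ => //; exact: sqint_trig.
rewrite ipC ipZl//; [|exact: sqint_trig|exact: sqint_trig].
rewrite ipC -[ip _ _ _ _](mulKf (_ : 2 != 0 :> R))// ip_trig.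
have half0 i : (0 < i)%N -> i != 1%N -> (i./2 == 0)%N = false by case: i => [|[]].
have [->|j1] := eqVneq j 1%N; have [->|k1] := eqVneq k 1%N.
- rewrite -[odd 1 && ~~ true]/false -[1./2]/0%N eqxx addn0 eqxx expr0 !mul1r.
  by rewrite -natrD mulVf.
- rewrite -[odd 1 && ~~ true]/false -[1./2]/0%N add0n !(eq_sym 0%N) half0//.
  by rewrite mulr0 addr0 !mulr0.
- rewrite -[odd 1 && ~~ true]/false -[1./2]/0%N addn0 half0//.
  by rewrite (negbTE j1) mulr0 addr0 !mulr0.
rewrite -[~~ false]/true !andbT addn_eq0 half0//= mulr0 addr0 -natrM mulnb.
have -> : (odd j == odd k) && (j./2 == k./2) = (j == k).
  apply/andP/eqP => [[/eqP oj /eqP hj]|->//].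
  by rewrite -[j]odd_double_half -[k]odd_double_half oj hj.
by rewrite !mulrA -expr2 sqr_sqrtr// mulfV// mul1r.
Qed.

End TrigonometricBasis.

(** * Decay of the Fourier coefficients of Sobolev functions *)

Section FourierCoefficients.
Context {R : realType}.
Local Notation mu := (@lebesgue_measure R).
Local Notation I01 := (`]0 : R, 1[%classic : set R).

(** The weight [a_k] of the Sobolev ellipsoid is the [alpha]-th power of this number: [k] if even,
    [k - 1] if odd. *)
Definition freq (k : nat) : nat := k./2.*2.

(** The derivative of [phi k] is a multiple of [phi (partner k)]. *)
Definition partner (k : nat) : nat := if odd k then k.-1 else k.+1.

Lemma odd_partner k : odd (partner k) = ~~ odd k.
Proof. by rewrite /partner; case: k => [//|k] /=; case e : (odd k); rewrite /= ?e. Qed.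

Lemma partnerK : involutive partner.
Proof.
move=> k; rewrite {1}/partner odd_partner /partner.
by case: k => [//|k] /=; case: (odd k).
Qed.

Lemma partner_ge2 k : (2 <= k)%N -> (2 <= partner k)%N.
Proof.
rewrite /partner; case: k => [|[|[|k]]]//=.
by rewrite negbK; case: (odd k).
Qed.

Lemma freq_partner k : freq (partner k) = freq k.
Proof.
rewrite /freq /partner; case: ifPn => ok.
  by rewrite -{2}(odd_double_half k) ok add1n -{1}(odd_double_half k) ok add1n /= uphalf_double doubleK.
by rewrite -{1}(odd_double_half k) (negbTE ok) add0n /= uphalf_double.
Qed.

(** Guarantees that every coefficient discarded by a truncation at [K] has frequency at least
    [K]. *)
Lemma freq_ge k : (k.-1 <= freq k)%N.
Proof.
by rewrite /freq -{1}(odd_double_half k); case: (odd k) => //=; rewrite leq_pred.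
Qed.

Lemma is_derive_phi k (t : R) : (2 <= k)%N ->
  is_derive t 1 (phi k)
    ((-1) ^+ (~~ odd k) * (pi * (freq k)%:R) * phi (partner k) t).
Proof.
move=> k2; have k0 : (0 < k)%N by exact: leq_trans k2.
have k1 : k != 1%N by rewrite gtn_eqF.
have p2 := partner_ge2 k2.
have p0 : (0 < partner k)%N by exact: leq_trans p2.
have p1 : partner k != 1%N by rewrite gtn_eqF.
rewrite (phiE k0) (phiE p0) (negbTE k1) (negbTE p1) !andbT odd_partner.
have -> : (partner k)./2 = k./2.
  by apply: double_inj; exact: freq_partner.
rewrite /trig /freq; set c := pi * _; case: (odd k) => /=.
  have := @is_deriveZ _ _ _ _ (Num.sqrt 2) _ _ _ (is_derive_sin_scaled c t).
  by congr is_derive; rewrite -[_ *: _]/(_ * _); ring.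
have := @is_deriveZ _ _ _ _ (Num.sqrt 2) _ _ _ (is_derive_cos_scaled c t).
by congr is_derive; rewrite -[_ *: _]/(_ * _); ring.
Qed.

Lemma phi_periodic k : (0 < k)%N -> phi k 1 = phi k 0 :> R.
Proof.
move=> /phiE ->; rewrite /trig !mulr1 !mulr0 sin0 cos0.
by rewrite sin_period_nat cos_period_nat.
Qed.

Lemma phi_norm_le k (t : R) : (0 < k)%N -> `|phi k t| <= 2.
Proof.
move=> k0; rewrite -(@ler_pXn2r _ 2) ?nnegrE// -normrX ger0_norm ?sqr_ge0//.
by rewrite (le_trans (phi_sqr_le _ k0))// expr2 ler_peMl// ler1n.
Qed.

Lemma abs_continuous_sqint (F : R -> R) : abs_continuous01 F -> sqint mu I01 F.
Proof.
move=> acF; have [C FC] := abs_continuous_bounded acF.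
apply: (@sqint_bounded _ _ _ _ _ _ _ C) => //.
- by rewrite /= lebesgue_measure_itv/= lte01 ltry.
- exact: abs_continuous_measurable.
- by move=> x /=; rewrite in_itv/= => /andP[x0 x1]; rewrite FC// !ltW.
Qed.

(** Integrate by parts against [phi (partner k)], whose derivative is a signed multiple of [phi k].
    Periodicity of [F] and of the basis removes the boundary terms, and squaring removes the
    sign. *)
Lemma fourier_coef_derive (F G : R -> R) k : (2 <= k)%N ->
  abs_continuous01 F -> mu.-integrable I01 (EFin \o G) ->
  (\forall x \ae mu, x \in `]0 : R, 1[ -> is_derive x 1 F (G x)) ->
  F 0 = F 1 ->
  (pi * (freq k)%:R) ^+ 2 * ip mu I01 F (phi k) ^+ 2 =
  ip mu I01 G (phi (partner k)) ^+ 2.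
Proof.
move=> k2 acF iG dF F01; have k0 : (0 < k)%N by exact: leq_trans k2.
have p2 := partner_ge2 k2.
have p0 : (0 < partner k)%N by exact: leq_trans p2.
have dpsi (t : R) := is_derive_phi t p2.
rewrite partnerK freq_partner in dpsi.
set c := (-1) ^+ _ * _ in dpsi.
have c2 : c ^+ 2 = (pi * (freq k)%:R) ^+ 2 by rewrite /c exprMn sqrr_sign mul1r.
have bc (t : R) : `|c * phi k t| <= `|c| * 2 by rewrite normrM ler_wpM2l ?phi_norm_le.
have mc : measurable_fun setT (fun t : R => c * phi k t).
  by apply: measurable_funM => //; exact: measurable_phi.
have := ac_ibp acF iG dF dpsi (fun t => phi_norm_le t p0) bc mc.
rewrite F01 phi_periodic// subrr => /eqP; rewrite addr_eq0 => /eqP E.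
have -> : ip mu I01 G (phi (partner k)) = - (c * ip mu I01 F (phi k)).
  rewrite /ip E -RintegralZl//; last first.
    by apply: sqint_mul => //; [exact: abs_continuous_sqint|exact: sqint_phi].
  by congr (- _); apply: eq_Rintegral => t _; ring.
by rewrite sqrrN [RHS]exprMn c2.
Qed.

(** Descending induction: absolute continuity is given for the last classical derivative and passes
    from a derivative to its primitive. *)
Lemma derivatives_abs_continuous (alpha : nat) (D : nat -> R -> R) :
  (0 < alpha)%N ->
  (forall j, (j.+1 < alpha)%N -> derivative01 (D j) (D j.+1)) ->
  abs_continuous01 (D alpha.-1) ->
  forall j, (j < alpha)%N -> abs_continuous01 (D j).
Proof.
move=> a0 dD acD j ja.
rewrite -(subKn (_ : j <= alpha.-1)%N); last by rewrite -ltnS prednK.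
elim: (alpha.-1 - j)%N => [|i IH]; first by rewrite subn0.
have [ia|ia] := ltnP i alpha.-1; last first.
  by have -> : (alpha.-1 - i.+1 = alpha.-1 - i)%N by lia.
have E : (alpha.-1 - i = (alpha.-1 - i.+1).+1)%N by lia.
rewrite E in IH; apply: derivative01_abs_continuous IH; apply: dD; lia.
Qed.

Lemma fourier_tail_le (alpha : nat) (L : R) (f : R -> R) (K N : nat) :
  (0 < alpha)%N -> (0 < K)%N -> Wper alpha L f ->
  \sum_(K.+1 <= k < N) ip mu I01 f (phi k) ^+ 2 <= L ^+ 2 * K%:R ^- (2 * alpha).
Proof.
move=> a0 K0 [D [D0 dD acD [mDa dDa Da2] Dper]].
have acDj := derivatives_abs_continuous a0 dD acD.
have muI : (mu I01 < +oo)%E by rewrite /= lebesgue_measure_itv/= lte01 ltry.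
have sub01 : I01 `<=` `[0, 1].
  by move=> x /=; rewrite !in_itv/= => /andP[/ltW-> /ltW->].
have Da2' : (\int[mu]_(x in I01) ((D alpha x) ^+ 2)%:E <= (L ^+ 2)%:E)%E.
  apply: le_trans Da2; apply: ge0_subset_integral => //.
    by apply/measurable_EFinP; exact: measurable_funX.
  by move=> x _; rewrite lee_fin sqr_ge0.
have sDa : sqint mu I01 (D alpha).
  apply/sqintP => //; split; first exact: measurable_funS mDa.
  by apply: (le_lt_trans Da2'); rewrite ltry.
have sD j : (j <= alpha)%N -> sqint mu I01 (D j).
  rewrite leq_eqVlt => /orP[/eqP->//|ja].
  by apply: abs_continuous_sqint; exact: acDj.
have dDj j : (j < alpha)%N ->
    \forall x \ae mu, x \in `]0 : R, 1[ -> is_derive x 1 (D j) (D j.+1 x).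
  move=> ja; have [ja1|ja1] := ltnP j.+1 alpha.
    by apply: aeW => x x01; apply: derivative01_is_derive => //; exact: dD.
  by rewrite (_ : j = alpha.-1) ?prednK//; lia.
have iterp j k : (2 <= k)%N -> (2 <= iter j partner k)%N.
  by move=> k2; elim: j => //= j; exact: partner_ge2.
have iterf j k : freq (iter j partner k) = freq k.
  by elim: j => //= j; rewrite freq_partner.
have coefj j k : (2 <= k)%N -> (j <= alpha)%N ->
    (pi * (freq k)%:R) ^+ (2 * j) * ip mu I01 f (phi k) ^+ 2 =
    ip mu I01 (D j) (phi (iter j partner k)) ^+ 2.
  move=> k2; elim: j => [_|j IH ja].
    rewrite muln0 expr0 mul1r; congr (_ ^+ 2); apply: eq_ip => // x.
    by rewrite inE => x01; rewrite D0.
  rewrite mulnS exprD -mulrA IH ?(ltnW ja)// iterS.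
  rewrite -(@fourier_coef_derive (D j)) ?iterp ?iterf//.
  - exact: acDj.
  - by apply: sqint_integrable => //; exact: sD.
  - exact: dDj.
  - exact: Dper.
have K0' : 0 < (K%:R : R) ^+ (2 * alpha) by rewrite exprn_gt0// ltr0n.
rewrite ler_pdivlMr// mulr_suml.
apply: (@le_trans _ _ (\sum_(K.+1 <= k < N)
    ip mu I01 (D alpha) (phi (iter alpha partner k)) ^+ 2)).
  rewrite big_nat [leRHS]big_nat; apply: ler_sum => k /andP[Kk _].
  rewrite -coefj//; last by lia.
  (* Only [pi >= 1] and [freq k >= K] are kept of the factor [(pi * freq k)^(2 alpha)]. *)
  rewrite mulrC ler_wpM2r ?sqr_ge0// lerXn2r ?nnegrE ?mulr_ge0 ?pi_ge0//.
  rewrite (@le_trans _ _ (freq k)%:R)//.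
    by rewrite ler_nat (leq_trans _ (freq_ge k))//; lia.
  by rewrite ler_peMl// (le_trans _ (pi_ge2 R))// ler1n.
rewrite -{1}[K.+1]add0n big_addn big_mkord.
apply: (@le_trans _ _ (ip mu I01 (D alpha) (D alpha))).
  (* Iterates of the involution [partner] are injective, so the permuted basis functions remain
     orthonormal and Bessel's inequality applies to the last derivative. *)
  pose e (i : 'I_(N - K.+1)) : R -> R := phi (iter alpha partner (i + K.+1)%N).
  apply: (@bessel _ _ _ mu I01 _ _ e) => //.
  - by move=> i; apply: sqint_phi; apply: leq_trans (iterp _ _ _); lia.
  - move=> i j; rewrite phi_orthonormal.
    + have injp n : injective (iter n partner).
        by elim: n => // n IHn x y /= /(inv_inj partnerK)/IHn.
      rewrite (inj_eq (injp _)).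
      by rewrite eqn_add2r.
    + by apply: leq_trans (iterp _ _ _); lia.
    + by apply: leq_trans (iterp _ _ _); lia.
by rewrite -lee_fin EFin_ip.
Qed.

End FourierCoefficients.

(** * Fourier series of Sobolev functions *)

Section PointwiseConvergence.
Context {R : realType}.
Local Notation mu := (@lebesgue_measure R).
Local Notation I01 := (`]0 : R, 1[%classic : set R).

Lemma cvg0_of_bounded_sum_sqr (u : R^nat) (B : R) :
  (forall n, \sum_(0 <= i < n) u i ^+ 2 <= B) -> u @ \oo --> (0 : R).
Proof.
move=> uB; pose v n := u n ^+ 2.
have cv : cvgn (series v).
  apply: nondecreasing_is_cvgn.
    by apply: nondecreasing_series => n _ _; exact: sqr_ge0.
  by exists B => _ [n _ <-]; exact: uB.
have := cvg_series_cvg_0 cv.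
move=> /cvgrPdist_lt h; apply/cvgrPdist_lt => e e0.
have e20 : 0 < e ^+ 2 by rewrite exprn_gt0.
move: (h _ e20); apply: filterS => n.
rewrite !sub0r !normrN /v normrX => he.
by rewrite -(@ltr_pXn2r _ 2) ?nnegrE// ltW.
Qed.

(** For square integrable [g] this is Bessel's inequality: [sqrt 2] times the trigonometric
    functions of positive frequency and fixed parity form an orthonormal family, so the squared
    coefficients have bounded sums. Frequency 0 is normalised differently, whence the shift of the
    index. *)
Lemma riemann_lebesgue (b : bool) (g : R -> R) : sqint mu I01 g ->
  ip mu I01 g (trig b n) @[n --> \oo] --> (0 : R).
Proof.
move=> sg; rewrite -cvg_shiftS.
apply: (@cvg0_of_bounded_sum_sqr _ (ip mu I01 g g)) => n.
have E i : ip mu I01 g (trig b i.+1) ^+ 2 = 2^-1 * ip mu I01 g (phi (i.*2.+2 + b)) ^+ 2.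
  rewrite phiE; last by lia.
  have -> : ((i.*2.+2 + b)%N == 1%N) = false by lia.
  have -> : odd (i.*2.+2 + b) && ~~ false = b.
    by rewrite oddD /= negbK odd_double /= andbT oddb.
  have -> : (i.*2.+2 + b)./2 = i.+1.
    by rewrite -doubleS addnC half_bit_double.
  rewrite [in RHS]ipC ipZl//; last exact: sqint_trig.
  by rewrite exprMn sqr_sqrtr// mulKf// ipC.
under eq_bigr do rewrite /= E.
rewrite -mulr_sumr big_mkord ler_pdivrMl//.
pose e (i : 'I_n) : R -> R := phi (i.*2.+2 + b).
have h : \sum_i ip mu I01 g (e i) ^+ 2 <= ip mu I01 g g.
  apply: bessel => //.
  - by move=> i; apply: sqint_phi; lia.
  - move=> i j; rewrite phi_orthonormal; [|lia|lia].
    by rewrite eqn_add2r !eqSS (inj_eq double_inj).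
by rewrite (le_trans h)// ler_peMl ?ip_ge0// ler1n.
Qed.

Lemma is_derive_near (H : R -> R) (s l : R) : is_derive s 1 H l ->
  forall e, 0 < e -> exists2 r, 0 < r &
    forall y, `|y - s| < r -> `|H y - H s - l * (y - s)| <= e * `|y - s|.
Proof.
move=> dH e e0.
have dl : is_derive s 1 (fun y => l * (y - s)) l.
  have := @is_deriveZ _ _ _ _ l _ _ _ (is_deriveB (is_derive_id s 1) (is_derive_cst s s 1)).
  by rewrite subr0 -[_ *: _]/(_ * _) mulr1.
have := is_deriveB dH dl; rewrite subrr => /is_derive0_near/(_ e e0)[r r0 h].
exists r => // y /h; rewrite -[(H - _) y]/(H y - l * (y - s)).
by rewrite -[(H - _) s]/(H s - l * (s - s)) subrr mulr0 subr0 addrAC.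
Qed.

(** The sum stops at the odd index [2 N + 1], so that every cosine comes with the sine of the same
    frequency. *)
Definition dirichlet_kernel (N : nat) (t x : R) : R :=
  \sum_(1 <= k < N.*2.+2) phi k t * phi k x.

(** Stated without a quotient because the sine vanishes at [t = x]. With [u = pi (t - x)], a new
    pair contributes [2 cos ((2 N + 2) u)], and its product with [sin u] is
    [sin ((2 N + 3) u) - sin ((2 N + 1) u)], which telescopes. *)
Lemma dirichlet_kernelE N (t x : R) :
  sin (pi * (t - x)) * dirichlet_kernel N t x = sin (N.*2.+1%:R * (pi * (t - x))).
Proof.
elim: N => [|N IH]; first by rewrite /dirichlet_kernel big_nat1 !mulr1 mul1r.
rewrite /dirichlet_kernel doubleS big_nat_recr// big_nat_recr//= -/(dirichlet_kernel N t x).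
have ok : odd N.*2.+2 = false by rewrite /= negbK odd_double.
have -> : phi N.*2.+2 t * phi N.*2.+2 x = 2 * (cos (N.*2.+2%:R * (pi * t)) *
    cos (N.*2.+2%:R * (pi * x))) :> R.
  rewrite /phi ok /= mulrACA -expr2 sqr_sqrtr//.
  by rewrite -!(mulrA pi) !(mulrCA _ pi).
have -> : phi N.*2.+3 t * phi N.*2.+3 x = 2 * (sin (N.*2.+2%:R * (pi * t)) *
    sin (N.*2.+2%:R * (pi * x))) :> R.
  rewrite /phi [odd _]/= -[~~ ~~ odd _]/(odd N.*2.+2) ok /=.
  rewrite mulrACA -expr2 sqr_sqrtr//.
  by rewrite -!(mulrA pi) !(mulrCA _ pi).
rewrite -addrA -mulrDr -cosB -mulrBr -mulrBr mulrDr IH.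
set u := pi * (t - x).
have -> : N.*2.+1%:R * u = N.*2.+2%:R * u - u by rewrite -[N.*2.+2%:R]natr1; ring.
have -> : N.*2.+3%:R * u = N.*2.+2%:R * u + u by rewrite -[N.*2.+3%:R]natr1; ring.
by rewrite sinB sinD; ring.
Qed.

(** Below some [r] the derivative [pi] at 0 gives the constant 1; on [[r, m]] the continuous
    function [sin (pi s)] has a positive minimum, since [m < 1] stays away from its next zero. *)
Lemma sin_lower_bound (m : R) : 0 <= m -> m < 1 ->
  exists2 c, 0 < c & forall s, `|s| <= m -> c * `|s| <= `|sin (pi * s)|.
Proof.
move=> m0 m1.
have d0 : is_derive (0 : R) 1 (fun s => sin (pi * s)) pi.
  by have := is_derive_sin_scaled pi (0 : R); rewrite mulr0 cos0 mulr1.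
have [r r0 hr] := is_derive_near d0 ltr01.
have near0 s : `|s| < r -> `|s| <= `|sin (pi * s)|.
  move=> sr; have := hr s; rewrite !subr0 mulr0 sin0 subr0 mul1r => /(_ sr).
  have : `|pi * s| <= `|sin (pi * s)| + `|sin (pi * s) - pi * s|.
    have {1}-> : pi * s = sin (pi * s) - (sin (pi * s) - pi * s) by ring.
    exact: ler_normB.
  rewrite normrM (ger0_norm (pi_ge0 _)); have := pi_ge2 R; have := normr_ge0 s.
  by nra.
have [rm|mr] := leP r m; last first.
  by exists 1 => // s sm; rewrite mul1r near0// (le_lt_trans sm).
have [|a am ha] := @EVT_min _ (fun s : R => sin (pi * s)) _ _ rm.
  by apply: continuous_subspaceT; exact: continuous_sin_scaled.
have a0 : 0 < sin (pi * a).
  move: am; rewrite in_itv/= => /andP[ra am].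
  rewrite sin_gt0_pi// mulr_gt0 ?pi_gt0 ?(lt_le_trans r0)//=.
  by rewrite gtr_pMr ?pi_gt0// (le_lt_trans am).
exists (Num.min 1 (sin (pi * a))); first by rewrite lt_min ltr01.
move=> s sm; have [sr|rs] := ltP `|s| r.
  by rewrite (le_trans _ (near0 _ sr))// ler_piMl// ge_min lexx.
apply: (@le_trans _ _ (sin (pi * a))).
  by rewrite (le_trans (_ : _ <= Num.min 1 (sin (pi * a)))) ?ge_min ?lexx ?orbT//
    ler_piMr ?(le_trans sm (ltW m1))// le_min ler01 ltW.
have -> : `|sin (pi * s)| = `|sin (pi * `|s|)|.
  by case: (ger0P s) => // _; rewrite mulrN sinN normrN.
rewrite (le_trans _ (ler_norm _))// ha// in_itv/= rs.
exact: sm.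
Qed.

(** Near [x] because [f] is differentiable, away from [x] because the sine does
    not vanish there. *)
Lemma dirichlet_quotient_bounded (f : R -> R) (x l C : R) : x \in `]0, 1[ ->
  is_derive x 1 f l -> (forall t, t \in `]0, 1[ -> `|f t| <= C) ->
  exists M, forall t, t \in `]0, 1[ ->
    `|(f t - f x) / sin (pi * (t - x))| <= M.
Proof.
rewrite in_itv/= => /andP[x0 x1] df fC.
have fx : `|f x| <= C by apply: fC; rewrite in_itv/= x0.
have [r r0 hr] := is_derive_near df ltr01.
(* The supremum of [|t - x|] over the unit interval, less than 1 because [x] is interior. *)
pose m := Num.max x (1 - x).
have m0 : 0 <= m by rewrite le_max ltW.
have m1 : m < 1 by rewrite gt_max x1/=; lra.
have [c c0 hc] := sin_lower_bound m0 m1.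
exists (Num.max ((`|l| + 1) / c) (2 * C / (c * r))) => t.
rewrite in_itv/= => /andP[t0 t1].
have tm : `|t - x| <= m.
  rewrite ler_norml /m; apply/andP; split; last by rewrite le_max; apply/orP; right; lra.
  by rewrite lerNl le_max; apply/orP; left; lra.
have C0 : 0 <= C by exact: le_trans fx.
have [->|tx] := eqVneq t x.
  by rewrite subrr mul0r normr0 le_max divr_ge0// ltW.
have tx0 : 0 < `|t - x| by rewrite normr_gt0 subr_eq0.
have s0 : 0 < `|sin (pi * (t - x))|.
  by apply: lt_le_trans (hc _ tm); rewrite mulr_gt0.
rewrite normrM normfV le_max; have [tr|rt] := ltP `|t - x| r; apply/orP.
  left; rewrite ler_pdivrMr// mulrAC ler_pdivlMr//.
  apply: (@le_trans _ _ ((`|l| + 1) * (c * `|t - x|))); last first.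
    by rewrite ler_wpM2l ?hc// addr_ge0.
  rewrite mulrCA mulrC ler_wpM2l ?(ltW c0)// mulrDl [leRHS]addrC.
  have -> : f t - f x = f t - f x - l * (t - x) + l * (t - x) by rewrite subrK.
  by rewrite (le_trans (ler_normD _ _))// lerD ?hr// normrM.
right; rewrite ler_pdivrMr// mulrAC ler_pdivlMr ?mulr_gt0//.
have h1 : `|f t - f x| <= 2 * C.
  rewrite (le_trans (ler_normB _ _))// mulr_natl mulr2n lerD// fC//.
  by rewrite in_itv/= t0.
have h2 : c * r <= `|sin (pi * (t - x))|.
  by rewrite (le_trans _ (hc _ tm))// ler_wpM2l// ltW.
rewrite ler_pM// ?mulr_ge0// ltW//; lra.
Qed.

End PointwiseConvergence.

Section FourierSeries.
Context {R : realType}.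
Local Notation mu := (@lebesgue_measure R).
Local Notation I01 := (`]0 : R, 1[%classic : set R).

Lemma measurable_inv : measurable_fun [set: R] (@GRing.inv R).
Proof.
have := @measurable_fun_if _ _ R R (cst 0) (@GRing.inv R) setT measurableT
  (fun x : R => x == 0).
have -> : (fun x : R => if x == 0 then cst 0 x else x^-1) = @GRing.inv R.
  by apply/funext => x; case: eqVneq => // ->; rewrite invr0.
apply.
- exact: measurable_fun_eqr.
- exact: measurable_cst.
- have -> : [set: R] `&` (fun x : R => x == 0) @^-1` [set false] = ~` [set 0].
    by apply/seteqP; split => [x [_ /= /eqP]|x /= /eqP/negbTE].
  apply: open_continuous_measurable_fun.
    by rewrite openC; exact: closed_eq.
  by move=> x; rewrite inE => /= /eqP x0; exact: inv_continuous.
Qed.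

Section Pointwise.
Variables (f : R -> R) (C : R).
Hypothesis mf : measurable_fun I01 f.
Hypothesis fC : forall t, t \in `]0, 1[ -> `|f t| <= C.

Let sf : sqint mu I01 f.
Proof.
apply: (@sqint_bounded _ _ _ _ _ _ _ C) => //.
by rewrite /= lebesgue_measure_itv/= lte01 ltry.
Qed.

(** As the Dirichlet kernel has integral 1, the error of the partial sum is the integral of
    [(f t - f x)] against it. By the closed form of the kernel this is the integral of the bounded
    quotient [q] against a sine of growing frequency. *)
Lemma fourier_series_cvg (x l : R) : x \in `]0, 1[ -> is_derive x 1 f l ->
  (\sum_(1 <= k < N.*2.+2) ip mu I01 f (phi k) * phi k x) @[N --> \oo] --> f x.
Proof.
move=> x01 df.
have [M qM] := dirichlet_quotient_bounded x01 df fC.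
pose q t := (f t - f x) / sin (pi * (t - x)).
have muI : (mu I01 < +oo)%E by rewrite /= lebesgue_measure_itv/= lte01 ltry.
have mq : measurable_fun I01 q.
  apply: measurable_funM; first exact: measurable_funB.
  apply: (measurableT_comp measurable_inv); apply: measurable_funTS.
  apply: (measurableT_comp (continuous_measurable_fun (@continuous_sin R))).
  apply: measurable_funM => //.
  exact: measurable_funB.
have sqM (h : R -> R) : measurable_fun setT h -> (forall t, `|h t| <= 1) ->
    sqint mu I01 (fun t => q t * h t).
  move=> mh h1; apply: (@sqint_bounded _ _ _ _ _ _ _ M) => //.
    by apply: measurable_funM => //; exact: measurable_funTS.
  move=> t t01; rewrite normrM (le_trans _ (qM t t01))// ler_piMr//.
(* The angle is [2 pi N t + pi t - c N]. The middle summand is absorbed into [q1] and [q2]; the last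
   one does not involve [t] and leaves bounded factors outside of the integrals. *)
pose q1 t := q t * cos (pi * t); pose q2 t := q t * sin (pi * t).
have sq1 : sqint mu I01 q1.
  by apply: sqM; [exact: measurable_cos_scaled|move=> t; exact: norm_cos_le1].
have sq2 : sqint mu I01 q2.
  by apply: sqM; [exact: measurable_sin_scaled|move=> t; exact: norm_sin_le1].
pose a b g N := ip mu I01 g (trig b N).
pose c N : R := N.*2.+1%:R * (pi * x).
have E N : \sum_(1 <= k < N.*2.+2) ip mu I01 f (phi k) * phi k x - f x =
    cos (c N) * (a true q1 N + a false q2 N) +
    sin (c N) * (a true q2 N - a false q1 N).
  pose D t := dirichlet_kernel N t x.
  have DE : D = fun t => \sum_(1 <= k < N.*2.+2 | (1 <= k < N.*2.+2)%N)
      (phi k x * phi k t).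
    by apply/funext => t; rewrite /D /dirichlet_kernel big_nat;
      apply: eq_bigr => k _; rewrite mulrC.
  have sphi k : (1 <= k < N.*2.+2)%N -> sqint mu I01 (fun t => phi k x * phi k t).
    by move=> /andP[k0 _]; apply: sqintZ => //; exact: sqint_phi.
  have sD : sqint mu I01 D by rewrite DE; exact: sqint_sum.
  have ipD g : sqint mu I01 g ->
      \sum_(1 <= k < N.*2.+2) ip mu I01 g (phi k) * phi k x = ip mu I01 g D.
    move=> sg; rewrite ipC DE ip_suml// big_nat; apply: eq_bigr => k /andP[k0 _].
    by rewrite ipZl//; [rewrite ipC mulrC|exact: sqint_phi].
  have phi1 : phi 1 = cst 1 :> (R -> R) by [].
  have s1 : sqint mu I01 (cst (1 : R)) by rewrite -phi1; exact: sqint_phi.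
  have ip1 : ip mu I01 (cst 1) D = 1.
    rewrite -ipD// big_ltn// -phi1 phi_orthonormal// eqxx phi1 mulr1.
    rewrite big_nat big1 ?addr0// => k /andP[k1 _].
    by rewrite -phi1 phi_orthonormal ?(ltnW k1)// ltn_eqF// mul0r.
  have -> : \sum_(1 <= k < N.*2.+2) ip mu I01 f (phi k) * phi k x - f x =
      ip mu I01 (fun t => f t - f x * cst 1 t) D.
    by rewrite ipBl ?ipZl// ?ip1 ?mulr1 ?ipD//; exact: sqintZ.
  have isq g b : sqint mu I01 g ->
      mu.-integrable I01 (EFin \o (fun t => g t * trig b N t)).
    by move=> sg; apply: sqint_mul => //; exact: sqint_trig.
  have iZ g (r : R) : mu.-integrable I01 (EFin \o g) ->
      mu.-integrable I01 (EFin \o (fun t => r * g t)).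
    by move=> /(@integrableZl _ _ _ _ _ _ r) => /(_ (measurable_itv _)).
  have iDD g h : mu.-integrable I01 (EFin \o g) -> mu.-integrable I01 (EFin \o h) ->
      mu.-integrable I01 (EFin \o (fun t => g t + h t)).
    exact: integrable_add_EFin.
  have iA := isq q1 true sq1.
  have iB := isq q2 false sq2.
  have iC := isq q2 true sq2.
  have iD := isq q1 false sq1.
  have iAB := iDD _ _ iA iB.
  have iND := iZ _ (-1) iD.
  have iCD := iDD _ _ iC iND.
  rewrite -mulN1r /a /ip -RintegralZl// -!RintegralD//; try exact: iZ.
  rewrite -!RintegralZl// -RintegralD//; try exact: iZ.
  apply: eq_Rintegral => t; rewrite inE /= in_itv/= => /andP[t0 t1].
  (* At [t = x] both sides are 0, the inverse of 0 being 0. *)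
  have st : q t * sin (pi * (t - x)) = f t - f x * cst 1 t.
    rewrite mulr1 /q; have [->|tx] := eqVneq t x; first by rewrite !subrr !mul0r.
    rewrite divfK//.
    move: x01; rewrite in_itv/= => /andP[x0 x1].
    have tx1 : `|t - x| < 1 by rewrite ltr_norml; lra.
    have [r r0 hr] := sin_lower_bound (normr_ge0 _) tx1.
    rewrite -normr_gt0; apply: lt_le_trans (hr _ (lexx _)).
    by rewrite mulr_gt0// normr_gt0 subr_eq0.
  rewrite -st -mulrA dirichlet_kernelE /q1 /q2 /trig.
  have -> : N.*2.+1%:R * (pi * (t - x)) = pi * N.*2%:R * t + pi * t - c N.
    by rewrite /c -[N.*2.+1%:R]natr1; ring.
  by rewrite sinB sinD cosD; ring.
apply/subr_cvg0.
under eq_fun do rewrite E.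
pose e N := `|a true q1 N| + `|a false q2 N| + (`|a true q2 N| + `|a false q1 N|).
have e0 : e N @[N --> \oo] --> (0 : R).
  have n0 b g : sqint mu I01 g -> `|a b g N| @[N --> \oo] --> (0 : R).
    by move=> sg; apply/norm_cvg0P; exact: riemann_lebesgue.
  have := cvgD (cvgD (n0 true _ sq1) (n0 false _ sq2))
               (cvgD (n0 true _ sq2) (n0 false _ sq1)).
  by rewrite !addr0; exact.
apply: norm_cvg0; apply: (@squeeze_cvgr _ _ _ _ (cst 0) e) => //; last exact: cvg_cst.
near=> N; rewrite normr_ge0 /= (le_trans (ler_normD _ _))// lerD//.
  rewrite normrM (le_trans (_ : _ <= 1 * `|a true q1 N + a false q2 N|))//.
    by rewrite ler_wpM2r// norm_cos_le1.
  by rewrite mul1r ler_normD.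
rewrite normrM (le_trans (_ : _ <= 1 * `|a true q2 N - a false q1 N|))//.
  by rewrite ler_wpM2r// norm_sin_le1.
by rewrite mul1r ler_normB.
Unshelve. all: by end_near. Qed.
Lemma fourier_remainder_le (K : nat) (B : R) :
  (forall t, t \in `]0, 1[ -> derivable f t 1) ->
  (forall N, \sum_(K.+1 <= k < N) ip mu I01 f (phi k) ^+ 2 <= B) ->
  (\int[mu]_(t in `]0%R, 1%R[)
    ((f t - \sum_(1 <= k < K.+1) ip mu I01 f (phi k) * phi k t) ^+ 2)%:E
   <= B%:E)%E.
Proof.
move=> df tailB.
(* The upper limit exceeds [K] for every [N], and it is one of the odd truncations for which
   convergence is known. *)
pose T N t := \sum_(K.+1 <= k < (N + K).*2.+2) ip mu I01 f (phi k) * phi k t.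
have sT N : sqint mu I01 (T N).
  rewrite (_ : T N = fun t => \sum_(K.+1 <= k < (N + K).*2.+2 |
      (K.+1 <= k < (N + K).*2.+2)%N) ip mu I01 f (phi k) * phi k t).
    apply: sqint_sum => // k /andP[Kk _]; apply: sqintZ => //.
    by apply: sqint_phi; exact: leq_trans Kk.
  by apply/funext => t; rewrite /T big_nat.
have shift (F : nat -> R) n :
    \sum_(K.+1 <= k < n) F k = \sum_(i < n - K.+1) F (i + K.+1)%N.
  by rewrite -{1}[K.+1]add0n big_addn big_mkord.
have T2 N : (\int[mu]_(t in I01) (T N t ^+ 2)%:E <= B%:E)%E.
  rewrite -EFin_ip// lee_fin; apply: le_trans (tailB (N + K).*2.+2).
  pose e (i : 'I_((N + K).*2.+2 - K.+1)) : R -> R := phi (i + K.+1)%N.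
  have -> : T N = fun t => \sum_i ip mu I01 f (e i) * e i t.
    by apply/funext => t; rewrite /T shift.
  rewrite ip_sum_orthonormal ?shift//.
  - by move=> i; apply: sqint_phi; lia.
  - move=> i j; rewrite phi_orthonormal; [|lia|lia].
    by rewrite eqn_add2r.
have mT N : measurable_fun I01 (fun t => (T N t ^+ 2)%:E).
  by apply/measurable_EFinP; apply: measurable_funX; case: (sT N).
have T0 N t : I01 t -> (0%:E <= (T N t ^+ 2)%:E)%E.
  by move=> _; rewrite lee_fin sqr_ge0.
apply: le_trans (le_trans (fatou mu (measurable_itv _) mT T0) _).
  rewrite le_eqVlt; apply/orP; left; apply/eqP; apply: eq_integral => t.
  rewrite inE => t01; apply/esym.
  have [l dl] : exists l, is_derive t 1 f l by exists ('D_1 f t); split => //; exact: df.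
  have := fourier_series_cvg t01 dl.
  rewrite -(cvg_shiftn K) => /= cf.
  have cT : T N t @[N --> \oo] -->
      f t - \sum_(1 <= k < K.+1) ip mu I01 f (phi k) * phi k t.
    rewrite (_ : (fun N => T N t) = (fun N =>
      \sum_(1 <= k < (N + K).*2.+2) ip mu I01 f (phi k) * phi k t -
      \sum_(1 <= k < K.+1) ip mu I01 f (phi k) * phi k t)).
      by apply: cvgB => //; exact: cvg_cst.
    apply/funext => N; rewrite (@big_cat_nat _ _ _ K.+1)//=; last by lia.
    by rewrite [RHS]addrAC subrr add0r.
  apply: (cvg_limn_einf_sup _).1; apply: cvg_EFin; first exact: nearW.
  exact: (continuous_cvg _ (@exprn_continuous _ 2 _) cT).
rewrite limn_einf_lim; apply: lime_le; first exact: is_cvg_einfs.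
apply: nearW => n; apply: le_trans (T2 n); apply: ereal_inf_lbound.
by exists n => //=.
Qed.

End Pointwise.

(** Here [alpha >= 2] enters: the function itself, and not only some lower bound on its order, is
    differentiable everywhere. [F] is the version of [f] that is regular up to the endpoints. *)
Lemma Wper_derivative01 (alpha : nat) (L : R) (f : R -> R) :
  (2 <= alpha)%N -> Wper alpha L f ->
  exists F G, [/\ {in I01, F =1 f}, abs_continuous01 F & derivative01 F G].
Proof.
move=> a2 [D [D0 dD acD _ _]]; exists (D 0%N), (D 1%N); split.
- by move=> x; rewrite inE => /D0.
- by apply: (derivatives_abs_continuous _ dD acD); exact: leq_trans a2.
- exact: dD.
Qed.

Lemma sqint_Wper (alpha : nat) (L : R) (f : R -> R) :
  (2 <= alpha)%N -> Wper alpha L f -> sqint mu I01 f.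
Proof.
move=> a2 /(Wper_derivative01 a2)[F [G [Ff acF _]]].
by apply: (@eq_sqint _ _ _ mu I01 _ F) => //; exact: abs_continuous_sqint.
Qed.

Lemma Wper_remainder_le (alpha : nat) (L : R) (f : R -> R) (K : nat) :
  (2 <= alpha)%N -> (0 < K)%N -> Wper alpha L f ->
  (\int[mu]_(t in `]0%R, 1%R[)
    ((f t - \sum_(1 <= k < K.+1) ip mu I01 f (phi k) * phi k t) ^+ 2)%:E
   <= (L ^+ 2 * K%:R ^- (2 * alpha))%:E)%E.
Proof.
move=> a2 K0 Wf; have [F [G [Ff acF dF]]] := Wper_derivative01 a2 Wf.
have ipF k : ip mu I01 F (phi k) = ip mu I01 f (phi k) by exact: eq_ip.
have [C FC] := abs_continuous_bounded acF.
have FC' t : t \in `]0, 1[ -> `|F t| <= C.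
  by rewrite in_itv/= => /andP[/ltW t0 /ltW t1]; rewrite FC ?t0.
have := @fourier_remainder_le _ _ (abs_continuous_measurable acF) FC' K
  (L ^+ 2 * K%:R ^- (2 * alpha)).
rewrite (@eq_integral _ _ _ mu I01 (fun t => ((f t -
  \sum_(1 <= k < K.+1) ip mu I01 f (phi k) * phi k t) ^+ 2)%:E)).
  apply.
  - by move=> t t01; case: (derivative01_is_derive dF t01).
  - move=> N; under eq_bigr do rewrite ipF.
    by apply: fourier_tail_le => //; exact: leq_trans a2.
move=> t t01; rewrite Ff//; congr ((_ - _) ^+ 2)%:E.
by apply: eq_bigr => k _; rewrite ipF.
Qed.

End FourierSeries.

(** * Independence and uniform sampling times *)

Section Probability.
Context {d : measure_display} {T : measurableType d} {R : realType}.

(** Neither function need be measurable: a simple function below [f] is also below [g]. This is what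
    allows the integrated squared error to be bounded as it stands. *)
Lemma ge0_le_integralT (mu : {measure set T -> \bar R}) (f g : T -> \bar R) :
  (forall x, (0 <= f x)%E) -> (forall x, (f x <= g x)%E) ->
  (\int[mu]_x f x <= \int[mu]_x g x)%E.
Proof.
move=> f0 fg; have g0 x : (0 <= g x)%E by exact: le_trans (fg x).
rewrite !ge0_integralTE//; apply: ub_ereal_sup => _ [h hf <-].
by apply: ereal_sup_ubound; exists h => // x; exact: le_trans (fg x).
Qed.

Variable P : probability T R.

Lemma mutually_independent_pair (I : finType) (G : I -> set_system T)
    (i j : I) (A B : set T) : mutually_independent P G -> i != j ->
  G i A -> G j B -> P (A `&` B) = (P A * P B)%E.
Proof.
move=> indG ij GA GB; pose C k := if k == i then A else B.
have := indG [set i; j]%SET C; rewrite big_setU1 ?inE//= big_set1.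
rewrite /C eqxx eq_sym (negbTE ij) => <-.
  congr (P _); apply/seteqP; split => [x [Ax Bx] k /=|x CAB].
    by rewrite !inE => /orP[] /eqP ->; rewrite ?eqxx// eq_sym (negbTE ij).
  split.
    by have := CAB i; rewrite /= !inE eqxx; exact.
  by have := CAB j; rewrite /= !inE eqxx orbT eq_sym (negbTE ij); exact.
by move=> k; rewrite !inE => /orP[] /eqP ->; rewrite ?eqxx// eq_sym (negbTE ij).
Qed.

Definition independent_rv (X Y : T -> R) : Prop :=
  forall A B : set R, measurable A -> measurable B ->
    P (X @^-1` A `&` Y @^-1` B) = (P (X @^-1` A) * P (Y @^-1` B))%E.

Lemma mutually_independent_rv (I : finType) (X : I -> T -> R) (i j : I) :
  mutually_independent P (fun i => sigma_of_rv (X i)) -> i != j ->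
  independent_rv (X i) (X j).
Proof.
move=> indX ij A B mA mB; apply: (mutually_independent_pair indX ij).
- by exists A; rewrite ?setTI.
- by exists B; rewrite ?setTI.
Qed.

Lemma independent_rv_comp (X Y : T -> R) (h k : R -> R) :
  independent_rv X Y -> measurable_fun setT h -> measurable_fun setT k ->
  independent_rv (h \o X) (k \o Y).
Proof.
move=> XY mh mk A B mA mB; apply: (XY (h @^-1` A) (k @^-1` B)).
- by rewrite -[X in measurable X]setTI; exact: mh.
- by rewrite -[X in measurable X]setTI; exact: mk.
Qed.

(** Independence identifies the law of [(X, Y)] with the product of the laws, and Fubini's theorem
    factors the integral of the product. *)
Lemma ip_independent (X Y : T -> R) : sqint P setT X -> sqint P setT Y ->
  independent_rv X Y ->
  ip P setT X Y = (\int[P]_w X w) * (\int[P]_w Y w).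
Proof.
move=> sX sY XY; have [mX _] := sX; have [mY _] := sY.
have PT : (P setT < +oo)%E by rewrite probability_setT ltry.
have iX := sqint_integrable measurableT PT sX.
have iY := sqint_integrable measurableT PT sY.
have iXY := sqint_mul measurableT sX sY.
pose X' : {mfun T >-> R} := mfun_Sub (mem_set mX).
pose Y' : {mfun T >-> R} := mfun_Sub (mem_set mY).
have mZ : measurable_fun setT (fun w => (X w, Y w)) by exact: measurable_fun_pair.
pose Z : {mfun T >-> (R * R)%type} := mfun_Sub (mem_set mZ).
pose pX := distribution P X'. pose pY := distribution P Y'.
pose pZ := distribution P Z.
have E A : measurable A -> (pX \x pY)%E A = pZ A.
  by apply: product_measure_unique => B C mB mC; exact: XY.
pose xy := fun z : R * R => (z.1 * z.2)%:E.
have mxy : measurable_fun setT xy.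
  by apply/measurable_EFinP; apply: measurable_funM;
    [exact: measurable_fst|exact: measurable_snd].
have EI f : (\int[(pX \x pY)%E]_z f z = \int[pZ]_z f z)%E.
  by apply: eq_measure_integral => A mA _; exact: E.
have ixy : (pX \x pY)%E.-integrable setT xy.
  apply/integrableP; split=> //; rewrite EI.
  have : pZ.-integrable setT xy by exact: integrable_pushforward.
  by move=> /integrableP[].
have -> : ip P setT X Y = fine (\int[(pX \x pY)%E]_z xy z)%E.
  by rewrite EI integral_pushforward.
rewrite -integral12_prod_meas1// /fubini_F.
have mE : measurable_fun setT (EFin \o (id : R -> R)) by exact/measurable_EFinP.
have iidX : pX.-integrable setT (EFin \o id) by exact: (integrable_pushforward mX mE).
have iidY : pY.-integrable setT (EFin \o id) by exact: (integrable_pushforward mY mE).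
have EX : (\int[pX]_x x%:E = \int[P]_w (X w)%:E)%E.
  by rewrite (integral_pushforward mX mE).
have EY : (\int[pY]_x x%:E = \int[P]_w (Y w)%:E)%E.
  by rewrite (integral_pushforward mY mE).
rewrite /xy /=.
under eq_integral => x _.
  under eq_integral do rewrite EFinM.
  rewrite integralZl// EY -[(\int[P]_w (Y w)%:E)%E]fineK ?integrable_fin_num// muleC.
  over.
rewrite /= integralZl// EX -[(\int[P]_w (X w)%:E)%E]fineK ?integrable_fin_num//.
by rewrite mulrC.
Qed.

End Probability.

Section UniformTimes.
Context {d : measure_display} {T : measurableType d} {R : realType}.
Variables (P : probability T R) (U : {RV P >-> R}).
Local Notation mu := (@lebesgue_measure R).
Local Notation I01 := (`]0 : R, 1[%classic : set R).
Hypothesis U01 : forall w, U w \in `]0, 1[.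
Hypothesis uU : forall B : set R, measurable B ->
  distribution P U B = uniform_prob (@ltr01 R) B.

(** [h] is measurable only on the open interval; as [U] takes its values there, [h] may be extended
    by 0. *)
Lemma measurable_comp_uniform (h : R -> R) : measurable_fun I01 h ->
  measurable_fun setT (h \o U).
Proof.
move=> mh; rewrite (_ : h \o U = (h \_ I01) \o U); last first.
  by apply/funext => w /=; rewrite patchE mem_set//; exact: U01.
by apply: measurableT_comp => //; exact/(measurable_restrictT _ _).1.
Qed.

Lemma ge0_integral_comp_uniform (h : R -> \bar R) : measurable_fun I01 h ->
  (forall t, I01 t -> (0 <= h t)%E) ->
  (\int[P]_w h (U w) = \int[mu]_(t in I01) h t)%E.
Proof.
move=> mh h0; pose g := h \_ I01.
have mg : measurable_fun setT g by exact/(measurable_restrictT _ _).1.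
have g0 t : (0 <= g t)%E by rewrite /g patchE; case: ifPn => // /set_mem/h0.
have -> : (\int[P]_w h (U w) = \int[P]_w (g \o U) w)%E.
  by apply: eq_integral => w _; rewrite /g /= patchE mem_set//; exact: U01.
have mU0 := measurable_funPT U.
have mU : @measurable_fun _ _ T (measurableTypeR R) setT U.
  by move=> mT A mA; exact: mU0.
pose U' := @mfun_Sub _ _ T (measurableTypeR R) U (mem_set mU).
have -> : (\int[P]_w (g \o U) w = \int[distribution P U']_y g y)%E.
  by rewrite (ge0_integral_pushforward mU).
have -> : (\int[distribution P U']_y g y = \int[uniform_prob (@ltr01 R)]_y g y)%E.
  by apply: eq_measure_integral => A mA _; exact: uU.
rewrite integral_uniform// subr0 invr1 mul1e -integral_mkcondr setIidr//.
by move=> x /=; rewrite !in_itv/= => /andP[/ltW-> /ltW->].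
Qed.

Lemma integrable_comp_uniform (h : R -> R) : mu.-integrable I01 (EFin \o h) ->
  P.-integrable setT (EFin \o (h \o U)).
Proof.
move=> /integrableP[mh ih]; apply/integrableP; split.
  by apply/measurable_EFinP/measurable_comp_uniform/measurable_EFinP.
rewrite (@ge0_integral_comp_uniform (fun t => `|(h t)%:E|%E))//.
exact: measurableT_comp.
Qed.

Lemma Rintegral_comp_uniform (h : R -> R) : mu.-integrable I01 (EFin \o h) ->
  \int[P]_w h (U w) = \int[mu]_(t in I01) h t.
Proof.
move=> ih; have [mh _] := integrableP _ _ _ ih.
rewrite /Rintegral integralE [in RHS]integralE; congr (fine (_ - _)).
- rewrite -(@ge0_integral_comp_uniform (EFin \o h)^\+%E)//; last first.
    exact: measurable_funepos.
  by apply: eq_integral => w _; rewrite !funeposE.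
- rewrite -(@ge0_integral_comp_uniform (EFin \o h)^\-%E)//; last first.
    exact: measurable_funeneg.
  by apply: eq_integral => w _; rewrite !funenegE.
Qed.

Lemma sqint_comp_uniform (h : R -> R) : sqint mu I01 h -> sqint P setT (h \o U).
Proof.
move=> [mh h2]; split; first exact: measurable_comp_uniform.
exact: (@integrable_comp_uniform (fun t => h t ^+ 2)).
Qed.

Lemma ip_comp_uniform (h k : R -> R) : sqint mu I01 h -> sqint mu I01 k ->
  ip P setT (h \o U) (k \o U) = ip mu I01 h k.
Proof.
by move=> sh sk; rewrite /ip -Rintegral_comp_uniform//; exact: sqint_mul.
Qed.

End UniformTimes.

Section AlmostEverywhere.
Context {d : measure_display} {T : measurableType d} {R : realType}.

(** Adding [+oo] on the null set [N] to [g] leaves its integral unchanged and makes the inequality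
    hold everywhere, so that [f] need not be measurable. *)
Lemma ge0_ae_le_integralT (mu : {measure set T -> \bar R}) (f g : T -> \bar R)
    (N : set T) : measurable N -> mu N = 0%E ->
  measurable_fun setT g -> (forall x, (0 <= f x)%E) -> (forall x, (0 <= g x)%E) ->
  (forall x, ~ N x -> (f x <= g x)%E) ->
  (\int[mu]_x f x <= \int[mu]_x g x)%E.
Proof.
move=> mN N0 mg f0 g0 fg.
pose j x : \bar R := (+oo * (\1_N x)%:E)%E.
have mj : measurable_fun setT j.
  by apply: measurable_funeM; apply/measurable_EFinP; exact: measurable_indic.
have j0 x : (0 <= j x)%E by rewrite mule_ge0// lee_fin.
pose h x := (g x + j x)%E.
have -> : (\int[mu]_x g x = \int[mu]_x h x)%E.
  rewrite ge0_integralD// (_ : (\int[mu]_x j x = 0)%E) ?adde0//.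
  rewrite /j ge0_integralZl//; last by apply/measurable_EFinP.
  by rewrite integral_indic// setIT N0 mule0.
apply: ge0_le_integralT => // x; rewrite /h /j indicE.
have [xN|xN] := boolP (x \in N).
  by rewrite mule1 addey ?leey// gt_eqF// (lt_le_trans _ (g0 x)).
by rewrite mule0 adde0 fg// => /mem_set; rewrite (negbTE xN).
Qed.

End AlmostEverywhere.

Section UncorrelatedSums.
Context {d : measure_display} {T : measurableType d} {R : realType}.
Variable P : probability T R.
Local Notation mu := (@lebesgue_measure R).
Local Notation I01 := (`]0 : R, 1[%classic : set R).

Let PT : (P setT < +oo)%E. Proof. by rewrite probability_setT ltry. Qed.

Lemma sqint_probability_cst (c : R) : sqint P setT (cst c).
Proof. exact: (@sqint_bounded _ _ _ _ _ measurableT (cst c) `|c|). Qed.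

Lemma ip_sum_independent (I : finType) (X : I -> T -> R) (c : I -> R) (s : R) :
  (forall i, measurable_fun setT (X i)) ->
  mutually_independent P (fun i => sigma_of_rv (X i)) ->
  (forall i, sqint P setT (X i)) ->
  (forall i, \int[P]_w X i w = 0) ->
  (forall i, ip P setT (X i) (X i) = s) ->
  ip P setT (fun w => \sum_i c i * X i w) (fun w => \sum_i c i * X i w) =
  s * \sum_i c i ^+ 2.
Proof.
move=> mX indX sX X0 Xs; rewrite ip_sum_orthogonal//.
- rewrite mulr_sumr; apply: eq_bigr => i _.
  rewrite ipZl//; last exact: sqintZ.
  by rewrite ipC ipZl// Xs; ring.
- by move=> i; exact: sqintZ.
- move=> i j ij; rewrite ipZl//; last exact: sqintZ.
  rewrite ipC ipZl// ip_independent// ?X0 ?mul0r ?mulr0//.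
  by apply: (mutually_independent_rv indX); rewrite eq_sym.
Qed.

(** The centred terms are uncorrelated by independence, so their second moments add up, and a
    variance is at most the second moment. *)
Lemma variance_uniform_sum_le (I : finType) (U : I -> {RV P >-> R})
    (g : I -> R -> R) :
  (forall i w, U i w \in `]0, 1[) ->
  (forall i (B : set R), measurable B ->
     distribution P (U i) B = uniform_prob (@ltr01 R) B) ->
  mutually_independent P (fun i => sigma_of_rv (U i)) ->
  (forall i, sqint mu I01 (g i)) ->
  let Z w := \sum_i (g i (U i w) - \int[mu]_(t in I01) g i t) in
  sqint P setT Z /\ ip P setT Z Z <= \sum_i ip mu I01 (g i) (g i).
Proof.
move=> U01 uU indU sg Z.
have muI : (mu I01 < +oo)%E by rewrite /= lebesgue_measure_itv/= lte01 ltry.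
have muI1 : fine (mu I01) = 1 by rewrite /= lebesgue_measure_itv/= lte01/= subr0.
pose c i := \int[mu]_(t in I01) g i t.
pose G i t := g i t - c i.
have scst i : sqint mu I01 (cst (c i)).
  exact: (@sqint_bounded _ _ _ _ _ _ (cst (c i)) `|c i|).
have sG i : sqint mu I01 (G i).
  by apply: (@sqintB _ _ _ mu I01 _ (g i) (cst (c i))).
have ig i : mu.-integrable I01 (EFin \o g i) by exact: sqint_integrable.
have icst i : mu.-integrable I01 (EFin \o cst (c i)) by exact: sqint_integrable.
have iG i : mu.-integrable I01 (EFin \o G i) by exact: sqint_integrable.
have cst_c (r : R) : \int[mu]_(t in I01) r = r.
  by rewrite Rintegral_cst//= muI1 mulr1.
have G0 i : \int[mu]_(t in I01) G i t = 0.
  have -> : \int[mu]_(t in I01) G i t = c i - \int[mu]_(t in I01) (cst (c i)) t.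
    by rewrite -RintegralB//; exact: ig.
  by rewrite /= cst_c subrr.
have sGU i : sqint P setT (G i \o U i) by exact: (sqint_comp_uniform (U01 i) (uU i) (sG i)).
have ZE : Z = fun w => \sum_i (G i \o U i) w by [].
split; first by rewrite ZE; exact: sqint_sum.
rewrite ZE ip_sum_orthogonal//; last first.
  move=> i j ij.
  (* Composition preserves independence for functions measurable on the whole line, hence the
     extension by 0. *)
  pose G' k := G k \_ I01.
  have mG' k : measurable_fun setT (G' k).
    by apply/(measurable_restrictT _ _).1 => //; case: (sG k).
  have GG' k : G k \o U k = G' k \o U k.
    by apply/funext => w /=; rewrite /G' patchE mem_set//; exact: U01.
  rewrite ip_independent//.
    by rewrite (Rintegral_comp_uniform (U01 i) (uU i) (iG i)) G0 mul0r.
  rewrite !GG'; apply: independent_rv_comp => //.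
  exact: (mutually_independent_rv indU).
apply: ler_sum => i _; rewrite (ip_comp_uniform (U01 i) (uU i) (sG i) (sG i)).
rewrite (@ip_subD _ _ _ mu I01 _ (g i) (cst (c i)))//.
have -> : ip mu I01 (g i) (cst (c i)) = c i ^+ 2.
  by rewrite ipC /ip RintegralZl// expr2.
have -> : ip mu I01 (cst (c i)) (cst (c i)) = c i ^+ 2.
  by rewrite /ip /= cst_c expr2.
have := sqr_ge0 (c i); lra.
Qed.

End UncorrelatedSums.

(** * Square integrable processes *)

Section SquareIntegrableProcesses.
Context {d : measure_display} {N : measurableType d} {R : realType}.
Variable P : probability N R.
Local Notation mu := (@lebesgue_measure R).
Local Notation I01 := (`]0 : R, 1[%classic : set R).

(** Square integrability is required of every path and the paths vanish off the interval, so that no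
    exceptional set or partial domain appears in the Fubini arguments below. *)
Definition sqint_process (z : N -> R -> R) (v : R) : Prop :=
  [/\ measurable_fun setT (fun wt : N * measurableTypeR R => z wt.1 wt.2),
      forall w t, ~ I01 t -> z w t = 0,
      forall w, sqint mu I01 (z w)
    & (\int[P]_w \int[mu]_(t in I01) (z w t ^+ 2)%:E <= v%:E)%E].

Let PT : (P setT < +oo)%E. Proof. by rewrite probability_setT ltry. Qed.
Let muI : (mu I01 < +oo)%E.
Proof. by rewrite /= lebesgue_measure_itv/= lte01 ltry. Qed.
Let mI : measurable (I01 : set (measurableTypeR R)).
Proof. exact: measurable_itv. Qed.

Section OneProcess.
Variables (z : N -> R -> R) (v : R).
Hypothesis hz : sqint_process z v.

Let mz : measurable_fun setT (fun wt : N * measurableTypeR R => z wt.1 wt.2).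
Proof. by case: hz. Qed.
Let z0 w t : ~ I01 t -> z w t = 0. Proof. by case: hz => _ + _ _; exact. Qed.
Let sz w : sqint mu I01 (z w). Proof. by case: hz. Qed.
Let vz : (\int[P]_w \int[mu]_(t in I01) (z w t ^+ 2)%:E <= v%:E)%E.
Proof. by case: hz. Qed.

Let integral_mkcondT (f : R -> \bar R) : (forall t, ~ I01 t -> f t = 0%E) ->
  (\int[mu]_t f t = \int[mu]_(t in I01) f t)%E.
Proof.
move=> f0; rewrite [RHS]integral_mkcond; apply: eq_integral => t _.
rewrite patchE; case: ifPn => // /negP tI; apply: f0 => It; apply: tI.
exact: mem_set.
Qed.

Let mz2 : measurable_fun setT
  (fun wt : N * measurableTypeR R => (z wt.1 wt.2 ^+ 2)%:E).
Proof. by apply/measurable_EFinP; exact: measurable_funX. Qed.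

Let energyE w : (\int[mu]_t (z w t ^+ 2)%:E = (ip mu I01 (z w) (z w))%:E)%E.
Proof.
rewrite EFin_ip//; apply: integral_mkcondT => t /z0 ->.
by rewrite expr0n.
Qed.

Lemma measurable_process_energy :
  measurable_fun setT (fun w => ip mu I01 (z w) (z w)).
Proof.
apply/measurable_EFinP.
rewrite (_ : EFin \o _ = fubini_F mu (fun wt : N * measurableTypeR R => (z wt.1 wt.2 ^+ 2)%:E)).
  by apply: measurable_fun_fubini_tonelli_F => // wt; rewrite lee_fin sqr_ge0.
by apply/funext => w; rewrite /fubini_F /= energyE.
Qed.

Lemma process_energy_le : (\int[P]_w (ip mu I01 (z w) (z w))%:E <= v%:E)%E.
Proof. by under eq_integral do rewrite EFin_ip//. Qed.

(** By Tonelli the second moment at time [t] has a finite integral over [t], hence it is finite for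
    almost every [t]; no more can be said at a given time. *)
Lemma process_section_sqint :
  {ae mu, forall t, sqint P setT (z ^~ t)}.
Proof.
pose g := fubini_G P (fun wt : N * measurableTypeR R => (z wt.1 wt.2 ^+ 2)%:E).
have z20 wt : (0 <= (z wt.1 wt.2 ^+ 2)%:E)%E by rewrite lee_fin sqr_ge0.
have mg : measurable_fun setT g by exact: measurable_fun_fubini_tonelli_G.
have g0 t : (0 <= g t)%E by apply: integral_ge0 => w _; exact: (z20 (w, t)).
have ig : mu.-integrable setT g.
  apply/integrableP; split=> //.
  under eq_integral do rewrite gee0_abs//.
  rewrite -fubini_tonelli2// fubini_tonelli1//.
  rewrite /fubini_F /=; under eq_integral do rewrite energyE.
  by apply: le_lt_trans process_energy_le _; rewrite ltry.
have := integrable_ae measurableT ig.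
apply: filterS => t gt.
apply/sqintP => //; split.
  exact: (measurable_fun_pair1 t mz).
by rewrite -ge0_fin_numE ?gt// integral_ge0// => w _; exact: (z20 (w, t)).
Qed.

Section Coefficient.
Variable phi0 : R -> R.
Hypothesis mphi0 : measurable_fun setT phi0.
Hypothesis phi02 : forall t, `|phi0 t| <= 2.

Let sphi0 : sqint mu I01 phi0.
Proof. by apply: (@sqint_bounded _ _ _ _ _ _ _ 2) => //; exact: measurable_funTS. Qed.

(** Integrated over time it gives [Y] times the coefficient of the path; integrated over the noise,
    [phi0 t] times the mean of [Y * z t]. It is integrable because [|phi0| <= 2] bounds it by
    [Y^2 + z^2]. *)
Let kern (Y : N -> R) : N * measurableTypeR R -> \bar R :=
  fun wt => (Y wt.1 * (z wt.1 wt.2 * phi0 wt.2))%:E.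

Let kernF Y w : fubini_F mu (kern Y) w = (Y w * ip mu I01 (z w) phi0)%:E.
Proof.
rewrite /fubini_F /kern /= integral_mkcondT; last first.
  by move=> t /z0 ->; rewrite mul0r mulr0.
have izp : mu.-integrable I01 (EFin \o (fun t => z w t * phi0 t)) by exact: sqint_mul.
under eq_integral do rewrite EFinM.
rewrite integralZl// [RHS]EFinM /ip /Rintegral fineK//.
exact: integrable_fin_num.
Qed.

Let kern_integrable Y : sqint P setT Y -> (P \x mu)%E.-integrable setT (kern Y).
Proof.
move=> sY; have [mY Y2] : measurable_fun setT Y /\ (\int[P]_w (Y w ^+ 2)%:E < +oo)%E.
  exact/sqintP.
have mk : measurable_fun setT (kern Y).
  apply/measurable_EFinP; apply: measurable_funM.
    by apply: measurableT_comp => //; exact: measurable_fst.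
  by apply: measurable_funM => //; apply: measurableT_comp => //; exact: measurable_snd.
apply/integrable12ltyP => //.
have le1 w : (\int[mu]_t `|kern Y (w, t)| <=
    (Y w ^+ 2)%:E + (ip mu I01 (z w) (z w))%:E)%E.
  rewrite integral_mkcondT; last by move=> t /z0; rewrite /kern /= => ->; rewrite mul0r mulr0 normr0.
  have [mzw _] := sz w.
  apply: (@le_trans _ _ (\int[mu]_(t in I01) ((Y w ^+ 2)%:E + (z w t ^+ 2)%:E))%E).
    apply: ge0_le_integral => //.
    - by apply: measurableT_comp => //; apply: measurable_funTS; exact: measurable_fun_pair2.
    - apply: emeasurable_funD; first exact: measurable_cst.
      by apply/measurable_EFinP; exact: measurable_funX.
    - move=> t _; rewrite /kern /= -EFinD lee_fin !normrM.
      have h1 : 2 * (`|Y w| * `|z w t|) <= Y w ^+ 2 + z w t ^+ 2.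
        rewrite -(real_normK (num_real (Y w))) -(real_normK (num_real (z w t))).
        by have := sqr_ge0 (`|Y w| - `|z w t|); nra.
      by apply: le_trans h1; rewrite mulrA mulrC ler_wpM2r.
  rewrite ge0_integralD//.
  - by rewrite integral_cst//= lebesgue_measure_itv/= lte01 sube0 mule1 EFin_ip.
  - by move=> t _; rewrite lee_fin sqr_ge0.
  - by move=> t _; rewrite lee_fin sqr_ge0.
  - by apply/measurable_EFinP; exact: measurable_funX.
apply: (@le_lt_trans _ _ (\int[P]_w ((Y w ^+ 2)%:E + (ip mu I01 (z w) (z w))%:E))%E).
  by apply: ge0_le_integralT => // w; exact: integral_ge0.
rewrite ge0_integralD//.
- by rewrite lte_add_pinfty//; apply: le_lt_trans process_energy_le _; rewrite ltry.
- by move=> w _; rewrite lee_fin sqr_ge0.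
- by apply/measurable_EFinP; exact: measurable_funX.
- by move=> w _; rewrite lee_fin ip_ge0.
- by apply/measurable_EFinP; exact: measurable_process_energy.
Qed.

Lemma measurable_process_coef : measurable_fun setT (fun w => ip mu I01 (z w) phi0).
Proof.
apply/measurable_EFinP.
(* With [Y = 1] the inner integral is the coefficient itself. *)
rewrite (_ : EFin \o _ = fubini_F mu (kern (cst 1))).
  by apply: measurable_fubini_F; apply: kern_integrable; exact: sqint_probability_cst.
by apply/funext => w; rewrite kernF mul1r.
Qed.

(** Exchange the integrals of [kern Y]: the inner one over the noise vanishes for almost every [t].
    The condition on the sections matches the fact that only almost all of them are square
    integrable. *)
Lemma ip_process_coef0 (Y : N -> R) : sqint P setT Y ->
  (forall t, I01 t -> sqint P setT (z ^~ t) -> ip P setT Y (z ^~ t) = 0) ->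
  ip P setT Y (fun w => ip mu I01 (z w) phi0) = 0.
Proof.
move=> sY Yz; have ik := kern_integrable sY.
have -> : ip P setT Y (fun w => ip mu I01 (z w) phi0) =
   fine (\int[P]_w fubini_F mu (kern Y) w)%E.
  by congr fine; apply: eq_integral => w _; rewrite kernF.
rewrite integral12_prod_meas1// -integral21_prod_meas1//.
rewrite (ae_eq_integral (cst 0%E))//.
- by rewrite integral0.
- exact: (measurable_fubini_G ik).
have := process_section_sqint.
apply: filterS.
  exact: (ae_filter_ringOfSetsType mu).
move=> t st _.
rewrite /fubini_G /kern /=.
have [t01|t01] := pselect (I01 t); last first.
  by under eq_integral do rewrite z0// mul0r mulr0; rewrite integral0.
have iYz := sqint_mul measurableT sY st.
under eq_integral do rewrite mulrA EFinM.
rewrite integralZr//= -[X in (X * _)%E]fineK ?integrable_fin_num//.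
by rewrite -[fine _]/(ip P setT Y (z ^~ t)) Yz// mul0e.
Qed.

End Coefficient.

Let coef k w := ip mu I01 (z w) (phi k).

Lemma process_coef_sum_sqr_le K w :
  \sum_(k < K) coef k.+1 w ^+ 2 <= ip mu I01 (z w) (z w).
Proof.
pose e (i : 'I_K) : R -> R := phi i.+1.
apply: (@bessel _ _ _ mu I01 _ _ e) => //.
- by move=> i; exact: sqint_phi.
- by move=> i j; rewrite phi_orthonormal.
Qed.

Lemma sqint_process_coef k : (0 < k)%N -> sqint P setT (coef k).
Proof.
case: k => // k _; have mc : measurable_fun setT (coef k.+1).
  apply: measurable_process_coef; first exact: measurable_phi.
  by move=> t; exact: phi_norm_le.
apply/sqintP => //; split=> //.
apply: (@le_lt_trans _ _ v%:E); last by rewrite ltry.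
apply: le_trans process_energy_le; apply: ge0_le_integralT => w.
  by rewrite lee_fin sqr_ge0.
rewrite lee_fin; apply: le_trans (process_coef_sum_sqr_le k.+1 w).
rewrite big_ord_recr/= lerDr.
by apply: sumr_ge0 => i _; exact: sqr_ge0.
Qed.

Lemma process_coef_sum_le K :
  \sum_(k < K) ip P setT (coef k.+1) (coef k.+1) <= v.
Proof.
have ic (k : 'I_K) : P.-integrable setT (EFin \o (fun w => coef k.+1 w ^+ 2)).
  by case: (@sqint_process_coef k.+1).
under eq_bigr do rewrite ipE.
rewrite -Rintegral_sum// -lee_fin /Rintegral fineK; last first.
  apply: integrable_fin_num => //; exact: integrable_sum_EFin.
apply: le_trans process_energy_le; apply: ge0_le_integralT => w.
  by rewrite lee_fin sumr_ge0// => k _; exact: sqr_ge0.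
by rewrite lee_fin process_coef_sum_sqr_le.
Qed.

End OneProcess.

(** The previous orthogonality argument, used once for each of the two processes. *)
Lemma process_coef_uncorrelated (z z' : N -> R -> R) (v v' : R) (k : nat) :
  sqint_process z v -> sqint_process z' v' -> (0 < k)%N ->
  (forall s t, I01 s -> I01 t -> sqint P setT (z ^~ s) -> sqint P setT (z' ^~ t) ->
     ip P setT (z ^~ s) (z' ^~ t) = 0) ->
  ip P setT (fun w => ip mu I01 (z w) (phi k)) (fun w => ip mu I01 (z' w) (phi k))
   = 0.
Proof.
move=> hz hz' k0 zz'.
have mphi : measurable_fun setT (phi k : R -> R) by exact: measurable_phi.
have bphi (t : R) : `|phi k t| <= 2 by exact: phi_norm_le.
apply: (ip_process_coef0 hz' mphi bphi); first exact: sqint_process_coef hz _ k0.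
move=> t It st; rewrite ipC; apply: (ip_process_coef0 hz mphi bphi) => // s Is ss.
by rewrite ipC zz'.
Qed.

End SquareIntegrableProcesses.

(** * The risk of the estimator *)

Section ModelBound.
Context {R : realType} {n : nat}.
Variable S : sample R n.
Local Notation mu := (@lebesgue_measure R).
Local Notation I01 := (`]0 : R, 1[%classic : set R).
Local Notation PT := (times_prob S).
Local Notation PN := (noise_prob S).
Local Notation m i := (nobs S i).
Local Notation f i := (xbeta S i).

Variables (z : 'I_n -> noise_space S -> R -> R) (v F s2 : R).
Hypothesis m_gt0 : forall i, (0 < m i)%N.
Hypothesis timesS : times_iid_uniform S.
Hypothesis hz : forall i, sqint_process PN (z i) v.
Hypothesis sf : forall i, sqint mu I01 (f i).
Hypothesis fF : forall i, ip mu I01 (f i) (f i) <= F.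
Hypothesis z_uncorr : forall i i', i != i' -> forall s t, I01 s -> I01 t ->
  sqint PN setT (z i ^~ s) -> sqint PN setT (z i' ^~ t) ->
  ip PN setT (z i ^~ s) (z i' ^~ t) = 0.
Hypothesis indep_eps : mutually_independent PN
  (fun ij : {i : 'I_n & 'I_(m i)} => sigma_of_rv (eps S (tag ij) (tagged ij))).
Hypothesis eps_sq : forall i j, sqint PN setT (eps S i j).
Hypothesis eps_mean : forall i j, \int[PN]_w eps S i j w = 0.
Hypothesis eps_var : forall i j, ip PN setT (eps S i j) (eps S i j) = s2.

Let muI : (mu I01 < +oo)%E.
Proof. by rewrite /= lebesgue_measure_itv/= lte01 ltry. Qed.

Let m_neq0 i : (m i)%:R != 0 :> R. Proof. by rewrite pnatr_eq0 -lt0n m_gt0. Qed.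

Let U01 i j u : time S i j u \in `]0, 1[. Proof. by case: timesS. Qed.

Let sz i w : sqint mu I01 (z i w). Proof. by case: (hz i). Qed.

Definition signal i w t : R := f i t + z i w t.

Definition effect_coef k i w : R := ip mu I01 (z i w) (phi k).

Let sq i w : sqint mu I01 (signal i w). Proof. exact: sqintD. Qed.

(** The error of the estimated coefficient splits into the sampling error of
    the signal, the coefficient of the random effects, and the error term. *)
Definition sampling_term (h : 'I_n -> R) k u w : R :=
  \sum_i h i * ((m i)%:R^-1 * \sum_(j < m i)
    signal i w (time S i j u) * phi k (time S i j u)
    - (ip mu I01 (f i) (phi k) + effect_coef k i w)).

Definition effect_term (h : 'I_n -> R) k w : R := \sum_i h i * effect_coef k i w.

Definition error_term (h : 'I_n -> R) k u w : R :=
  \sum_i h i * ((m i)%:R^-1 * \sum_(j < m i) eps S i j w * phi k (time S i j u)).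

(** All observations are indexed by one finite type, the one over which independence is stated. *)
Lemma sum_obs (G : forall i, 'I_(m i) -> R) :
  \sum_i \sum_(j < m i) G i j =
  \sum_(ij : {i : 'I_n & 'I_(m i)}) G (tag ij) (tagged ij).
Proof. by rewrite (@sig_big_dep _ _ _ _ _ xpredT (fun _ => xpredT)). Qed.

Lemma ip_mul_phi_le k (q : R -> R) : (0 < k)%N -> sqint mu I01 q ->
  sqint mu I01 (fun t => q t * phi k t) /\
  ip mu I01 (fun t => q t * phi k t) (fun t => q t * phi k t) <= 2 * ip mu I01 q q.
Proof.
move=> k0 sqq; have [mq q2] := sqq.
have mqp : measurable_fun I01 (fun t => q t * phi k t).
  by apply: measurable_funM => //; apply: measurable_funTS; exact: measurable_phi.
have le2 t : (q t * phi k t) ^+ 2 <= 2 * q t ^+ 2.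
  by rewrite exprMn mulrC ler_wpM2r ?sqr_ge0// phi_sqr_le.
have s1 : sqint mu I01 (fun t => q t * phi k t).
  apply: (@sqint_le _ _ _ mu I01 _ _ (fun t => 2 * q t)) => //; last exact: sqintZ.
  move=> t _; rewrite !normrM mulrC ler_wpM2r// (ger0_norm (_ : 0 <= 2))//.
  exact: phi_norm_le.
split=> //; rewrite !ipE -RintegralZl//.
apply: le_Rintegral => //; first by case: s1.
have := integrableZl _ 2 q2.
by apply.
Qed.

(** For fixed paths this is a centred sum of independent terms over all observations; individual [i]
    contributes [m_i] terms of size [1 / m_i^2]. The 4 is 2 from [phi_k^2 <= 2] times 2 from
    splitting the signal. *)
Lemma sampling_term_sqr_le h k w : (0 < k)%N ->
  sqint PT setT (sampling_term h k ^~ w) /\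
  ip PT setT (sampling_term h k ^~ w) (sampling_term h k ^~ w) <=
  \sum_i h i ^+ 2 * (m i)%:R^-1 * (4 * F + 4 * ip mu I01 (z i w) (z i w)).
Proof.
move=> k0; case: timesS => _ uU indU.
pose J := {i : 'I_n & 'I_(m i)}.
pose c (i : 'I_n) : R := h i * (m i)%:R^-1.
pose g (ij : J) t := c (tag ij) * (signal (tag ij) w t * phi k t).
have sg ij : sqint mu I01 (g ij).
  by apply: sqintZ => //; exact: (ip_mul_phi_le k0 (sq _ w)).1.
have [sZ ZZ] := @variance_uniform_sum_le _ _ _ PT J
  (fun ij => time S (tag ij) (tagged ij)) g (fun ij w => U01 _ w) (fun ij => uU _ _)
  indU sg.
set Z := (fun w => _) in sZ ZZ.
have -> : sampling_term h k ^~ w = Z.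
  apply/funext => u.
  rewrite /Z -(@sum_obs (fun i j => c i * (signal i w (time S i j u) *
    phi k (time S i j u)) - \int[mu]_(t in I01) (c i * (signal i w t * phi k t)))).
  apply: eq_bigr => i _; rewrite big_split/= -mulr_sumr sumrN sumr_const card_ord.
  rewrite RintegralZl//; last exact: sqint_mul _ _ (sq _ w) (sqint_phi k0).
  rewrite -[\int[mu]_(x in I01) _]/(ip mu I01 (signal i w) (phi k)).
  rewrite ipDl//; last exact: sqint_phi.
  rewrite /c mulrBr mulrA; congr (_ - _).
  by rewrite -[RHS]mulr_natr mulrAC divfK ?m_neq0.
split=> //; apply: le_trans ZZ _.
rewrite -(@sum_obs (fun i j => ip mu I01 (fun t => c i * (signal i w t * phi k t))
  (fun t => c i * (signal i w t * phi k t)))).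
apply: ler_sum => i _; rewrite sumr_const card_ord.
have [s1 le1] := ip_mul_phi_le k0 (sq i w).
rewrite ipZl//; last exact: sqintZ.
rewrite ipC ipZl//.
have le2 : ip mu I01 (signal i w) (signal i w) <= 2 * F + 2 * ip mu I01 (z i w) (z i w).
  by apply: le_trans (ip_add_le _ (sf i) (sz i w)) _ => //; rewrite lerD2r ler_wpM2l.
rewrite -[leLHS]mulr_natr /c.
set Q := ip _ _ (fun t => _) (fun t => _) in le1 *.
have -> : h i / (m i)%:R * (h i / (m i)%:R * Q) * (m i)%:R =
    h i ^+ 2 * (m i)%:R^-1 * Q.
  by field; exact: m_neq0.
have h0 : 0 <= h i ^+ 2 / (m i)%:R by rewrite divr_ge0 ?sqr_ge0.
rewrite ler_wpM2l//.
lra.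
Qed.

Lemma effect_term_sqr_le h K :
  \sum_(k < K) ip PN setT (effect_term h k.+1) (effect_term h k.+1) <=
  v * \sum_i h i ^+ 2.
Proof.
have sc i (k : 'I_K) : sqint PN setT (effect_coef k.+1 i).
  exact: sqint_process_coef (hz i) _ _.
have E (k : 'I_K) : ip PN setT (effect_term h k.+1) (effect_term h k.+1) =
    \sum_i h i ^+ 2 * ip PN setT (effect_coef k.+1 i) (effect_coef k.+1 i).
  rewrite /effect_term ip_sum_orthogonal//.
  - apply: eq_bigr => i _; rewrite ipZl//; last exact: sqintZ.
    by rewrite ipC ipZl// mulrA expr2.
  - by move=> i; exact: sqintZ.
  - move=> i i' ii'; rewrite ipZl//; last exact: sqintZ.
    rewrite ipC ipZl// (process_coef_uncorrelated (hz i') (hz i))// ?mulr0//.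
    by apply: z_uncorr; rewrite eq_sym.
under eq_bigr do rewrite E.
rewrite exchange_big/= mulr_sumr; apply: ler_sum => i _.
rewrite -mulr_sumr mulrC ler_wpM2r ?sqr_ge0//.
exact: (process_coef_sum_le (hz i)).
Qed.

Lemma error_term_sqr_le h k u : (0 < k)%N ->
  sqint PN setT (error_term h k u) /\
  ip PN setT (error_term h k u) (error_term h k u) <=
  \sum_i h i ^+ 2 * (m i)%:R^-1 * (2 * s2).
Proof.
move=> k0; pose J := {i : 'I_n & 'I_(m i)}.
pose c (ij : J) : R := h (tag ij) * (m (tag ij))%:R^-1 *
  phi k (time S (tag ij) (tagged ij) u).
pose X (ij : J) : noise_space S -> R := eps S (tag ij) (tagged ij).
have E : error_term h k u = fun w => \sum_ij c ij * X ij w.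
  apply/funext => w; rewrite /error_term /c /X.
  rewrite -(@sum_obs (fun i j => h i * (m i)%:R^-1 * phi k (time S i j u) * eps S i j w)).
  apply: eq_bigr => i _; rewrite mulrA mulr_sumr; apply: eq_bigr => j _.
  by rewrite -[RHS]mulrA [phi _ _ * _]mulrC.
have mX ij : measurable_fun setT (X ij) by exact: measurable_funPT.
rewrite E; split.
  by apply: sqint_sum => // ij _; apply: sqintZ => //; exact: eps_sq.
rewrite (@ip_sum_independent _ _ _ _ _ X c s2)//.
- rewrite /c -(@sum_obs (fun i j => (h i * (m i)%:R^-1 * phi k (time S i j u)) ^+ 2)).
  rewrite mulr_sumr; apply: ler_sum => i _.
  (* Read off the first error of individual [i], which exists as [m_i > 0]. *)
  have s20 : 0 <= s2.
    by rewrite -(eps_var (Ordinal (m_gt0 i))) ip_ge0.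
  rewrite [leRHS](_ : _ = s2 * \sum_(j < m i) (h i ^+ 2 * (m i)%:R^-1 ^+ 2 * 2)).
    rewrite ler_wpM2l//; apply: ler_sum => j _.
    rewrite !exprMn; apply: ler_wpM2l; last exact: phi_sqr_le.
    by rewrite mulr_ge0 ?sqr_ge0.
  rewrite sumr_const card_ord -[in RHS]mulr_natr; field.
  exact: m_neq0.
- by move=> ij; exact: eps_sq.
- by move=> ij; exact: eps_mean.
- by move=> ij; exact: eps_var.
Qed.

Lemma measurable_sampling_term h k : (0 < k)%N ->
  measurable_fun setT (fun uw : times_space S * noise_space S =>
    sampling_term h k uw.1 uw.2).
Proof.
move=> k0; apply: measurable_sum => i; apply: measurable_funM => //.
have mt j : measurable_fun setT (time S i j) by exact: measurable_funPT.
apply: measurable_funB; last first.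
  apply: measurable_funD => //.
  apply: (@measurableT_comp _ _ _ _ _ _ (effect_coef k i)); last exact: measurable_snd.
  by have [] := sqint_process_coef (hz i) k0.
apply: measurable_funM => //; apply: measurable_sum => j.
apply: measurable_funM; last first.
  apply: (@measurableT_comp _ _ _ _ _ _ (phi k \o time S i j)); last exact: measurable_fst.
  by apply: measurableT_comp => //; exact: measurable_phi.
apply: measurable_funD.
  apply: (@measurableT_comp _ _ _ _ _ _ (f i \o time S i j)); last exact: measurable_fst.
  by have [mf _] := sf i; exact: (measurable_comp_uniform (U01 j) mf).
have [mz _ _ _] := hz i.
pose G (uw : times_space S * noise_space S) : noise_space S * measurableTypeR R :=
  (uw.2, time S i j uw.1).
have mG : measurable_fun setT G.
  apply: measurable_fun_pair; first exact: measurable_snd.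
  have mt' : @measurable_fun _ _ _ (measurableTypeR R) setT (time S i j).
    by move=> mT A mA; exact: mt.
  by apply: (measurableT_comp mt'); exact: measurable_fst.
exact: (measurableT_comp mz mG).
Qed.

End ModelBound.

Lemma integral_sum_sqr {d : measure_display} {T : measurableType d} {R : realType}
    (mu : {measure set T -> \bar R}) (I : finType) (c : R) (X : I -> T -> R) :
  (forall i, sqint mu setT (X i)) ->
  (\int[mu]_x (c * \sum_i X i x ^+ 2)%:E = (c * \sum_i ip mu setT (X i) (X i))%:E)%E.
Proof.
move=> sX; have i2 i : mu.-integrable setT (EFin \o (fun x => X i x ^+ 2)).
  by case: (sX i).
have iS := @integrable_sum_EFin _ _ _ mu _ measurableT I (index_enum I) xpredT
  (fun i x => X i x ^+ 2) (fun i _ => i2 i).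
under eq_integral do rewrite EFinM.
rewrite integralZl// EFinM; congr (_ * _)%E.
rewrite (eq_bigr (fun i => \int[mu]_x X i x ^+ 2)); last by move=> i _; rewrite ipE.
rewrite -Rintegral_sum// fineK//.
exact: integrable_fin_num.
Qed.

(** * Summation over coordinates and frequencies: the upper bound on the risk *)

Section RiskBound.
Context {R : realType} {n : nat}.
Variable S : sample R n.
Local Notation mu := (@lebesgue_measure R).
Local Notation I01 := (`]0 : R, 1[%classic : set R).
Local Notation PT := (times_prob S).
Local Notation PN := (noise_prob S).
Local Notation m i := (nobs S i).
Local Notation f i := (xbeta S i).
Local Notation K := (trunc S).
Local Notation H := (gram_inv S *m (design S)^T).

Variables (z : 'I_n -> noise_space S -> R -> R) (v F s2 B : R).
Hypothesis gram_unit : (design S)^T *m design S \in unitmx.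
Hypothesis m_gt0 : forall i, (0 < m i)%N.
Hypothesis timesS : times_iid_uniform S.
Hypothesis hz : forall i, sqint_process PN (z i) v.
Hypothesis sf : forall i, sqint mu I01 (f i).
Hypothesis fF : forall i, ip mu I01 (f i) (f i) <= F.
Hypothesis z_uncorr : forall i i', i != i' -> forall s t, I01 s -> I01 t ->
  sqint PN setT (z i ^~ s) -> sqint PN setT (z i' ^~ t) ->
  ip PN setT (z i ^~ s) (z i' ^~ t) = 0.
Hypothesis indep_eps : mutually_independent PN
  (fun ij : {i : 'I_n & 'I_(m i)} => sigma_of_rv (eps S (tag ij) (tagged ij))).
Hypothesis eps_sq : forall i j, sqint PN setT (eps S i j).
Hypothesis eps_mean : forall i j, \int[PN]_w eps S i j w = 0.
Hypothesis eps_var : forall i j, ip PN setT (eps S i j) (eps S i j) = s2.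
Hypothesis sb : forall l, sqint mu I01 (betac S l).
Hypothesis tailB : forall l, (\int[mu]_(t in I01)
  ((betac S l t - \sum_(1 <= k < K.+1) ip mu I01 (betac S l) (phi k) * phi k t) ^+ 2)%:E
  <= B%:E)%E.
Variable Nb : set (noise_space S).
Hypothesis mNb : measurable Nb.
Hypothesis Nb0 : PN Nb = 0%E.
Hypothesis zE : forall i w t, ~ Nb w -> I01 t -> xi S i w t = z i w t.

Let U01 i j u : time S i j u \in `]0, 1[. Proof. by case: timesS. Qed.

Let HX : H *m design S = 1%:M.
Proof. by rewrite -mulmxA mulVmx. Qed.

Definition coef_error l k u w : R :=
  sampling_term z (H l) k u w + effect_term z (H l) k w + error_term (H l) k u w.

Lemma betacE l t : betac S l t = \sum_i H l i * f i t.
Proof.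
have -> : betac S l t = (H *m (design S *m beta S t)) l ord0.
  by rewrite mulmxA HX mul1mx.
by rewrite mxE.
Qed.

Lemma hat_beth_error l k u w : ~ Nb w -> (1 <= k <= K)%N ->
  hat_beth u w k l ord0 = ip mu I01 (betac S l) (phi k) + coef_error l k u w.
Proof.
move=> bw kK; have k0 : (0 < k)%N by case/andP: kK.
rewrite /hat_beth kK mxE.
have -> : ip mu I01 (betac S l) (phi k) = \sum_i H l i * ip mu I01 (f i) (phi k).
  rewrite (_ : betac S l = fun t => \sum_i H l i * f i t); last first.
    by apply/funext => t; rewrite betacE.
  rewrite ip_suml//; last exact: sqint_phi.
    by apply: eq_bigr => i _; rewrite ipZl//; exact: sqint_phi.
  by move=> i _; exact: sqintZ.
rewrite /coef_error /sampling_term /effect_term /error_term -!big_split/=.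
apply: eq_bigr => i _; rewrite [Omegak _ _ _ _ _]mxE -!mulrDr; congr (_ * _).
rewrite (_ : \sum_(j < m i) _ = \sum_(j < m i) signal z i w (time S i j u) * phi k (time S i j u)
   + \sum_(j < m i) eps S i j w * phi k (time S i j u)); first by ring.
rewrite -big_split/=; apply: eq_bigr => j _.
rewrite /obs /signal zE//; last exact: U01.
by ring.
Qed.

Lemma sum_phiE (c : nat -> R) t :
  \sum_(1 <= k < K.+1) c k * phi k t = \sum_(k < K) c k.+1 * phi k.+1 t.
Proof. by rewrite big_add1 big_mkord. Qed.

(** [a] is the stochastic error within the span of the first [K] basis functions, and [r] is the
    truncation error up to sign. *)
Lemma coordinate_error_le l u w : ~ Nb w ->
  sqint mu I01 (fun t => hat_beta u w t l ord0 - betac S l t) /\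
  ip mu I01 (fun t => hat_beta u w t l ord0 - betac S l t)
    (fun t => hat_beta u w t l ord0 - betac S l t)
  <= 2 * (\sum_(k < K) coef_error l k.+1 u w ^+ 2) + 2 * B.
Proof.
move=> bw.
pose a t := \sum_(k < K) coef_error l k.+1 u w * phi k.+1 t.
pose r t := \sum_(k < K) ip mu I01 (betac S l) (phi k.+1) * phi k.+1 t - betac S l t.
have sphi (k : 'I_K) : sqint mu I01 (phi k.+1) by exact: sqint_phi.
have sa : sqint mu I01 a by apply: sqint_sum => // k _; exact: sqintZ.
have sr : sqint mu I01 r.
  by apply: sqintB => //; apply: sqint_sum => // k _; exact: sqintZ.
have -> : (fun t => hat_beta u w t l ord0 - betac S l t) = (fun t => a t + r t).
  apply/funext => t; rewrite /a /r addrA -big_split/= /hat_beta.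
  rewrite summxE big_add1 big_mkord; congr (_ - _).
  apply: eq_bigr => k _; rewrite mxE hat_beth_error//; first by ring.
  by rewrite /= ltn_ord.
split; first exact: sqintD.
apply: le_trans (ip_add_le _ sa sr) _ => //.
rewrite ip_sum_orthonormal//; last first.
  by move=> i j; rewrite phi_orthonormal// (inj_eq succn_inj).
rewrite lerD2l ler_wpM2l// -lee_fin EFin_ip//.
apply: le_trans (tailB l); rewrite le_eqVlt; apply/orP; left; apply/eqP.
apply: eq_integral => t _; rewrite sum_phiE /r; congr EFin; ring.
Qed.

Definition sampling_risk (u : times_space S) (w : noise_space S) : R :=
  \sum_(q : 'I_(ncov S) * 'I_K) sampling_term z (H q.1) q.2.+1 u w ^+ 2.

Definition effect_risk (w : noise_space S) : R :=
  \sum_(q : 'I_(ncov S) * 'I_K) effect_term z (H q.1) q.2.+1 w ^+ 2.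

Definition error_risk (u : times_space S) (w : noise_space S) : R :=
  \sum_(q : 'I_(ncov S) * 'I_K) error_term (H q.1) q.2.+1 u w ^+ 2.

Lemma ISE_le u w : ~ Nb w ->
  (ISE u w <= (6 * sampling_risk u w + (6 * effect_risk w +
    (6 * error_risk u w + 2 * B * (ncov S)%:R)))%:E)%E.
Proof.
move=> bw; have ce l := coordinate_error_le l u bw.
rewrite /ISE (_ : (\int[_]_(_ in _) _)%E =
    (\sum_(l < ncov S) ip mu I01 (fun t => hat_beta u w t l ord0 - betac S l t)
    (fun t => hat_beta u w t l ord0 - betac S l t))%:E); last first.
  rewrite (eq_bigr (fun l => \int[mu]_(t in I01)
    (hat_beta u w t l ord0 - betac S l t) ^+ 2)); last by move=> l _; rewrite ipE.
  rewrite -Rintegral_sum//; last by move=> l _; case: (ce l) => -[].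
  rewrite fineK//; apply: integrable_fin_num => //.
  by apply: integrable_sum_EFin => // l _; case: (ce l) => -[].
rewrite lee_fin.
apply: (@le_trans _ _ (\sum_(l < ncov S)
    (2 * (\sum_(k < K) coef_error l k.+1 u w ^+ 2) + 2 * B))).
  by apply: ler_sum => l _; case: (ce l).
rewrite big_split/= sumr_const card_ord mulr_natr !addrA lerD2r.
rewrite -mulr_sumr pair_big/= -!mulrDr -!big_split/= !mulr_sumr.
apply: ler_sum => q _; rewrite /coef_error.
set x := sampling_term _ _ _ _ _; set y := effect_term _ _ _ _; set y' := error_term _ _ _ _.
(* The three squares add up to [3 (x^2 + y^2 + y'^2) - (x + y + y')^2]. *)
have := sqr_ge0 (x - y); have := sqr_ge0 (x - y'); have := sqr_ge0 (y - y').
nra.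
Qed.

Let cstT c : (\int[PT]_u c%:E = c%:E)%E.
Proof. by rewrite integral_cst// [X in (_ * X)%E]probability_setT mule1. Qed.

Let cstN c : (\int[PN]_w c%:E = c%:E)%E.
Proof. by rewrite integral_cst// [X in (_ * X)%E]probability_setT mule1. Qed.

Let H2 l i : 0 <= H l i ^+ 2 * (m i)%:R^-1.
Proof. by rewrite mulr_ge0 ?sqr_ge0// invr_ge0. Qed.

Lemma integral_effect_risk_le :
  (\int[PN]_w (6 * effect_risk w)%:E <= (\sum_l \sum_i H l i ^+ 2 * (6 * v))%:E)%E.
Proof.
rewrite /effect_risk integral_sum_sqr; last first.
  move=> q; apply: sqint_sum => // i _; apply: sqintZ => //.
  exact: sqint_process_coef (hz i) _ _.
rewrite lee_fin -(pair_big xpredT xpredT (fun l (k : 'I_K) =>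
  ip PN setT (effect_term z (H l) k.+1) (effect_term z (H l) k.+1)))/=.
rewrite mulr_sumr; apply: ler_sum => l _.
have := effect_term_sqr_le hz z_uncorr (H l) K.
by rewrite -mulr_suml; set x := \sum_(k < K) _; set y := \sum_i _; lra.
Qed.

Lemma integral_error_risk_le u :
  (\int[PN]_w (6 * error_risk u w)%:E <=
   (\sum_l \sum_i H l i ^+ 2 * (m i)%:R^-1 * (K%:R * (12 * s2)))%:E)%E.
Proof.
have ee l (k : 'I_K) := error_term_sqr_le m_gt0 indep_eps eps_sq eps_mean eps_var
  (H l) u (ltn0Sn k).
rewrite /error_risk integral_sum_sqr; last by move=> q; case: (ee q.1 q.2).
rewrite lee_fin -(pair_big xpredT xpredT (fun l (k : 'I_K) =>
  ip PN setT (error_term (H l) k.+1 u) (error_term (H l) k.+1 u)))/=.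
rewrite mulr_sumr; apply: ler_sum => l _.
apply: (@le_trans _ _ (6 * \sum_(k < K) \sum_i H l i ^+ 2 / (m i)%:R * (2 * s2))).
  by rewrite ler_wpM2l//; apply: ler_sum => k _; case: (ee l k).
rewrite sumr_const card_ord -mulr_suml -mulr_suml -[X in 6 * X]mulr_natl le_eqVlt.
by apply/orP; left; apply/eqP; ring.
Qed.

Lemma measurable_sampling_risk :
  measurable_fun setT (fun uw : times_space S * noise_space S =>
    (6 * sampling_risk uw.1 uw.2)%:E).
Proof.
apply/measurable_EFinP; apply: measurable_funM => //.
apply: measurable_sum => q; apply: measurable_funX.
exact: (measurable_sampling_term timesS hz sf).
Qed.

Lemma sampling_risk_ge0 u w : 0 <= 6 * sampling_risk u w.
Proof. by rewrite mulr_ge0// sumr_ge0// => q _; exact: sqr_ge0. Qed.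

(** The bound on the sampling terms holds for fixed paths, so Tonelli first moves the integral over
    the times inside; the path energies that remain are then averaged over the noise. *)
Lemma integral_sampling_risk_le :
  (\int[PT]_u \int[PN]_w (6 * sampling_risk u w)%:E <=
   (\sum_l \sum_i H l i ^+ 2 * (m i)%:R^-1 * (K%:R * (24 * F + 24 * v)))%:E)%E.
Proof.
rewrite (fubini_tonelli _ measurable_sampling_risk)/=; last first.
  by move=> uw; rewrite lee_fin sampling_risk_ge0.
pose e i w := ip mu I01 (z i w) (z i w).
pose c l i := H l i ^+ 2 * (m i)%:R^-1 * K%:R * 24.
have aa l (k : 'I_K) w := sampling_term_sqr_le m_gt0 timesS hz sf fF (H l) w (ltn0Sn k).
have F0 (i : 'I_n) : 0 <= F by apply: le_trans (fF i); exact: ip_ge0.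
have c0 l i : 0 <= c l i by rewrite /c mulr_ge0// mulr_ge0 ?H2.
apply: (@le_trans _ _ (\int[PN]_w \sum_l \sum_i ((c l i)%:E * (F%:E + (e i w)%:E)))%E).
  apply: ge0_le_integralT => w.
    by apply: integral_ge0 => u _; rewrite lee_fin sampling_risk_ge0.
  rewrite /sampling_risk integral_sum_sqr; last by move=> q; case: (aa q.1 q.2 w).
  rewrite (eq_bigr (fun l => (\sum_i c l i * (F + e i w))%:E)); last first.
    by move=> l _; rewrite -sumEFin; apply: eq_bigr => i _; rewrite -EFinD -EFinM.
  rewrite sumEFin lee_fin -(pair_big xpredT xpredT (fun l (k : 'I_K) =>
    ip PT setT (sampling_term z (H l) k.+1 ^~ w) (sampling_term z (H l) k.+1 ^~ w)))/=.
  rewrite mulr_sumr; apply: ler_sum => l _.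
  apply: (@le_trans _ _ (6 * \sum_(k < K) \sum_i H l i ^+ 2 / (m i)%:R *
      (4 * F + 4 * e i w))).
    by rewrite ler_wpM2l//; apply: ler_sum => k _; case: (aa l k w).
  rewrite sumr_const card_ord -[X in 6 * X]mulr_natl mulrA mulr_sumr.
  by apply: ler_sum => i _; rewrite /c le_eqVlt; apply/orP; left; apply/eqP; ring.
have me i : measurable_fun setT (fun w => F%:E + (e i w)%:E)%E.
  apply: emeasurable_funD; first exact: measurable_cst.
  by apply/measurable_EFinP; exact: (measurable_process_energy (hz i)).
have e0 i w : (0 <= F%:E + (e i w)%:E)%E by rewrite -EFinD lee_fin addr_ge0 ?F0 ?ip_ge0.
have ce0 l i w : (0 <= (c l i)%:E * (F%:E + (e i w)%:E))%E by rewrite mule_ge0// lee_fin.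
rewrite ge0_integral_sum//; last 2 first.
- by move=> l; apply: emeasurable_sum => i; exact: measurable_funeM.
- by move=> l w _; exact: sume_ge0.
rewrite -sumEFin; apply: lee_sum => l _.
rewrite ge0_integral_sum//; last by move=> i; exact: measurable_funeM.
rewrite -sumEFin; apply: lee_sum => i _.
rewrite ge0_integralZl//; last by rewrite lee_fin.
rewrite ge0_integralD//; last 3 first.
- by move=> w _; rewrite lee_fin F0.
- by move=> w _; rewrite lee_fin ip_ge0.
- by apply/measurable_EFinP; exact: (measurable_process_energy (hz i)).
rewrite cstN.
apply: (@le_trans _ _ ((c l i)%:E * (F%:E + v%:E))%E).
  apply: lee_wpmul2l; first by rewrite lee_fin.
  by rewrite leeD2l//; exact: (process_energy_le (hz i)).
by rewrite -EFinD -EFinM lee_fin /c le_eqVlt; apply/orP; left; apply/eqP; ring.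
Qed.

Lemma MISE_le : (MISE S <=
  (\sum_l \sum_i H l i ^+ 2 *
     (6 * v + (m i)%:R^-1 * (K%:R * (24 * F + 24 * v + 12 * s2)))
   + (ncov S)%:R * (2 * B))%:E)%E.
Proof.
pose A u := (\int[PN]_w (6 * sampling_risk u w)%:E)%E.
pose C1 := \sum_l \sum_i H l i ^+ 2 * (6 * v).
pose C2 := \sum_l \sum_i H l i ^+ 2 * (m i)%:R^-1 * (K%:R * (12 * s2)).
pose C := C1 + (C2 + 2 * B * (ncov S)%:R).
have ISE_ge0 u w : (0 <= ISE u w)%E.
  by apply: integral_ge0 => t _; rewrite lee_fin sumr_ge0// => l _; exact: sqr_ge0.
have A0 u : (0 <= A u)%E by apply: integral_ge0 => w _; rewrite lee_fin sampling_risk_ge0.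
have mA : measurable_fun setT A.
  have h0 (uw : times_space S * noise_space S) : (0 <= (6 * sampling_risk uw.1 uw.2)%:E)%E.
    by rewrite lee_fin sampling_risk_ge0.
  exact: (measurable_fun_fubini_tonelli_F (m2 := PN) _ measurable_sampling_risk h0).
(* Nonnegativity of [B] needs a coordinate to read it from; without any coordinate the term
   [2 * B * ncov] is 0. *)
have B0 (l : 'I_(ncov S)) : 0 <= B.
  rewrite -lee_fin; apply: le_trans (tailB l).
  by apply: integral_ge0 => t _; rewrite lee_fin sqr_ge0.
have Bp : 0 <= 2 * B * (ncov S)%:R.
  case: (posnP (ncov S)) => [->|p0]; first by rewrite mulr0.
  by rewrite !mulr_ge0// (B0 (Ordinal p0)).
have r0 (I : finType) (X : I -> R) : 0 <= 6 * \sum_i X i ^+ 2.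
  by rewrite mulr_ge0// sumr_ge0// => i _; exact: sqr_ge0.
have mE w0 : measurable_fun setT (fun w => (6 * error_risk w0 w)%:E).
  apply/measurable_EFinP; apply: measurable_funM => //.
  apply: measurable_sum => q; apply: measurable_funX.
  by have [[]] := error_term_sqr_le m_gt0 indep_eps eps_sq eps_mean eps_var
    (H q.1) w0 (ltn0Sn q.2).
have mF : measurable_fun setT (fun w => (6 * effect_risk w)%:E).
  apply/measurable_EFinP; apply: measurable_funM => //.
  apply: measurable_sum => q; apply: measurable_funX; apply: measurable_sum => i.
  apply: measurable_funM => //.
  by have [] := sqint_process_coef (hz i) (ltn0Sn q.2).
have mS u : measurable_fun setT (fun w => (6 * sampling_risk u w)%:E).
  exact: (measurable_fun_pair2 u measurable_sampling_risk).
have inner u : (\int[PN]_w ISE u w <= A u + C%:E)%E.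
  apply: (@le_trans _ _ (\int[PN]_w ((6 * sampling_risk u w)%:E +
      ((6 * effect_risk w)%:E + ((6 * error_risk u w)%:E + (2 * B * (ncov S)%:R)%:E))))%E).
    (* Only the dominating function has to be measurable here; on [Nb] the paths of [xi] are not
       those of [z]. *)
    apply: (@ge0_ae_le_integralT _ _ _ _ _ _ Nb) => //.
    - by apply: emeasurable_funD => //; apply: emeasurable_funD => //; exact: emeasurable_funD.
    - by move=> w; rewrite -!EFinD lee_fin !addr_ge0// r0.
    - by move=> w bw; rewrite -!EFinD; exact: ISE_le.
  rewrite ge0_integralD//; last 3 first.
  - by move=> w _; rewrite lee_fin sampling_risk_ge0.
  - by move=> w _; rewrite -!EFinD lee_fin !addr_ge0// r0.
  - by apply: emeasurable_funD => //; exact: emeasurable_funD.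
  rewrite leeD2l// ge0_integralD//; last 3 first.
  - by move=> w _; rewrite lee_fin r0.
  - by move=> w _; rewrite -!EFinD lee_fin !addr_ge0// r0.
  - exact: emeasurable_funD.
  rewrite ge0_integralD//; last by move=> w _; rewrite lee_fin r0.
  rewrite cstN /C !EFinD.
  apply: leeD; first exact: integral_effect_risk_le.
  by rewrite leeD2r//; exact: integral_error_risk_le.
apply: (@le_trans _ _ (\int[PT]_u (A u + C%:E))%E).
  by apply: ge0_le_integralT => // u; apply: integral_ge0.
(* The sign of the error part is read off an integral at some [u], hence the argument. *)
have C0 (u : times_space S) : (0 <= C%:E)%E.
  rewrite lee_fin !addr_ge0//.
    rewrite -lee_fin; apply: le_trans integral_effect_risk_le.
    by apply: integral_ge0 => w _; rewrite lee_fin r0.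
  rewrite -lee_fin; apply: le_trans (integral_error_risk_le u).
  by apply: integral_ge0 => w _; rewrite lee_fin r0.
rewrite ge0_integralD//; last by move=> u _; exact: C0.
rewrite cstT.
apply: (@le_trans _ _ ((\sum_l \sum_i H l i ^+ 2 * (m i)%:R^-1 *
    (K%:R * (24 * F + 24 * v)))%:E + C%:E)%E).
  by rewrite leeD2r//; exact: integral_sampling_risk_le.
rewrite -EFinD lee_fin /C /C1 /C2 !addrA -!big_split/= le_eqVlt; apply/orP; left.
apply/eqP; congr (_ + _); last by ring.
apply: eq_bigr => l _; rewrite -!big_split/=; apply: eq_bigr => i _; ring.
Qed.

End RiskBound.

(** * The random effects, modified on a null set, as square integrable processes *)

Section EffectProcess.
Context {R : realType} {n : nat}.
Variable S : sample R n.
Local Notation mu := (@lebesgue_measure R).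
Local Notation I01 := (`]0 : R, 1[%classic : set R).
Local Notation PN := (noise_prob S).

Variable v : R.
Hypothesis xiS : effects_iid_centered S.
Hypothesis xi_le : forall i, (\int[PN]_w \int[mu]_(t in `]0%R, 1%R[)
  (xi S i w t ^+ 2)%:E <= v%:E)%E.

Let D01 : set (noise_space S * measurableTypeR R) := setT `*` `]0, 1[.

Let mD01 : measurable D01.
Proof. by apply: measurableX => //; exact: measurable_itv. Qed.

Let y i : noise_space S * measurableTypeR R -> R :=
  (fun wt => xi S i wt.1 wt.2) \_ D01.

Let my i : measurable_fun setT (y i).
Proof. by apply/(measurable_restrictT _ _).1 => //; case: xiS. Qed.

Let y_in i w t : I01 t -> y i (w, t) = xi S i w t.
Proof. by move=> t01; rewrite /y patchE mem_set. Qed.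

Let y_out i w t : ~ I01 t -> y i (w, t) = 0.
Proof. by move=> t01; rewrite /y patchE memNset// => -[]. Qed.

Let energy i w : \bar R := (\int[mu]_(t in I01) (xi S i w t ^+ 2)%:E)%E.

Let energy_ge0 i w : (0 <= energy i w)%E.
Proof. by apply: integral_ge0 => t _; rewrite lee_fin sqr_ge0. Qed.

Let measurable_energy i : measurable_fun setT (energy i).
Proof.
pose k (wt : noise_space S * measurableTypeR R) := (y i wt ^+ 2)%:E.
have mk : measurable_fun setT k by apply/measurable_EFinP; exact: measurable_funX.
have k0 wt : (0 <= k wt)%E by rewrite lee_fin sqr_ge0.
rewrite (_ : energy i = fubini_F mu k).
  exact: (measurable_fun_fubini_tonelli_F (m2 := mu) _ mk k0).
apply/funext => w; rewrite /fubini_F /energy /k [LHS]integral_mkcond.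
apply: eq_integral => t _; rewrite patchE; case: ifPn => [/set_mem t01|tI].
  by rewrite y_in.
by rewrite y_out ?expr0n//= => t01; move: tI; rewrite mem_set.
Qed.

(** Energies are nonnegative, so their sum is infinite exactly when one of them is: one exceptional
    set serves all individuals. *)
Definition infinite_energy : set (noise_space S) :=
  (fun w => \sum_i energy i w)%E @^-1` [set +oo%E].

Let measurable_total : measurable_fun setT (fun w => \sum_i energy i w)%E.
Proof. exact: emeasurable_sum. Qed.

Lemma measurable_infinite_energy : measurable infinite_energy.
Proof.
rewrite -[X in measurable X]setTI; apply: measurable_total => //.
Qed.

Lemma infinite_energy0 : PN infinite_energy = 0%E.
Proof.
have iQ : PN.-integrable setT (fun w => \sum_i energy i w)%E.
  apply/integrableP; split=> //.
  under eq_integral do rewrite gee0_abs ?sume_ge0//.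
  rewrite ge0_integral_sum//; apply: (@le_lt_trans _ _ (\sum_(i < n) v%:E)%E).
    by apply: lee_sum => i _; exact: xi_le.
  by rewrite sumEFin ltry.
have /negligibleP/= := integrable_ae measurableT iQ.
move=> h; apply/negligibleP; first exact: measurable_infinite_energy.
apply: negligibleS (integrable_ae measurableT iQ) => w /= wy h'.
by have := h' I; rewrite wy.
Qed.

(** The paths of [xi] are square integrable only almost surely, and they carry
    no information outside of the unit interval. *)
Definition effect_process i w t : R := y i (w, t) * \1_(~` infinite_energy) w.

Lemma effect_processE i w t : ~ infinite_energy w -> I01 t ->
  xi S i w t = effect_process i w t.
Proof.
by move=> bw t01; rewrite /effect_process y_in// indicE mem_set// mulr1.
Qed.

Lemma sqint_effect_process i : sqint_process PN (effect_process i) v.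
Proof.
have mi := measurable_infinite_energy.
split.
- apply: measurable_funM.
    by apply: (eq_measurable_fun (y i)) => // -[].
  apply: (@measurableT_comp _ _ _ _ _ _ (\1_(~` infinite_energy) : noise_space S -> R)).
    by apply: measurable_indic; exact: measurableC.
  exact: measurable_fst.
- by move=> w t t01; rewrite /effect_process y_out// mul0r.
- move=> w; have [bw|bw] := pselect (infinite_energy w).
    apply: (@eq_sqint _ _ _ mu I01 _ (cst 0)) => //.
      by move=> t _; rewrite /effect_process indicE memNset ?mulr0//= => /(_ bw).
    apply: (@sqint_bounded _ _ _ mu I01 _ _ 0) => //; last by move=> t _; rewrite normr0.
    by rewrite /= lebesgue_measure_itv/= lte01 ltry.
  apply: (@eq_sqint _ _ _ mu I01 _ (xi S i w)) => //.
    by move=> t /set_mem t01; rewrite effect_processE.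
  apply/sqintP => //; split.
    apply: (@eq_measurable_fun _ _ _ _ _ (fun t => y i (w, t))).
      by move=> t /set_mem t01; rewrite y_in.
    apply: measurable_funTS.
    exact: (measurable_fun_pair2 w (my i)).
  rewrite ltNge leye_eq; apply/negP => /eqP Q; apply: bw.
  rewrite /infinite_energy /= (bigD1 i)//= [energy i w]Q addye//.
  by rewrite -ltNye; apply: (@lt_le_trans _ _ 0%E); [exact: ltNy0|exact: sume_ge0].
- apply: le_trans (xi_le i); apply: ge0_le_integralT => w.
    by apply: integral_ge0 => t _; rewrite lee_fin sqr_ge0.
  have [bw|bw] := pselect (infinite_energy w).
    rewrite integral0_eq; first exact: energy_ge0.
    move=> t _; rewrite /effect_process indicE memNset ?mulr0 ?expr0n//= => /(_ bw).
  rewrite le_eqVlt; apply/orP; left; apply/eqP; apply: eq_integral => t /set_mem t01.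
  by rewrite effect_processE.
Qed.

Let msection i t : I01 t -> measurable_fun setT (xi S i ^~ t).
Proof.
move=> t01; apply: (@eq_measurable_fun _ _ _ _ _ (fun w => y i (w, t))).
  by move=> w _; rewrite y_in.
exact: (measurable_fun_pair1 t (my i)).
Qed.

(** The modification concerns a null set, so the integral is that of [xi], where independence
    factors it into two means, both 0. Square integrability of the sections is transferred to [xi]
    in the same way. *)
Lemma effect_process_uncorrelated i i' : i != i' -> forall s t, I01 s -> I01 t ->
  sqint PN setT (effect_process i ^~ s) -> sqint PN setT (effect_process i' ^~ t) ->
  ip PN setT (effect_process i ^~ s) (effect_process i' ^~ t) = 0.
Proof.
move=> ii' s t s01 t01 sz sz'.
have [_ indS _ meanS] := xiS.
have off (f g : noise_space S -> \bar R) : measurable_fun setT f ->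
    measurable_fun setT g -> (forall w, ~ infinite_energy w -> f w = g w) ->
    (\int[PN]_w f w = \int[PN]_w g w)%E.
  move=> mf mg fg; apply: ae_eq_integral => //.
  exists infinite_energy; split; [exact: measurable_infinite_energy|exact: infinite_energy0|].
  by move=> w /= h; apply: contrapT => bw; apply: h => _; exact: fg.
have sX k r : I01 r -> sqint PN setT (effect_process k ^~ r) ->
    sqint PN setT (xi S k ^~ r).
  move=> r01 /sqintP [mz z2]; apply/sqintP => //.
  have mx := msection k r01; split=> //; rewrite (off _ (fun w => (effect_process k w r ^+ 2)%:E))//.
  - by apply/measurable_EFinP; exact: measurable_funX.
  - by apply/measurable_EFinP; exact: measurable_funX.
  - by move=> w bw; rewrite effect_processE.
have sx := sX _ _ s01 sz; have sx' := sX _ _ t01 sz'.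
have mean0 k r : I01 r -> \int[PN]_w xi S k w r = 0.
  move=> r01; have := meanS k r r01; rewrite unlock => E.
  by rewrite /Rintegral E.
have -> : ip PN setT (effect_process i ^~ s) (effect_process i' ^~ t) =
    ip PN setT (xi S i ^~ s) (xi S i' ^~ t).
  congr fine; apply: off.
  - by case: sz => ? _; case: sz' => ? _; apply/measurable_EFinP; exact: measurable_funM.
  - by case: sx => ? _; case: sx' => ? _; apply/measurable_EFinP; exact: measurable_funM.
  - by move=> w bw; rewrite !effect_processE.
rewrite ip_independent//; first by rewrite mean0// mul0r.
move=> A B mA mB.
have memS k r C : I01 r -> measurable C ->
    sigma_of_process (xi S k) ((xi S k ^~ r) @^-1` C).
  move=> r01 mC; apply: sub_sigma_algebra; exists r => //.
  by exists C => //; rewrite setTI.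
by apply: (mutually_independent_pair indS ii'); exact: memS.
Qed.

End EffectProcess.

(** * From the upper bound to the asserted equality *)

Lemma eqO_seqP {R : realType} (f g : R^nat) : f =O_\oo g <->
  exists2 C : R, 0 < C & exists N : nat, forall n, (N <= n)%N -> `|f n| <= C * `|g n|.
Proof.
split=> [/eqO_exP[C C0 [N _ fN]]|[C C0 [N fN]]]; first by exists C => //; exists N.
by apply/eqO_exP; exists C => //; exists N.
Qed.

(** For a centred variable the variance is the extended integral of its square, so a finite variance
    also yields square integrability. *)
Lemma variance_centered {d : measure_display} {T : measurableType d} {R : realType}
    (P : probability T R) (X : {RV P >-> R}) (s : R) :
  ('E_P[X] = 0)%E -> ('V_P[X] = s%:E)%E ->
  [/\ sqint P setT X, \int[P]_w X w = 0 & ip P setT X X = s].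
Proof.
move=> EX VX.
have V2 : (\int[P]_w (X w ^+ 2)%:E = s%:E)%E.
  rewrite -VX /variance unlock EX unlock; apply: eq_integral => w _ /=.
  by rewrite -[X w]subr0 expr2.
have sX : sqint P setT X.
  by apply/sqintP; split; [exact: measurable_funPT|rewrite V2 ltry].
split=> //; first by move: EX; rewrite unlock /Rintegral => ->.
by apply: EFin_inj; rewrite EFin_ip.
Qed.

Section SampleRisk.
Context {R : realType} {n : nat}.
Variable S : sample R n.
Local Notation mu := (@lebesgue_measure R).
Local Notation I01 := (`]0 : R, 1[%classic : set R).
Local Notation H := (gram_inv S *m (design S)^T).

(** The inverse Gram matrix is symmetric, so the trailing factors form the transpose of [H], and the
    trace is a weighted sum of the squared entries of [H]. *)
Lemma mxtrace_risk (a b : R) : (forall i, (0 < nobs S i)%N) ->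
  \tr (gram_inv S *m (design S)^T *m (a *: 1%:M + b *: invmx (Mdiag S))
       *m design S *m gram_inv S) =
  \sum_l \sum_i H l i ^+ 2 * (a + b * (nobs S i)%:R^-1).
Proof.
move=> m0; pose e : 'rV[R]_n := \row_i (nobs S i)%:R^-1.
have MM : Mdiag S *m diag_mx e = 1%:M.
  rewrite /Mdiag mulmx_diag; apply/matrixP => i j; rewrite !mxE divff//.
  by rewrite pnatr_eq0 -lt0n m0.
have [uM _] := mulmx1_unit MM.
have -> : invmx (Mdiag S) = diag_mx e by rewrite -[LHS]mulmx1 -MM mulKmx.
have -> : a *: 1%:M + b *: diag_mx e = diag_mx (\row_i (a + b * (nobs S i)%:R^-1)).
  apply/matrixP => i j; rewrite !mxE; case: eqP => _ /=; rewrite ?mulr1n//.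
    by rewrite mulr1.
  by rewrite !mulr0n !mulr0 addr0.
rewrite -[_ *m design S *m _]mulmxA.
have -> : design S *m gram_inv S = H^T.
  by rewrite trmx_mul trmxK /gram_inv trmx_inv trmx_mul trmxK.
rewrite mul_mx_diag; apply: eq_bigr => l _; rewrite mxE; apply: eq_bigr => i _.
rewrite mxE [_^T _ _]mxE [X in _ * X * _]mxE; ring.
Qed.

Variables (alpha : nat) (L v : R) (r : 'I_n -> R).
Hypothesis alpha_ge2 : (2 <= alpha)%N.
Hypothesis wpS : well_posed S.
Hypothesis timesS : times_iid_uniform S.
Hypothesis errorsS : errors_iid S.
Hypothesis betaS : forall l, Wper alpha L (betac S l).
Hypothesis xbetaS : forall i, Wper alpha (r i) (xbeta S i).
Hypothesis xiS : effects_iid_centered S.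
Hypothesis xi_le : forall i, (\int[noise_prob S]_w \int[mu]_(t in `]0%R, 1%R[)
  (xi S i w t ^+ 2)%:E <= v%:E)%E.

Definition signal_energy : R :=
  \big[Num.max/0]_(i < n) (\int[mu]_(t in `]0, 1[) (xbeta S i t) ^+ 2)%R.

Lemma MISE_leP : exists2 th : R, 0 <= th <= 1 & MISE S =
  (\tr (gram_inv S *m (design S)^T *m
     ((th * (6 * v)) *: 1%:M +
      (th * ((trunc S)%:R * (24 * signal_energy + 24 * v + 12 * sigma2 S)))
        *: invmx (Mdiag S))
     *m design S *m gram_inv S)
   + th * ((ncov S)%:R * (2 * (L ^+ 2 * (trunc S)%:R ^- (2 * alpha)))))%:E.
Proof.
have [_ unitS m_gt0 K_gt0] := wpS.
have [_ indE meanE varE] := errorsS.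
have epsE i j := variance_centered (meanE i j) (varE i j).
have muI : (mu I01 < +oo)%E by rewrite /= lebesgue_measure_itv/= lte01 ltry.
have sf i : sqint mu I01 (xbeta S i) by exact: sqint_Wper alpha_ge2 (xbetaS i).
have fF i : ip mu I01 (xbeta S i) (xbeta S i) <= signal_energy.
  by rewrite ipE; apply: (le_bigmax _ (fun i => \int[mu]_(t in I01) xbeta S i t ^+ 2)).
have := MISE_le unitS m_gt0 timesS (sqint_effect_process xiS xi_le) sf fF
  (effect_process_uncorrelated xiS xi_le) indE
  (fun i j => let: And3 h _ _ := epsE i j in h)
  (fun i j => let: And3 _ h _ := epsE i j in h)
  (fun i j => let: And3 _ _ h := epsE i j in h)
  (fun l => sqint_Wper alpha_ge2 (betaS l))
  (fun l => Wper_remainder_le alpha_ge2 K_gt0 (betaS l))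
  (measurable_infinite_energy xiS) (infinite_energy0 xiS xi_le)
  (fun i w t => @effect_processE _ _ S i w t).
set U := (X in (_ <= X%:E)%E) => le_U.
have M0 : (0 <= MISE S)%E.
  apply: integral_ge0 => u _; apply: integral_ge0 => w _; apply: integral_ge0 => t _.
  by rewrite lee_fin sumr_ge0// => l _; exact: sqr_ge0.
have : MISE S \is a fin_num by rewrite ge0_fin_numE// (le_lt_trans le_U)// ltry.
move=> /fineK; set x := fine _ => xE.
move: M0 le_U; rewrite -xE !lee_fin => x0 xU.
have U0 : 0 <= U by exact: le_trans xU.
have [th th01 xthU] : exists2 th, 0 <= th <= 1 & x = th * U.
  (* If the bound is 0, so is the risk, and the ratio 0 serves. *)
  have [U00|Un0] := eqVneq U 0.
    by exists 0; rewrite ?lexx ?ler01// mul0r; apply/eqP; rewrite eq_le x0 -U00 xU.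
  exists (x / U); last by rewrite divfK.
  by rewrite divr_ge0//= ler_pdivrMr ?mul1r// lt_neqAle eq_sym Un0.
exists th => //; congr EFin; rewrite mxtrace_risk// xthU /U mulrDr; congr (_ + _).
rewrite mulr_sumr; apply: eq_bigr => l _; rewrite mulr_sumr; apply: eq_bigr => i _.
by ring.
Qed.

End SampleRisk.

Unset Implicit Arguments.

Theorem proposition3 (R : realType) (alpha : nat) (L : R) (g : R^nat)
    (S : forall n : nat, sample R n)
    (alpha_ge2 : (2 <= alpha)%N) (L_gt0 : 0 < L)
    (* g is an order of magnitude that does not vanish *)
    (g_bounded_below : (fun _ : nat => 1 : R) =O_\oo g)
    (S_well_posed : forall n, (0 < n)%N -> well_posed (S n))
    (* (i) *)
    (times_iid : forall n, (0 < n)%N -> times_iid_uniform (S n))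
    (errors_iid : forall n, (0 < n)%N -> errors_iid (S n))
    (errors_variance : (fun n => sigma2 (S n)) =O_\oo (fun _ : nat => 1 : R))
    (* (ii) *)
    (beta_smooth : forall n, (0 < n)%N ->
       forall l : 'I_(ncov (S n)), Wper alpha L (betac (S n) l))
    (beta_nonzero : forall n, (0 < n)%N -> sbeta (S n) = ncov (S n))
    (xbeta_smooth : exists2 r : R^nat, r =O_\oo g &
       forall n, (0 < n)%N -> forall i : 'I_n, Wper alpha (r n) (xbeta (S n) i))
    (xbeta_bounded :
       (fun n => \big[Num.max/0]_(i < n)
          (\int[lebesgue_measure]_(t in `]0, 1[) (xbeta (S n) i t) ^+ 2)%R)
         =O_\oo g)
    (* (iii) *)
    (xi_smooth : forall n, (0 < n)%N -> forall i : 'I_n,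
       \forall w \ae noise_prob (S n), Wper alpha L (xi (S n) i w))
    (xi_iid : forall n, (0 < n)%N -> effects_iid_centered (S n))
    (xi_bounded : exists2 v : R^nat, v =O_\oo (fun _ : nat => 1 : R) &
       forall n, (0 < n)%N -> forall i : 'I_n,
         (\int[noise_prob (S n)]_w \int[lebesgue_measure]_(t in `]0%R, 1%R[)
            ((xi (S n) i w t) ^+ 2)%:E <= (v n)%:E)%E) :
  exists a b c : R^nat,
    [/\ a =O_\oo (fun _ : nat => 1 : R),
        b =O_\oo (fun n => g n * (trunc (S n))%:R),
        c =O_\oo (fun n => (sbeta (S n))%:R * (trunc (S n))%:R ^- (2 * alpha) : R)
      & forall n, (0 < n)%N ->
          MISE (S n) =
          (\tr (gram_inv (S n) *m (design (S n))^T
                *m (a n *: 1%:M + b n *: invmx (Mdiag (S n)))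
                *m design (S n) *m gram_inv (S n)) + c n)%:E].
Proof.
(* The sequence of energy bounds is extracted by choice before [n] is fixed, so that the same one
   occurs for all [n]. The model says nothing at [n = 0], where any ratio does. *)
have : forall n, exists th : R, 0 <= th <= 1 /\ ((0 < n)%N -> MISE (S n) =
    (\tr (gram_inv (S n) *m (design (S n))^T *m
      ((th * (6 * (sval (cid2 xi_bounded) n))) *: 1%:M +
       (th * ((trunc (S n))%:R * (24 * signal_energy (S n) +
          24 * (sval (cid2 xi_bounded) n) + 12 * sigma2 (S n))))
       *: invmx (Mdiag (S n)))
      *m design (S n) *m gram_inv (S n))
    + th * ((ncov (S n))%:R *
        (2 * (L ^+ 2 * (trunc (S n))%:R ^- (2 * alpha)))))%:E).
  move=> n; have [n0|n0] := posnP n.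
    by exists 0; rewrite lexx ler01 n0.
  case: xbeta_smooth => r _ xbeta_r; case: cid2 => v /= _ xi_le.
  have [th th01 E] := MISE_leP alpha_ge2 (S_well_posed n n0) (times_iid n n0)
    (errors_iid n n0) (beta_smooth n n0) (xbeta_r n n0) (xi_iid n n0) (xi_le n n0).
  by exists th.
case: cid2 => v /= vO _ /choice[th thP].
have th_le n x : `|th n * x| <= `|x|.
  by have [/andP[? ?] _] := thP n; rewrite normrM ler_piMl// ger0_norm.
move/eqO_seqP: vO => [Cv Cv0 [Nv vO]].
move/eqO_seqP: errors_variance => [Cs Cs0 [Ns sO]].
move/eqO_seqP: g_bounded_below => [Cg Cg0 [Ng gO]].
move/eqO_seqP: xbeta_bounded => [Cf Cf0 [Nf fO]].
exists (fun n => th n * (6 * v n)).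
exists (fun n => th n * ((trunc (S n))%:R *
  (24 * signal_energy (S n) + 24 * v n + 12 * sigma2 (S n)))).
exists (fun n => th n * ((ncov (S n))%:R *
  (2 * (L ^+ 2 * (trunc (S n))%:R ^- (2 * alpha))))).
split; last by move=> n n0; have [_ ->] := thP n.
- apply/eqO_seqP; exists (6 * Cv); first by rewrite mulr_gt0.
  exists Nv => n nN; apply: le_trans (th_le _ _) _.
  by rewrite normrM ger0_norm// -mulrA ler_wpM2l// vO.
(* The bounded quantities [v] and [sigma2] become [O(g)] since [1 <= Cg * |g n|] eventually; this is
   the origin of the factor [Cg]. *)
- apply/eqO_seqP; exists (24 * Cf + (24 * Cv + 12 * Cs) * Cg).
    by rewrite addr_gt0 ?mulr_gt0 ?addr_gt0 ?mulr_gt0.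
  exists (Nv + Ns + Ng + Nf)%N => n nN; apply: le_trans (th_le _ _) _.
  rewrite !normrM [`|(trunc _)%:R|]ger0_norm// mulrA [leRHS]mulrC ler_wpM2l//.
  have := vO n ltac:(lia); have := sO n ltac:(lia).
  have := gO n ltac:(lia); have := fO n ltac:(lia).
  rewrite -/(signal_energy (S n)) normr1 !mulr1 => h1 h2 h3 h4.
  apply: (@le_trans _ _ (24 * `|signal_energy (S n)| + 24 * `|v n| + 12 * `|sigma2 (S n)|)).
    apply: le_trans (ler_normD _ _) _; apply: lerD.
      apply: le_trans (ler_normD _ _) _.
      by rewrite !normrM ger0_norm.
    by rewrite normrM ger0_norm.
  nra.
- apply/eqO_seqP; exists (2 * L ^+ 2); first by rewrite mulr_gt0 ?exprn_gt0.
  exists 1%N => n n0; apply: le_trans (th_le _ _) _.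
  (* The truncation error was summed over all [ncov] coordinates, which are the nonzero ones. *)
  rewrite beta_nonzero// [X in `|X| <= _](_ : _ = 2 * L ^+ 2 *
    ((ncov (S n))%:R / (trunc (S n))%:R ^+ (2 * alpha))); last by ring.
  by rewrite normrM ger0_norm// mulr_ge0 ?sqr_ge0.
Qed.
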